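(* Let $A$ be a self-adjoint operator in a Hilbert space $\mathcal H$ with an orthonormal basis of eigenvectors $\{\psi_n\}_{n\in\mathbb N}$, $A\psi_n=\mu_n\psi_n$, whose eigenvalues satisfy $\mu_1\ge 1$ and $\mu_{n+1}-\mu_n\ge 1$ for all $n\in\mathbb N$. Let $b$ be a sesquilinear form such that, for some $\alpha>0$ and $M_b>0$, $$|b(\psi_m,\psi_n)|\le \frac{M_b}{m^\alpha n^\alpha}\qquad\text{for all } m,n\in\mathbb N,$$ and let $T$ be the m-sectorial operator associated with the form $t=a+b$ (see context). Let $N$, $h$ and the Riesz projections $S_{N+1}$ and $P_n$, $n>N+1$, of $T$ be as described in the context, and let $P_n^0$ denote the one-dimensional spectral projection of $A$ corresponding to the eigenvalue $\mu_n$. Then there exists a bounded operator $W$ on $\mathcal H$ with bounded inverse such that $$W P_n W^{-1}=P_n^0\quad\text{for all } n>N+1,\qquad\text{and}\qquad W S_{N+1}W^{-1}=\sum_{n=1}^{N+1}P_n^0 .$$ Hence $\{S_{N+1},P_{N+2},P_{N+3},\dots\}$ is a Riesz system of projectors.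
   Context: Here $\mathbb N=\{1,2,\dots\}$. The form $a$ is $a(\phi,\psi)=\langle A^{1/2}\phi,A^{1/2}\psi\rangle$ with $\operatorname{Dom}(a)=\operatorname{Dom}(A^{1/2})$. Forms are linear in the first and antilinear in the second argument. The (not necessarily symmetric) form $b$ is defined on $\operatorname{Dom}(a)$ and is determined there by its values on the eigenvectors: for $f=\sum_j f_j\psi_j$ and $g=\sum_k g_k\psi_k$ in $\operatorname{Dom}(a)$ one has $b(f,g)=\sum_{j,k}f_j\overline{g_k}\,b(\psi_j,\psi_k)$ (the series converges absolutely under the assumption on $b(\psi_m,\psi_n)$). Under this assumption $b$ is form-bounded relative to $a$ with relative bound $0$, so $t:=a+b$ with $\operatorname{Dom}(t)=\operatorname{Dom}(a)$ is a closed sectorial form, and $T$ is the m-sectorial operator associated with $t$ by the first representation theorem; $T$ has compact resolvent. Functions: for $\gamma>0$ and integers $n>1$, $\sigma_\gamma(n):=n^{-\gamma}\log n$ if $\gamma\le1$ and $\sigma_\gamma(n):=n^{-1}$ if $\gamma>1$. For $h>1$, $\tau_\gamma(h):=h^{-\gamma}$ if $\gamma<1$, $\tau_\gamma(h):=h^{-1}\log(1+h)$ if $\gamma=1$, $\tau_\gamma(h):=h^{-1}$ if $\gamma>1$. Constants: $C(\gamma)>0$ is a constant such that for every integer $n>1$ and every $z\in\mathbb C$ with $\operatorname{Re}z\in[\mu_n-\tfrac12,\mu_{n+1}-\tfrac12]$ and $|z-\mu_n|\ge\tfrac12$ one has $\sum_{k=1}^\infty \frac{1}{k^\gamma|\mu_k-z|}\le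 C(\gamma)\sigma_\gamma(n)$. $D(\gamma)>0$ is a constant such that $\sum_{k=1}^\infty\frac1{k^\gamma(k+h)}\le D(\gamma)\tau_\gamma(h)$ for all $h>1$. Choice of $N$ and $h$: $N\in\mathbb N$ is such that $M_b\,C(2\alpha)\,\sigma_{2\alpha}(n)\le\frac12$ for all $n>N$, and $h>1$ is such that $2M_b\big(\frac1h\sum_{k=1}^{N+2}k^{-2\alpha}+D(2\alpha)\tau_{2\alpha}(h)\big)\le\frac12$. Riesz projections: $\Pi_0:=\{z\in\mathbb C:\ -h<\operatorname{Re}z<\mu_{N+1}+\tfrac12,\ |\operatorname{Im}z|<h\}$, $\Pi_k:=\{z\in\mathbb C: |z-\mu_k|<\tfrac12\}$ for $k\in\mathbb N$, $\Gamma_k:=\partial\Pi_k$ for $k\ge0$ (positively oriented). For such $N,h$ the contours $\Gamma_0$ and $\Gamma_j$, $j>N+1$, lie in the resolvent set of $T$, and $S_{N+1}:=\frac1{2\pi \mathrm i}\int_{\Gamma_0}(z-T)^{-1}\mathrm dz$, $P_j:=\frac1{2\pi\mathrm i}\int_{\Gamma_j}(z-T)^{-1}\mathrm dz$ for $j>N+1$. A Riesz system of projectors is a family of projections of the form $\{W^{-1}Q_jW\}_j$, where $W$ is bounded with bounded inverse and $\{Q_j\}_j$ is a complete family of mutually orthogonal orthogonal projections. *)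

(* Defs.v *)
From Stdlib Require Export Reals ClassicalEpsilon.
From Coquelicot Require Export Coquelicot.
From Stdlib Require Import Lra.
Open Scope R_scope.

(* The inner product is linear in its first argument. *)
Record HilbertSpace := {
  hspace :> CompleteNormedModule C_AbsRing;
  inner : hspace -> hspace -> C;
  inner_plus_l : forall u v w : hspace,
    inner (plus u v) w = Cplus (inner u w) (inner v w);
  inner_scal_l : forall (c : C) (u v : hspace),
    inner (scal c u) v = Cmult c (inner u v);
  inner_conj : forall u v : hspace, inner v u = Cconj (inner u v);
  inner_norm : forall u : hspace, inner u u = RtoC (norm u ^ 2)
}.

Arguments inner {h}.

(* Restriction of scalars from C to R, needed because [RInt] takes values in
   complete normed modules over R. *)
Section RestrictScalars.

Variable V : CompleteNormedModule C_AbsRing.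

Lemma rs_scal_assoc (x y : R_Ring) (u : V) :
  scal (RtoC x : C_AbsRing) (scal (RtoC y : C_AbsRing) u)
  = scal (RtoC (mult x y) : C_AbsRing) u.
Proof.
rewrite scal_assoc; apply (f_equal (fun c : C_AbsRing => scal c u)).
exact (eq_sym (RtoC_mult x y)).
Qed.

Lemma rs_scal_one (u : V) : scal (RtoC (one : R_Ring) : C_AbsRing) u = u.
Proof. exact (scal_one u). Qed.

Lemma rs_scal_distr_l (x : R_Ring) (u v : V) :
  scal (RtoC x : C_AbsRing) (plus u v)
  = plus (scal (RtoC x : C_AbsRing) u) (scal (RtoC x : C_AbsRing) v).
Proof. exact (scal_distr_l (RtoC x : C_AbsRing) u v). Qed.

Lemma rs_scal_distr_r (x y : R_Ring) (u : V) :
  scal (RtoC (plus x y) : C_AbsRing) u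
  = plus (scal (RtoC x : C_AbsRing) u) (scal (RtoC y : C_AbsRing) u).
Proof.
rewrite <- scal_distr_r; apply (f_equal (fun c : C_AbsRing => scal c u)).
exact (RtoC_plus x y).
Qed.

Definition rs_ModuleSpace_mixin :=
  ModuleSpace.Mixin R_Ring (CompleteNormedModule.AbelianGroup _ V)
    (fun (x : R) (u : V) => scal (RtoC x : C_AbsRing) u)
    rs_scal_assoc rs_scal_one rs_scal_distr_l rs_scal_distr_r.

Definition rs_ModuleSpace_class : ModuleSpace.class_of R_Ring V :=
  ModuleSpace.Class R_Ring V
    (AbelianGroup.class (CompleteNormedModule.AbelianGroup _ V))
    rs_ModuleSpace_mixin.

Definition rs_NormedModuleAux_class : NormedModuleAux.class_of R_AbsRing V :=
  NormedModuleAux.Class R_AbsRing V rs_ModuleSpace_class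
    (UniformSpace.class (CompleteNormedModule.UniformSpace _ V)).

Lemma rs_norm_scal (x : R_AbsRing) (u : V) :
  norm (scal (RtoC x : C_AbsRing) u) <= abs x * norm u.
Proof.
apply Rle_trans with (1 := norm_scal (RtoC x : C_AbsRing) u).
change (Cmod (RtoC x) * norm u <= Rabs x * norm u).
rewrite Cmod_R; apply Rle_refl.
Qed.

Definition rs_NormedModule_mixin :=
  NormedModule.Mixin R_AbsRing
    (NormedModuleAux.Pack R_AbsRing V rs_NormedModuleAux_class V)
    (fun u : V => norm u) (@norm_factor C_AbsRing V)
    norm_triangle rs_norm_scal
    (@norm_compat1 C_AbsRing V) (@norm_compat2 C_AbsRing V)
    (fun (u : V) (Hu : norm u = 0) => norm_eq_zero u Hu).

Definition rs_NormedModule_class : NormedModule.class_of R_AbsRing V :=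
  NormedModule.Class R_AbsRing V rs_NormedModuleAux_class
    rs_NormedModule_mixin.

Definition restrict_scalars : CompleteNormedModule R_AbsRing :=
  CompleteNormedModule.Pack R_AbsRing V
    (CompleteNormedModule.Class R_AbsRing V rs_NormedModule_class
       (CompleteNormedModule.mixin _ _ (CompleteNormedModule.class _ V))) V.

End RestrictScalars.

Section Hilbert.

Variable H : HilbertSpace.

(* The indices are 1, 2, 3, ...; the value [psi 0] plays no role. *)
Definition orthonormal_basis (psi : nat -> H) : Prop :=
  (forall m n : nat, (1 <= m)%nat -> (1 <= n)%nat ->
     inner (psi m) (psi n) = if Nat.eq_dec m n then RtoC 1 else RtoC 0) /\
  (forall f : H,
     is_series (fun k => scal (inner f (psi (S k))) (psi (S k))) f).

(* Coquelicot's [is_linear] means: linear and bounded. *)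
Definition bounded_inverse (W Winv : H -> H) : Prop :=
  is_linear W /\ is_linear Winv /\
  (forall f, W (Winv f) = f) /\ (forall f, Winv (W f) = f).

(* Unbounded operators: only the values of [app] on [dom] are meaningful. *)
Record operator := { dom : H -> Prop; app :> H -> H }.

Definition linear_operator (A : operator) : Prop :=
  dom A zero /\
  (forall u v, dom A u -> dom A v ->
     dom A (plus u v) /\ A (plus u v) = plus (A u) (A v)) /\
  (forall (c : C) u, dom A u -> dom A (scal c u) /\ A (scal c u) = scal c (A u)).

Definition densely_defined (A : operator) : Prop :=
  forall (f : H) (eps : posreal),
    exists u, dom A u /\ norm (minus f u) < eps.

Definition self_adjoint (A : operator) : Prop :=
  linear_operator A /\ densely_defined A /\
  forall v w : H,
    (dom A v /\ A v = w) <->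
    (forall u, dom A u -> inner (A u) v = inner u w).

Definition nonnegative (A : operator) : Prop :=
  forall u, dom A u -> 0 <= Re (inner (A u) u).

(* [B] is the nonnegative self-adjoint square root of [A]. *)
Definition is_sqrt_op (A B : operator) : Prop :=
  self_adjoint B /\ nonnegative B /\
  (forall u, dom A u <-> dom B u /\ dom B (B u)) /\
  (forall u, dom A u -> A u = B (B u)).

Definition orthogonal_projection (Q : H -> H) : Prop :=
  is_linear Q /\ (forall f, Q (Q f) = Q f) /\
  (forall f g, inner (Q f) g = inner f (Q g)).

(* For self-adjoint [A] the spectral projection of an eigenvalue is the
   orthogonal projection onto the eigenspace. *)
Definition eigen_projection (A : operator) (lambda : C) (Q : H -> H) : Prop :=
  orthogonal_projection Q /\
  (forall f, Q f = f <-> dom A f /\ A f = scal lambda f).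

Record form := { fdom : H -> Prop; fval :> H -> H -> C }.

Definition sesquilinear (b : form) : Prop :=
  (forall u v w, fdom b u -> fdom b v -> fdom b w ->
     b (plus u v) w = Cplus (b u w) (b v w)) /\
  (forall (c : C) u w, fdom b u -> fdom b w ->
     b (scal c u) w = Cmult c (b u w)) /\
  (forall u v w, fdom b u -> fdom b v -> fdom b w ->
     b w (plus u v) = Cplus (b w u) (b w v)) /\
  (forall (c : C) u w, fdom b u -> fdom b w ->
     b w (scal c u) = Cmult (Cconj c) (b w u)).

Definition form_of_sqrt (B : operator) : form :=
  {| fdom := dom B; fval := fun u v => inner (B u) (B v) |}.

Definition form_plus (a b : form) : form :=
  {| fdom := fun u => fdom a u /\ fdom b u;
     fval := fun u v => Cplus (a u v) (b u v) |}.

(* The operator [T] of the first representation theorem: [u] is in [dom T] and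
   [T u = w] iff [u] is in [fdom t] and [t u v = <w, v>] for all [v] in
   [fdom t]; [w] is unique because the form domain is dense. *)
Definition represents (t : form) (u w : H) : Prop :=
  fdom t u /\ forall v, fdom t v -> t u v = inner w v.

Definition form_operator (t : form) : operator :=
  {| dom := fun u => exists w, represents t u w;
     app := fun u => epsilon (inhabits zero) (represents t u) |}.

(* Absolute convergence of a double series, and its sum. *)
Definition is_double_series (u : nat -> nat -> C) (s : C) : Prop :=
  (exists M : R, forall n : nat,
     sum_n (fun j => sum_n (fun k => Cmod (u j k)) n) n <= M) /\
  filterlim (fun n => sum_n (fun j => sum_n (fun k => u j k) n) n)
    eventually (locally s).

Definition determined_by_matrix (psi : nat -> H) (b : form) : Prop :=
  forall f g, fdom b f -> fdom b g ->
    is_double_series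
      (fun j k => Cmult (Cmult (inner f (psi (S j)))
                               (Cconj (inner g (psi (S k)))))
                        (b (psi (S j)) (psi (S k))))
      (b f g).

Definition is_resolvent (T : operator) (z : C) (Rz : H -> H) : Prop :=
  is_linear Rz /\
  (forall f, dom T (Rz f) /\ minus (scal z (Rz f)) (T (Rz f)) = f) /\
  (forall u, dom T u -> Rz (minus (scal z u) (T u)) = u).

(* [(z - T)^-1] when [z] is in the resolvent set; unspecified otherwise. *)
Definition resolvent (T : operator) (z : C) : H -> H :=
  epsilon (inhabits (fun _ : H => zero)) (is_resolvent T z).

Definition path_derive (g : R -> C) (s : R) : C :=
  (Derive (fun x => Re (g x)) s, Derive (fun x => Im (g x)) s).

Definition path_integral (g : R -> C) (a b : R) (F : C -> H) : H :=
  @RInt (restrict_scalars H)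
    (fun s => scal (path_derive g s : C_AbsRing) (F (g s))) a b.

Definition segment_integral (z w : C) : (C -> H) -> H :=
  path_integral (fun s => Cplus z (Cmult (RtoC s) (Cminus w z))) 0 1.

Definition circle_integral (c : C) (r : R) : (C -> H) -> H :=
  path_integral (fun s => Cplus c (r * cos s, r * sin s)) 0 (2 * PI).

(* Boundary of [{x1 < Re z < x2, y1 < Im z < y2}]. *)
Definition rectangle_integral (x1 x2 y1 y2 : R) (F : C -> H) : H :=
  plus (plus (segment_integral (x1, y1) (x2, y1) F)
             (segment_integral (x2, y1) (x2, y2) F))
       (plus (segment_integral (x2, y2) (x1, y2) F)
             (segment_integral (x1, y2) (x1, y1) F)).

(* The contour integral of the resolvent, taken vector by vector (the integrand
   is norm-continuous along a contour in the resolvent set, so this is the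
   operator-norm integral). *)
Definition riesz_projection (oint : (C -> H) -> H) (T : operator) (f : H) : H :=
  scal (Cinv (Cmult (RtoC (2 * PI)) Ci) : C_AbsRing)
    (oint (fun z => resolvent T z f)).

Definition riesz_system (P : nat -> H -> H) : Prop :=
  exists (W Winv : H -> H) (Q : nat -> H -> H),
    bounded_inverse W Winv /\
    (forall j, orthogonal_projection (Q j)) /\
    (forall i j, i <> j -> forall f, Q i (Q j f) = zero) /\
    (forall f, is_series (fun j => Q j f) f) /\
    (forall j f, P j f = Winv (Q j (W f))).

End Hilbert.

Arguments orthonormal_basis {H}.
Arguments bounded_inverse {H}.
Arguments dom {H}.
Arguments app {H}.
Arguments self_adjoint {H}.
Arguments is_sqrt_op {H}.
Arguments eigen_projection {H}.
Arguments fdom {H}.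
Arguments fval {H}.
Arguments sesquilinear {H}.
Arguments form_of_sqrt {H}.
Arguments form_plus {H}.
Arguments form_operator {H}.
Arguments determined_by_matrix {H}.
Arguments riesz_projection {H}.
Arguments circle_integral {H}.
Arguments rectangle_integral {H}.
Arguments riesz_system {H}.

Definition sigma (gamma : R) (n : nat) : R :=
  if Rle_dec gamma 1 then Rpower (INR n) (- gamma) * ln (INR n) else / INR n.

Definition tau (gamma h : R) : R :=
  if Rlt_dec gamma 1 then Rpower h (- gamma)
  else if Req_dec_T gamma 1 then / h * ln (1 + h)
  else / h.

Definition series_le (u : nat -> R) (M : R) : Prop :=
  ex_series u /\ Series u <= M.

Definition is_C_constant (mu : nat -> R) (gamma Cgamma : R) : Prop :=
  0 < Cgamma /\
  forall (n : nat) (z : C), (1 < n)%nat ->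
    mu n - 1 / 2 <= Re z <= mu (n + 1)%nat - 1 / 2 ->
    1 / 2 <= Cmod (Cminus z (RtoC (mu n))) ->
    series_le
      (fun k => / (Rpower (INR (S k)) gamma *
                   Cmod (Cminus (RtoC (mu (S k))) z)))
      (Cgamma * sigma gamma n).

Definition is_D_constant (gamma Dgamma : R) : Prop :=
  0 < Dgamma /\
  forall h : R, 1 < h ->
    series_le
      (fun k => / (Rpower (INR (S k)) gamma * (INR (S k) + h)))
      (Dgamma * tau gamma h).

(* Main.v *)
Require Import Defs.
From Stdlib Require Import ssreflect Compare_dec List Lra Lia Psatz FunctionalExtensionality.
Open Scope general_if_scope.

(** The coupling is switched on gradually. For [s] in [[0,1]] let [T(s)] be the operator
    of the form [a + s b], and let [Q_i(s)] be its Riesz projection over the rectangle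
    ([i = 0]) or over the disc of radius [1/2] about the [(N + 1 + i)]-th eigenvalue
    ([i >= 1]). At [s = 0] these are sums of spectral projections of [A], at [s = 1]
    they are [S_(N+1), P_(N+2), P_(N+3)] and so on. The families [Q(s)] and [Q(s')] turn
    out to be similar when [|s - s'|] is below a fixed step length, so finitely many
    steps join the two ends. Completeness travels along with the similarity: no
    comparison of ranks or indices of projections is needed.

    The resolvent is constructed in the form sense. Testing [(z - A - s B) u = f] with
    the eigenvectors gives [(z - mu_k) u_k = f_k + s b(u, psi_k)], and
    [|b(u, psi_k)| <= M_b v_k sum_j v_j |u_j|] with [v_k = k^(-alpha)]. The choice of [N]
    and [h] makes [M_b sum_k v_k^2 / |z - mu_k|] at most [1/2] on all contours, hence at
    most [2/3] nearby; there the equation has exactly one solution for every [s]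
    ([weak_exists], [weak_unique]). Uniqueness gives linearity and the resolvent
    identity, and at [s = 1] the solution operator is the resolvent of [T]
    ([form_resolvent_is_resolvent]).

    That the [Q_i(s)] are idempotent and annihilate each other follows from the
    resolvent identity, by exchanging the order of two contour integrals and counting
    windings ([double_contour_int], [riesz_integral_product]). The contours may touch,
    so each integral is first moved to a slightly smaller contour, which Cauchy's
    theorem in the form of homotopy invariance permits ([homotopy]).

    The quantitative heart is the bound
    [|<(R_s(z) - R_s'(z)) f, g>| <= 9 M_b |s - s'| q(f) q(g)], where
    [q(f) = sum_k v_k |f_k| / |z - mu_k|] ([weak_difference]). On the circle about
    [mu_n] the spacing of the eigenvalues gives [q(f) <= 4 K_n(f)] with
    [K_n(f) = sum_k v_k |f_k| / (1 + |n - k|)] ([dual_norm_circle]). The kernel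
    [v_n v_k / (1 + |n - k|)] is dominated by [(1 + |n - k|)^(-1-alpha)], whose rows and
    columns have bounded sums; by Schur's test [sum_n (v_n K_n(f))^2 <= c |f|^2]
    ([kernel_sum_square]). For this part [alpha] is replaced by a small exponent if
    necessary.

    Consequently [U = sum_i Q_i(s') Q_i(s)] differs from the identity by at most
    [|s - s'|] times a constant. For small [|s - s'|] it is invertible, and it
    intertwines the two families ([similar_step], [similar_0_1]). Composing the steps
    gives [W]; a family similar to the complete orthogonal family of blocks of spectral
    projections of [A] is a Riesz system. *)

(** * Series of nonnegative reals *)

Lemma nonneg_series (u : nat -> R) (M : R) :
  (forall n, 0 <= u n) -> (forall n, sum_n u n <= M) ->
  ex_series u /\ Series u <= M.
Proof.
intros Hu HM.
assert (Hex : ex_finite_lim_seq (sum_n u)).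
{ apply ex_finite_lim_seq_incr with M; auto.
  intros n; rewrite sum_Sn; change plus with Rplus; specialize (Hu (S n)); lra. }
split.
- destruct Hex as [l Hl]; exists l; exact Hl.
- unfold Series. destruct Hex as [l Hl].
  rewrite (is_lim_seq_unique _ _ Hl); simpl.
  exact (is_lim_seq_le _ _ l M HM Hl (is_lim_seq_const M)).
Qed.

Lemma sum_n_le_Series (u : nat -> R) (n : nat) :
  (forall k, 0 <= u k) -> ex_series u -> sum_n u n <= Series u.
Proof.
intros Hu [l Hl].
rewrite (is_series_unique _ _ Hl).
refine (is_lim_seq_incr_compare (sum_n u) l Hl _ n).
intros k; rewrite sum_Sn; change plus with Rplus; specialize (Hu (S k)); lra.
Qed.

Lemma sum_n_nonneg (u : nat -> R) (n : nat) : (forall k, 0 <= u k) -> 0 <= sum_n u n.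
Proof.
intros Hu; induction n as [|n IH]; rewrite ?sum_O ?sum_Sn; auto.
change plus with Rplus; specialize (Hu (S n)); lra.
Qed.

Lemma sum_n_le_sum_n (u w : nat -> R) (n : nat) :
  (forall k, u k <= w k) -> sum_n u n <= sum_n w n.
Proof.
intros Hu; induction n as [|n IH]; rewrite ?sum_O ?sum_Sn; auto.
change (sum_n u n + u (S n) <= sum_n w n + w (S n)); specialize (Hu (S n)); lra.
Qed.

Lemma term_le_sum_n (u : nat -> R) (n k : nat) :
  (forall j, 0 <= u j) -> (k <= n)%nat -> u k <= sum_n u n.
Proof.
intros Hu; induction n as [|n IH]; intros Hk.
- replace k with 0%nat by lia; rewrite sum_O; lra.
- rewrite sum_Sn; change (u k <= sum_n u n + u (S n)).
  destruct (Nat.eq_dec k (S n)) as [->|Hne].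
  + pose proof (sum_n_nonneg u n Hu); lra.
  + pose proof (IH ltac:(lia)); specialize (Hu (S n)); lra.
Qed.

Lemma term_le_Series (u : nat -> R) (k : nat) :
  (forall j, 0 <= u j) -> ex_series u -> u k <= Series u.
Proof.
intros Hu Hex; apply Rle_trans with (sum_n u k).
- apply term_le_sum_n; auto.
- now apply sum_n_le_Series.
Qed.

Lemma Series_nonneg (u : nat -> R) : (forall j, 0 <= u j) -> ex_series u -> 0 <= Series u.
Proof. intros Hu Hex; apply Rle_trans with (u 0%nat); auto; now apply term_le_Series. Qed.

Lemma ex_series_dominated (u w : nat -> R) :
  (forall k, 0 <= u k <= w k) -> ex_series w -> ex_series u.
Proof.
intros Hu Hw; apply (ex_series_le (V := R_CompleteNormedModule) u w); auto.
intros n; change (Rabs (u n) <= w n); rewrite Rabs_pos_eq; apply Hu.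
Qed.

Lemma ex_series_ext_R (u w : nat -> R) : (forall k, u k = w k) -> ex_series u -> ex_series w.
Proof. intros E; exact (ex_series_ext u w E). Qed.

Lemma ex_series_scal_R (c : R) (u : nat -> R) :
  ex_series u -> ex_series (fun k => c * u k).
Proof. intros Hu; exact (ex_series_scal_l c u Hu). Qed.

Lemma ex_series_scal_R_r (c : R) (u : nat -> R) :
  ex_series u -> ex_series (fun k => u k * c).
Proof. intros Hu; exact (ex_series_scal_r c u Hu). Qed.

Lemma ex_series_plus_R (u w : nat -> R) :
  ex_series u -> ex_series w -> ex_series (fun k => u k + w k).
Proof. intros Hu Hw; exact (ex_series_plus u w Hu Hw). Qed.

(** The quadratic form [sum (s a k + t b k)^2] in [s] and [t] is nonnegative, so its
    discriminant is not positive. *)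
Lemma sum_n_cauchy_schwarz (a b : nat -> R) (n : nat) :
  (sum_n (fun k => a k * b k) n) ^ 2
  <= sum_n (fun k => a k ^ 2) n * sum_n (fun k => b k ^ 2) n.
Proof.
set (X := sum_n (fun k => a k ^ 2) n); set (Y := sum_n (fun k => b k ^ 2) n).
set (Z := sum_n (fun k => a k * b k) n).
assert (Hq : forall s t : R, 0 <= s ^ 2 * X + 2 * s * t * Z + t ^ 2 * Y).
{ intros s t; unfold X, Y, Z; clear X Y Z.
  induction n as [|n IH]; rewrite ?sum_O ?sum_Sn.
  - replace (s ^ 2 * a 0%nat ^ 2 + 2 * s * t * (a 0%nat * b 0%nat) + t ^ 2 * b 0%nat ^ 2)
      with ((s * a 0%nat + t * b 0%nat) ^ 2) by ring. apply pow2_ge_0.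
  - change plus with Rplus.
    pose proof (pow2_ge_0 (s * a (S n) + t * b (S n))). nra. }
assert (HX : 0 <= X) by (specialize (Hq 1 0); nra).
assert (HY : 0 <= Y) by (specialize (Hq 0 1); nra).
pose proof (Hq Y (- Z)) as H1.
destruct (Req_dec Y 0) as [HY0|HY0].
- pose proof (Hq Z (- (X + 1) / 2)) as H2. rewrite HY0 in H2 |- *. nra.
- assert (0 < Y) by lra. apply Rmult_le_reg_l with Y; nra.
Qed.

Lemma series_cauchy_schwarz (a b : nat -> R) :
  (forall k, 0 <= a k) -> (forall k, 0 <= b k) ->
  ex_series (fun k => a k ^ 2) -> ex_series (fun k => b k ^ 2) ->
  ex_series (fun k => a k * b k) /\
  (Series (fun k => a k * b k)) ^ 2
    <= Series (fun k => a k ^ 2) * Series (fun k => b k ^ 2).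
Proof.
intros Ha Hb Hxa Hxb.
set (X := Series (fun k => a k ^ 2)); set (Y := Series (fun k => b k ^ 2)).
assert (HX : 0 <= X) by (apply Series_nonneg; auto; intros; apply pow2_ge_0).
assert (HY : 0 <= Y) by (apply Series_nonneg; auto; intros; apply pow2_ge_0).
assert (Hp : forall k, 0 <= a k * b k) by (intros; now apply Rmult_le_pos).
destruct (nonneg_series (fun k => a k * b k) (sqrt (X * Y))) as [Hex Hle]; auto.
{ intros n.
  apply Rsqr_incr_0_var; [|apply sqrt_pos].
  rewrite Rsqr_sqrt; [|now apply Rmult_le_pos].
  rewrite Rsqr_pow2.
  apply Rle_trans with (1 := sum_n_cauchy_schwarz a b n).
  apply Rmult_le_compat.
  - apply sum_n_nonneg; intros; apply pow2_ge_0.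
  - apply sum_n_nonneg; intros; apply pow2_ge_0.
  - apply (sum_n_le_Series (fun k => a k ^ 2)); auto; intros; apply pow2_ge_0.
  - apply (sum_n_le_Series (fun k => b k ^ 2)); auto; intros; apply pow2_ge_0. }
split; auto.
rewrite <- (pow2_sqrt (X * Y)); [|now apply Rmult_le_pos].
apply pow_incr; split; auto. now apply Series_nonneg.
Qed.

(** * Inner products *)

Section InnerProduct.

Variable H : HilbertSpace.
Implicit Types u v w : H.

Lemma inner_plus_r u v w : inner u (plus v w) = Cplus (inner u v) (inner u w).
Proof.
rewrite (inner_conj _ (plus v w) u) inner_plus_l Cplus_conj.
now rewrite <- (inner_conj _ v u), <- (inner_conj _ w u).
Qed.

Lemma inner_scal_r (c : C) u v : inner u (scal c v) = Cmult (Cconj c) (inner u v).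
Proof. rewrite (inner_conj _ (scal c v) u) inner_scal_l Cmult_conj; now rewrite <- (inner_conj _ v u). Qed.

Lemma inner_zero_l v : inner zero v = 0.
Proof.
pose proof (inner_plus_l _ zero zero v) as E; rewrite plus_zero_l in E.
destruct (inner zero v) as [x y]; injection E; intros E2 E1.
unfold RtoC; f_equal; lra.
Qed.

Lemma inner_zero_r v : inner v zero = 0.
Proof.
rewrite inner_conj inner_zero_l. unfold Cconj; simpl. now rewrite Ropp_0.
Qed.

Lemma inner_opp_l u v : inner (opp u) v = (- inner u v)%C.
Proof.
pose proof (inner_plus_l _ (opp u) u v) as E.
rewrite plus_opp_l inner_zero_l in E.
destruct (inner (opp u) v) as [x y], (inner u v) as [x' y']; injection E; intros E2 E1.
unfold Copp; simpl; f_equal; lra.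
Qed.

Lemma inner_opp_r u v : inner u (opp v) = (- inner u v)%C.
Proof. rewrite (inner_conj _ (opp v) u) inner_opp_l Copp_conj; now rewrite <- (inner_conj _ v u). Qed.

Lemma inner_minus_l u v w : inner (minus u v) w = (inner u w - inner v w)%C.
Proof. unfold minus; rewrite inner_plus_l inner_opp_l; ring. Qed.

Lemma inner_minus_r u v w : inner w (minus u v) = (inner w u - inner w v)%C.
Proof. unfold minus; rewrite inner_plus_r inner_opp_r; ring. Qed.

Lemma norm_sqr_inner u : norm u ^ 2 = Re (inner u u).
Proof. now rewrite inner_norm. Qed.

Lemma inner_self_zero u : inner u u = 0 -> u = zero.
Proof.
intros E; refine (norm_eq_zero u _).
assert (E2 : norm u ^ 2 = 0) by now rewrite norm_sqr_inner E.
pose proof (norm_ge_0 u); nra.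
Qed.

Lemma inner_ext u v : (forall w, inner u w = inner v w) -> u = v.
Proof.
intros E.
assert (Z : minus u v = zero).
{ apply inner_self_zero; rewrite inner_minus_l E; ring. }
transitivity (plus (minus u v) v).
- unfold minus; rewrite <- plus_assoc, plus_opp_l; symmetry; apply plus_zero_r.
- rewrite Z; apply plus_zero_l.
Qed.

Lemma norm_scal_eq (c : C) u : norm (scal c u) = Cmod c * norm u.
Proof.
apply Rsqr_inj.
- apply norm_ge_0.
- apply Rmult_le_pos; [apply Cmod_ge_0|apply norm_ge_0].
- rewrite !Rsqr_pow2 norm_sqr_inner inner_scal_l inner_scal_r inner_norm.
  rewrite Rpow_mult_distr Cmod2_alt; unfold Re, Im; destruct c as [x y]; simpl; ring.
Qed.

Lemma cauchy_schwarz u v : Cmod (inner u v) <= norm u * norm v.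
Proof.
pose proof (norm_ge_0 u) as Hu; pose proof (norm_ge_0 v) as Hv.
destruct (Req_dec (norm v) 0) as [Hv0|Hv0].
- rewrite (norm_eq_zero _ Hv0) inner_zero_r Cmod_0; apply Rmult_le_pos; auto; apply norm_ge_0.
- set (c := inner u v).
  (* [|v|^2 u - <u,v> v] is orthogonal to [v] and avoids a division *)
  set (w := (minus (scal (RtoC (norm v ^ 2) : C_AbsRing) u) (scal (c : C_AbsRing) v)) : H).
  pose proof (norm_ge_0 w) as Hw.
  assert (E : norm w ^ 2 = norm v ^ 2 * (norm u ^ 2 * norm v ^ 2 - Cmod c ^ 2)).
  { rewrite norm_sqr_inner; unfold w; rewrite inner_minus_l !inner_minus_r !inner_scal_l !inner_scal_r !inner_norm.
    rewrite (inner_conj _ u v); fold c. rewrite Cmod2_alt.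
    destruct c as [x y]; unfold Re, Im; simpl; ring. }
  assert (0 < norm v ^ 2) by nra.
  apply Rsqr_incr_0_var; [|now apply Rmult_le_pos].
  rewrite !Rsqr_pow2. rewrite Rpow_mult_distr. nra.
Qed.

Lemma inner_linear v : is_linear (fun u => (inner u v : C_NormedModule)).
Proof.
split.
- intros x y; apply inner_plus_l.
- intros c x; apply inner_scal_l.
- exists (norm v + 1); split.
  + pose proof (norm_ge_0 v); lra.
  + intros x; change (Cmod (inner x v) <= (norm v + 1) * norm x).
    apply Rle_trans with (1 := cauchy_schwarz x v).
    pose proof (norm_ge_0 x); pose proof (norm_ge_0 v); nra.
Qed.

Lemma inner_sum_n (a : nat -> H) v n :
  inner (sum_n a n) v = sum_n (fun k => inner (a k) v) n.
Proof.
induction n as [|n IH]; rewrite ?sum_O ?sum_Sn; auto.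
now rewrite inner_plus_l IH.
Qed.

End InnerProduct.

Lemma is_linear_series {K : AbsRing} {U V : NormedModule K} (l : U -> V)
  (a : nat -> U) (s : U) :
  is_linear l -> is_series a s -> is_series (fun k => l (a k)) (l s).
Proof.
intros Hl Ha.
apply filterlim_ext with (fun n => l (sum_n a n)).
- intros n; induction n as [|n IH]; rewrite ?sum_O ?sum_Sn; auto.
  now rewrite (linear_plus l Hl) IH.
- apply filterlim_comp with (locally s); auto.
  now apply linear_cont.
Qed.

Lemma inner_series (H : HilbertSpace) (a : nat -> H) (s v : H) :
  is_series a s ->
  is_series (fun k => inner (a k) v : C_NormedModule) (inner s v).
Proof. intros Ha; exact (is_linear_series _ a s (inner_linear H v) Ha). Qed.

Lemma norm_le_of_inner (H : HilbertSpace) (u : H) (M : R) :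
  0 <= M -> (forall v, Cmod (inner u v) <= M * norm v) -> norm u <= M.
Proof.
intros HM Hb; specialize (Hb u); rewrite inner_norm Cmod_R in Hb.
pose proof (norm_ge_0 u).
rewrite Rabs_pos_eq in Hb; [|apply pow2_ge_0].
destruct (Req_dec (norm u) 0); [lra|].
apply Rmult_le_reg_r with (norm u); [lra|]; lra.
Qed.

Lemma is_series_norm {K : AbsRing} {V : NormedModule K} (a : nat -> V) (l : V) :
  is_series a l <->
  (forall eps : posreal, exists N, forall n, (N <= n)%nat -> norm (minus (sum_n a n) l) < eps).
Proof. exact (filterlim_locally_ball_norm (F := eventually) (sum_n a) l). Qed.

Lemma is_series_R (a : nat -> R) (l : R) :
  is_series a l <->
  (forall eps : posreal, exists N, forall n, (N <= n)%nat -> Rabs (sum_n a n - l) < eps).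
Proof. exact (is_series_norm (V := R_NormedModule) a l). Qed.

Lemma is_series_C (a : nat -> C) (l : C) :
  is_series (V := C_NormedModule) a l <->
  (forall eps : posreal, exists N, forall n, (N <= n)%nat -> Cmod (sum_n a n - l)%C < eps).
Proof. exact (is_series_norm (V := C_NormedModule) a l). Qed.

Lemma Re_sum_n (a : nat -> C) n : Re (sum_n a n) = sum_n (fun k => Re (a k)) n.
Proof.
induction n as [|n IH]; rewrite ?sum_O ?sum_Sn; auto.
change (Re (sum_n a n) + Re (a (S n)) = plus (sum_n (fun k => Re (a k)) n) (Re (a (S n)))).
now rewrite IH.
Qed.

Lemma is_series_Re (a : nat -> C) (l : C) :
  is_series (V := C_NormedModule) a l -> is_series (fun k => Re (a k)) (Re l).
Proof.
intros Ha; apply is_series_R; intros eps.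
destruct (proj1 (is_series_C a l) Ha eps) as [N HN]; exists N; intros n Hn.
apply Rle_lt_trans with (2 := HN n Hn).
rewrite <- Re_sum_n.
change (Rabs (Re (sum_n a n - l)%C) <= Cmod (sum_n a n - l)%C); apply re_le_Cmod.
Qed.

Lemma Cmod_sum_n (a : nat -> C) n : Cmod (sum_n a n) <= sum_n (fun k => Cmod (a k)) n.
Proof.
induction n as [|n IH]; rewrite ?sum_O ?sum_Sn; [lra|].
apply Rle_trans with (1 := Cmod_triangle _ _).
change (Cmod (sum_n a n) + Cmod (a (S n)) <= sum_n (fun k => Cmod (a k)) n + Cmod (a (S n))).
lra.
Qed.

Lemma is_series_C_unique (a : nat -> C) (l l' : C) :
  is_series (V := C_NormedModule) a l -> is_series (V := C_NormedModule) a l' -> l = l'.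
Proof. intros H1 H2; exact (filterlim_locally_unique (V := C_NormedModule) _ l l' H1 H2). Qed.

Lemma is_series_C_single (a : nat -> C) (c : C) (i : nat) :
  (forall k, a k = if Nat.eq_dec k i then c else RtoC 0) -> is_series (V := C_NormedModule) a c.
Proof.
intros Ha.
assert (Hz : forall m, sum_n a m = if le_dec i m then c else RtoC 0).
{ induction m as [|m IH]; rewrite ?sum_O ?sum_Sn Ha.
  - destruct (Nat.eq_dec 0 i), (le_dec i 0); auto; lia.
  - rewrite IH.
    destruct (Nat.eq_dec (S m) i), (le_dec i (S m)), (le_dec i m); try lia;
      [apply Cplus_0_l|apply Cplus_0_r|apply Cplus_0_r]. }
apply is_series_C; intros eps; exists i; intros n Hn.
rewrite Hz; destruct (le_dec i n); [|lia].
replace (c - c)%C with (RtoC 0) by ring. rewrite Cmod_0; apply cond_pos.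
Qed.

(** Closed balls are closed. *)
Lemma is_series_C_bound (a : nat -> C) (l : C) (M : R) :
  is_series (V := C_NormedModule) a l -> (forall n, Cmod (sum_n a n) <= M) -> Cmod l <= M.
Proof.
intros Ha HM; apply Rnot_lt_le; intros Hlt.
destruct (proj1 (is_series_C a l) Ha (mkposreal (Cmod l - M) ltac:(lra))) as [N HN].
specialize (HN N (Nat.le_refl _)); simpl in HN.
pose proof (Cmod_triangle (sum_n a N) (- (sum_n a N - l))%C) as Ht.
replace (sum_n a N + - (sum_n a N - l))%C with l in Ht by (apply injective_projections; simpl; ring).
rewrite Cmod_opp in Ht; specialize (HM N); lra.
Qed.

Lemma is_series_C_Series_bound (a : nat -> C) (l : C) (w : nat -> R) :
  is_series (V := C_NormedModule) a l -> (forall k, Cmod (a k) <= w k) -> ex_series w ->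
  Cmod l <= Series w.
Proof.
intros Ha Hw Hex; apply (is_series_C_bound a); auto; intros n.
apply Rle_trans with (1 := Cmod_sum_n a n).
apply Rle_trans with (sum_n w n).
- now apply sum_n_le_sum_n.
- apply sum_n_le_Series; auto; intros k; apply Rle_trans with (2 := Hw k); apply Cmod_ge_0.
Qed.

Record bounded_sesquilinear (H : HilbertSpace) (M : R) (B : H -> H -> C) : Prop := {
  bs_plus_l : forall u v w, B (plus u v) w = Cplus (B u w) (B v w);
  bs_scal_l : forall (c : C) u w, B (scal c u) w = Cmult c (B u w);
  bs_plus_r : forall u v w, B w (plus u v) = Cplus (B w u) (B w v);
  bs_scal_r : forall (c : C) u w, B w (scal c u) = Cmult (Cconj c) (B w u);
  bs_bound : forall u v, Cmod (B u v) <= M * norm u * norm v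
}.

Lemma additive_minus (H : HilbertSpace) (L : H -> C) (x y : H) :
  (forall u v, L (plus u v) = Cplus (L u) (L v)) -> L (minus x y) = (L x - L y)%C.
Proof.
intros HL.
assert (E : L x = (L (minus x y) + L y)%C).
{ rewrite <- HL; f_equal; apply inner_ext; intros w.
  rewrite inner_plus_l inner_minus_l; ring. }
rewrite E; apply injective_projections; simpl; ring.
Qed.

(** * Orthonormal bases *)

Section Basis.

Variable H : HilbertSpace.
Variable e : nat -> H.
Hypothesis e_orthonormal : forall j k, inner (e j) (e k) = if Nat.eq_dec j k then RtoC 1 else RtoC 0.
Hypothesis e_expansion : forall f, is_series (fun k => scal (inner f (e k)) (e k)) f.
Implicit Types u v f g x y : H.

Lemma parseval_inner f g :
  is_series (V := C_NormedModule) (fun k => (inner f (e k) * Cconj (inner g (e k)))%C) (inner f g).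
Proof.
apply (is_series_ext (V := C_NormedModule)) with (fun k => inner (scal (inner f (e k)) (e k)) g).
- intros k. rewrite inner_scal_l. now rewrite (inner_conj _ g (e k)).
- exact (inner_series H _ f g (e_expansion f)).
Qed.

Lemma parseval f : is_series (fun k => Cmod (inner f (e k)) ^ 2) (norm f ^ 2).
Proof.
rewrite norm_sqr_inner.
apply (is_series_ext (V := R_NormedModule)) with (2 := is_series_Re _ _ (parseval_inner f f)).
intros k; rewrite <- Cmod2_conj; reflexivity.
Qed.

Lemma coord_square_summable f : ex_series (fun k => Cmod (inner f (e k)) ^ 2).
Proof. eexists; apply parseval. Qed.

Lemma Series_coord_square f : Series (fun k => Cmod (inner f (e k)) ^ 2) = norm f ^ 2.
Proof. apply is_series_unique, parseval. Qed.

Lemma coord_ext f g : (forall k, inner f (e k) = inner g (e k)) -> f = g.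
Proof.
intros E; apply inner_ext; intros w.
apply is_series_C_unique with (1 := parseval_inner f w).
apply (is_series_ext (V := C_NormedModule)) with (2 := parseval_inner g w).
intros k; now rewrite E.
Qed.

Lemma norm_le_of_coord f (w : nat -> R) (M : R) :
  0 <= M -> (forall k, Cmod (inner f (e k)) <= w k) ->
  ex_series (fun k => w k ^ 2) -> Series (fun k => w k ^ 2) <= M ^ 2 -> norm f <= M.
Proof.
intros HM Hw Hex HS.
assert (HM2 : norm f ^ 2 <= M ^ 2).
{ rewrite <- Series_coord_square; apply Rle_trans with (2 := HS).
  apply Series_le; auto; intros k; split; [apply pow2_ge_0|].
  apply pow_incr; split; auto; apply Cmod_ge_0. }
pose proof (norm_ge_0 f); nra.
Qed.

Lemma inner_sum_n_m_basis (c : nat -> C) n m j :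
  (m < j)%nat -> inner (sum_n_m (fun k => scal (c k) (e k)) n m) (e j) = 0.
Proof.
intros Hj; induction m as [|m IH].
- destruct n as [|n].
  + rewrite sum_n_n inner_scal_l e_orthonormal; destruct (Nat.eq_dec 0 j); [lia|ring].
  + rewrite sum_n_m_zero; [apply inner_zero_l|lia].
- destruct (Nat.le_gt_cases n (S m)).
  + rewrite sum_n_Sm; auto. rewrite inner_plus_l IH; [|lia].
    rewrite inner_scal_l e_orthonormal; destruct (Nat.eq_dec (S m) j); [lia|ring].
  + rewrite sum_n_m_zero; [apply inner_zero_l|lia].
Qed.

Lemma norm_sqr_plus_orthogonal u v :
  inner u v = 0 -> norm (plus u v) ^ 2 = norm u ^ 2 + norm v ^ 2.
Proof.
intros E; rewrite !norm_sqr_inner inner_plus_l !inner_plus_r (inner_conj _ u v) E.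
unfold Re; simpl; ring.
Qed.

Lemma norm_sum_n_m_basis (c : nat -> C) n m :
  norm (sum_n_m (fun k => scal (c k) (e k)) n m) ^ 2 = sum_n_m (fun k => Cmod (c k) ^ 2) n m.
Proof.
assert (He : forall k, norm (e k) = 1).
{ intros k. pose proof (norm_sqr_inner H (e k)) as E; rewrite e_orthonormal in E.
  destruct (Nat.eq_dec k k); [simpl in E|lia]. pose proof (norm_ge_0 (e k)).
  change (Re (RtoC 1)) with 1 in E. nra. }
assert (Hs : forall k, norm (scal (c k : C_AbsRing) (e k)) ^ 2 = Cmod (c k) ^ 2).
{ intros k; rewrite (norm_scal_eq H) He; ring. }
induction m as [|m IH].
- destruct n as [|n].
  + rewrite !sum_n_n; apply Hs.
  + rewrite !sum_n_m_zero; try lia. change (norm (zero : H) ^ 2 = 0).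
    rewrite (norm_zero (V := H)); ring.
- destruct (Nat.le_gt_cases n (S m)).
  + rewrite !sum_n_Sm; auto. rewrite norm_sqr_plus_orthogonal.
    * change (norm (sum_n_m (fun k : nat => scal (c k) (e k)) n m) ^ 2 + norm (scal (c (S m)) (e (S m))) ^ 2 = sum_n_m (fun k => Cmod (c k) ^ 2) n m + Cmod (c (S m)) ^ 2).
      now rewrite IH Hs.
    * rewrite inner_scal_r inner_sum_n_m_basis; [ring|lia].
  + rewrite !sum_n_m_zero; try lia. change (norm (zero : H) ^ 2 = 0).
    rewrite (norm_zero (V := H)); ring.
Qed.

Lemma inner_sum_n_basis (c : nat -> C) n j :
  (j <= n)%nat -> inner (sum_n (fun k => scal (c k) (e k)) n) (e j) = c j.
Proof.
intros Hj; induction n as [|n IH].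
- rewrite sum_O inner_scal_l e_orthonormal; replace j with 0%nat by lia; simpl; ring.
- rewrite sum_Sn inner_plus_l inner_scal_l e_orthonormal.
  destruct (Nat.eq_dec (S n) j) as [<-|Hne].
  + unfold sum_n; rewrite inner_sum_n_m_basis; [ring|lia].
  + rewrite IH; [ring|lia].
Qed.

Lemma riesz_fischer (c : nat -> C) :
  ex_series (fun k => Cmod (c k) ^ 2) -> exists x, forall k, inner x (e k) = c k.
Proof.
intros Hc.
assert (Hex : ex_series (fun k => scal (c k : C_AbsRing) (e k))).
{ apply ex_series_Cauchy; intros eps.
  destruct (Cauchy_ex_series _ Hc (mkposreal (eps ^ 2) ltac:(destruct eps as [r Hr]; simpl; nra)))
    as [N HN].
  exists N; intros n m Hn Hm; specialize (HN n m Hn Hm).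
  change (Rabs (sum_n_m (fun k => Cmod (c k) ^ 2) n m) < eps ^ 2) in HN.
  rewrite <- norm_sum_n_m_basis in HN.
  set (x := sum_n_m (fun k => scal (c k : C_AbsRing) (e k)) n m : H).
  change (Rabs (norm x ^ 2) < eps ^ 2) in HN. change (norm x < eps).
  rewrite Rabs_pos_eq in HN; [|apply pow2_ge_0].
  pose proof (cond_pos eps); pose proof (norm_ge_0 x).
  apply Rnot_le_lt; intros Hle. nra. }
destruct Hex as [x Hx]; exists x; intros k.
apply is_series_C_unique with (1 := inner_series H _ x (e k) Hx).
apply is_series_C; intros eps; exists k; intros n Hn.
rewrite <- (inner_sum_n H), inner_sum_n_basis; auto.
replace (c k - c k)%C with (RtoC 0) by ring. rewrite Cmod_0; apply cond_pos.
Qed.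

(** An arbitrary vector if the coordinates are not square summable. *)
Definition vec (c : nat -> C) : H :=
  epsilon (inhabits zero) (fun x => forall k, inner x (e k) = c k).

Lemma coord_vec (c : nat -> C) k :
  ex_series (fun k => Cmod (c k) ^ 2) -> inner (vec c) (e k) = c k.
Proof.
intros Hc; revert k. exact (epsilon_spec (inhabits zero) _ (riesz_fischer c Hc)).
Qed.

(** Riesz representation: the coordinates [B u (e k)] of [K u] are square summable,
    as one sees by testing [B u] on their partial sums. *)
Lemma form_to_operator (M : R) (B : H -> H -> C) :
  0 <= M -> bounded_sesquilinear H M B ->
  exists K : H -> H, is_linear K /\ (forall u v, inner (K u) v = B u v) /\
    (forall u, norm (K u) <= M * norm u).
Proof.
intros HM [Bpl Bsl Bpr Bsr Bb].
assert (Hsum : forall u (c : nat -> C) n,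
  B u (sum_n (fun k => scal (c k) (e k)) n) = sum_n (fun k => (Cconj (c k) * B u (e k))%C) n).
{ intros u c n; induction n as [|n IH]; rewrite ?sum_O ?sum_Sn; [apply Bsr|].
  now rewrite Bpr IH Bsr. }
assert (Hsq : forall u, ex_series (fun k => Cmod (B u (e k)) ^ 2)).
{ intros u. apply (nonneg_series _ ((M * norm u) ^ 2)); [intros; apply pow2_ge_0|].
  intros n. set (S := sum_n _ n).
  set (y := sum_n (fun k => scal (B u (e k) : C_AbsRing) (e k)) n : H).
  assert (Hy : norm y ^ 2 = S) by apply (norm_sum_n_m_basis (fun k => B u (e k)) 0 n).
  assert (HB : Cmod (B u y) = S).
  { unfold y; rewrite Hsum.
    rewrite (sum_n_ext _ (fun k => RtoC (Cmod (B u (e k)) ^ 2))).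
    2: { intros k; rewrite Cmod2_conj; apply Cmult_comm. }
    { assert (E : sum_n (fun k => RtoC (Cmod (B u (e k)) ^ 2)) n = RtoC S).
      { unfold S; clear; induction n as [|n IH]; rewrite ?sum_O ?sum_Sn; auto.
        rewrite IH; symmetry; apply RtoC_plus. }
      rewrite E Cmod_R Rabs_pos_eq; auto.
      unfold S; apply sum_n_nonneg; intros; apply pow2_ge_0. } }
  pose proof (Bb u y) as Hb; rewrite HB in Hb.
  pose proof (norm_ge_0 y); pose proof (norm_ge_0 u).
  assert (0 <= M * norm u) by now apply Rmult_le_pos.
  destruct (Req_dec (norm y) 0) as [Hy0|Hy0].
  - rewrite Hy0 in Hy; nra.
  - assert (norm y <= M * norm u) by (apply Rmult_le_reg_r with (norm y); [lra|]; nra).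
    rewrite <- Hy; apply pow_incr; lra. }
set (K := fun u => vec (fun k => B u (e k))).
assert (HK : forall u v, inner (K u) v = B u v).
{ intros u v.
  apply is_series_C_unique with (1 := parseval_inner (K u) v).
  apply is_series_C; intros eps.
  assert (Hpos : 0 < eps / (M * norm u + 1)).
  { apply Rdiv_lt_0_compat; [apply cond_pos|].
    pose proof (Rmult_le_pos _ _ HM (norm_ge_0 u)); lra. }
  destruct (proj1 (is_series_norm _ _) (e_expansion v) (mkposreal _ Hpos)) as [N HN].
  exists N; intros n Hn; specialize (HN n Hn); simpl in HN.
  rewrite (sum_n_ext _ (fun k => (Cconj (inner v (e k)) * B u (e k))%C)).
  2: { intros k; unfold K; rewrite coord_vec; auto; apply Cmult_comm. }
  rewrite <- Hsum.
  rewrite <- (additive_minus H (B u)); [|intros; apply Bpr].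
  apply Rle_lt_trans with (1 := Bb _ _).
  pose proof (Rmult_le_pos _ _ HM (norm_ge_0 u)) as Hp.
  set (r := minus (sum_n (fun k => scal (inner v (e k) : C_AbsRing) (e k)) n) v : H).
  set (p := M * norm u) in *. set (q := norm r).
  change (q < eps / (p + 1)) in HN. change (p * q < eps).
  assert (0 <= q) by apply norm_ge_0.
  apply Rle_lt_trans with ((p + 1) * q); [nra|].
  replace (pos eps) with ((p + 1) * (eps / (p + 1))) by (field; lra).
  apply Rmult_lt_compat_l; [lra|]. exact HN. }
assert (Kb : forall u, norm (K u) <= M * norm u).
{ intros u; apply norm_le_of_inner.
  - apply Rmult_le_pos; auto; apply norm_ge_0.
  - intros v; rewrite HK; apply Bb. }
exists K; split; [|split]; auto.
split.
- intros u v; apply inner_ext; intros w; now rewrite inner_plus_l !HK Bpl.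
- intros c u; apply inner_ext; intros w; now rewrite inner_scal_l !HK Bsl.
- exists (M + 1); split; [lra|]; intros u.
  apply Rle_trans with (1 := Kb u). pose proof (norm_ge_0 u); nra.
Qed.

Lemma adjoint_exists (L : H -> H) :
  is_linear L -> exists L' : H -> H, is_linear L' /\ forall u v, inner (L u) v = inner u (L' v).
Proof.
intros [Lp Ls [M [HM LM]]].
destruct (form_to_operator M (fun v u => inner v (L u))) as [L' [HL' [E _]]]; [lra| |].
- split; intros.
  + apply inner_plus_l.
  + apply inner_scal_l.
  + now rewrite Lp inner_plus_r.
  + now rewrite Ls inner_scal_r.
  + apply Rle_trans with (1 := cauchy_schwarz _ _ _).
    pose proof (norm_ge_0 u); specialize (LM v). nra.
- exists L'; split; auto; intros u v.
  rewrite (inner_conj _ (L' v) u) E. apply inner_conj.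
Qed.

End Basis.

(** * Similarity of families of projections *)

Lemma linear_zero (H : HilbertSpace) (E : H -> H) : is_linear E -> E zero = zero.
Proof.
intros HE.
transitivity (E (scal (zero : C_AbsRing) (zero : H))).
- f_equal; symmetry; apply (scal_zero_l (zero : H)).
- rewrite (linear_scal E HE); apply (scal_zero_l (E zero)).
Qed.

Lemma linear_minus (H : HilbertSpace) (E : H -> H) (x y : H) :
  is_linear E -> E (minus x y) = minus (E x) (E y).
Proof.
intros HE.
assert (P : plus (E (minus x y)) (E y) = E x).
{ rewrite <- (linear_plus E HE); f_equal; apply inner_ext; intros w.
  rewrite inner_plus_l inner_minus_l; ring. }
apply inner_ext; intros w; rewrite inner_minus_l -P inner_plus_l; ring.
Qed.

Lemma linear_compose (H : HilbertSpace) (E F : H -> H) :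
  is_linear E -> is_linear F -> is_linear (fun x => E (F x)).
Proof. intros; now apply is_linear_comp. Qed.

(** The Neumann series makes [1 + E] onto; the contraction bound makes it injective
    and its inverse bounded. *)
Lemma neumann (H : HilbertSpace) (E : H -> H) (q : R) :
  is_linear E -> 0 <= q < 1 -> (forall f, norm (E f) <= q * norm f) ->
  exists V : H -> H, is_linear V /\ (forall f, V (plus f (E f)) = f) /\
    (forall f, plus (V f) (E (V f)) = f).
Proof.
intros HE Hq Hb.
assert (Hinj : forall f g : H, plus f (E f) = plus g (E g) -> f = g).
{ intros f g Hfg.
  set (d := minus f g : H).
  assert (Hd : d = opp (E d)).
  { apply inner_ext; intros w; unfold d; rewrite (linear_minus H E f g HE).
    rewrite inner_opp_l !inner_minus_l.
    assert (Hw : inner (plus f (E f)) w = inner (plus g (E g)) w) by now rewrite Hfg.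
    rewrite !inner_plus_l in Hw.
    destruct (inner f w) as [a1 a2], (inner g w) as [b1 b2], (inner (E f) w) as [c1 c2],
      (inner (E g) w) as [d1 d2]; injection Hw; intros.
    unfold Copp, Cminus, Cplus, Copp; simpl; f_equal; lra. }
  assert (norm d <= q * norm d).
  { rewrite {1}Hd. rewrite (norm_opp (E d)). apply Hb. }
  pose proof (norm_ge_0 d).
  assert (Hd0 : d = zero) by (refine (norm_eq_zero d _); nra).
  apply inner_ext; intros w.
  assert (Z : inner d w = 0) by (rewrite Hd0; apply inner_zero_l).
  unfold d in Z; rewrite inner_minus_l in Z.
  destruct (inner f w), (inner g w); injection Z; intros; f_equal; lra. }
assert (Hsurj : forall f : H, exists x : H, plus x (E x) = f).
{ intros f.
  set (it := fix it n : H := match n with O => f | S n => opp (E (it n)) end).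
  assert (Hit : forall n, norm (it n) <= q ^ n * norm f).
  { induction n as [|n IH]; [simpl; lra|].
    change (norm (opp (E (it n))) <= q * q ^ n * norm f). rewrite (norm_opp (E (it n))).
    apply Rle_trans with (1 := Hb _).
    rewrite Rmult_assoc; apply Rmult_le_compat_l; auto; lra. }
  assert (Hex : ex_series it).
  { apply (ex_series_le it (fun n => q ^ n * norm f)); auto.
    apply ex_series_scal_R_r, ex_series_geom; rewrite Rabs_pos_eq; lra. }
  destruct Hex as [x Hx]; exists x.
  apply inner_ext; intros w.
  pose proof (inner_series H _ _ w Hx) as Hxw.
  pose proof (inner_series H _ _ w (is_linear_series E it x HE Hx)) as HEw.
  rewrite inner_plus_l.
  (* [E (it n) = - it (n + 1)], so [x] and [- E x] are the same series but for its first term [f] *)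
  assert (H1 : is_series (V := C_NormedModule) (fun k => inner (it (S k)) w) (inner x w - inner f w)%C).
  { apply (is_series_incr_1 (V := C_NormedModule) (fun k => inner (it k) w)).
    replace (plus _ _) with (inner x w : C_NormedModule); auto.
    change (inner x w = inner x w - inner f w + inner f w)%C; ring. }
  assert (H2 : is_series (V := C_NormedModule) (fun k => inner (it (S k)) w) (- inner (E x) w)%C).
  { apply (is_series_ext (V := C_NormedModule)) with (2 := is_series_opp (V := C_NormedModule) _ _ HEw).
    intros n. change (- inner (E (it n)) w = inner (opp (E (it n))) w)%C.
    now rewrite inner_opp_l. }
  pose proof (is_series_C_unique _ _ _ H1 H2) as Heq.
  destruct (inner x w), (inner f w), (inner (E x) w); injection Heq; intros.
  unfold Cplus; simpl; f_equal; lra. }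
set (V := fun f : H => epsilon (inhabits zero) (fun x => plus x (E x) = f) : H).
assert (HV : forall f, plus (V f) (E (V f)) = f).
{ intros f; exact (epsilon_spec (inhabits zero) _ (Hsurj f)). }
exists V; split; [split|split]; auto.
- intros x y; apply Hinj; rewrite HV (linear_plus E HE).
  transitivity (plus (plus (V x) (E (V x))) (plus (V y) (E (V y)))); [now rewrite !HV|].
  apply inner_ext; intros w; rewrite !inner_plus_l; ring.
- intros c x; apply Hinj; rewrite HV (linear_scal E HE).
  transitivity (scal (c : C_AbsRing) (plus (V x) (E (V x)))); [now rewrite !HV|].
  apply inner_ext; intros w; rewrite inner_plus_l !inner_scal_l inner_plus_l; ring.
- exists (/ (1 - q)); split; [apply Rinv_0_lt_compat; lra|].
  intros f. apply Rmult_le_reg_l with (1 - q); [lra|]. rewrite <- Rmult_assoc, Rinv_r, Rmult_1_l; [|lra].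
  assert (Hn : norm (V f) <= norm f + norm (E (V f))).
  { replace (V f) with (minus f (E (V f)) : H) at 1.
    - unfold minus. apply Rle_trans with (1 := norm_triangle f (opp (E (V f)))).
      rewrite (norm_opp (E (V f))); lra.
    - apply inner_ext; intros w; rewrite inner_minus_l -{1}(HV f) inner_plus_l; ring. }
  specialize (Hb (V f)); lra.
Qed.

Section Similarity.

Variable H : HilbertSpace.
Variable e : nat -> H.
Hypothesis e_orthonormal : forall j k, inner (e j) (e k) = if Nat.eq_dec j k then RtoC 1 else RtoC 0.
Hypothesis e_expansion : forall f, is_series (fun k => scal (inner f (e k)) (e k)) f.

Variables (Q : nat -> R -> H -> H) (A : nat -> H -> R) (kap : nat -> R) (M : R).
Hypothesis M_nonneg : 0 <= M.
Hypothesis Q_linear : forall i s, 0 <= s <= 1 -> is_linear (Q i s).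
Hypothesis Q_product : forall i j s f, 0 <= s <= 1 ->
  Q i s (Q j s f) = if Nat.eq_dec i j then Q i s f else zero.
Hypothesis A_nonneg : forall i f, 0 <= A i f.
Hypothesis kap_nonneg : forall i, 0 <= kap i.
Hypothesis Q_lipschitz : forall i s s' f g, 0 <= s <= 1 -> 0 <= s' <= 1 ->
  Cmod (inner (minus (Q i s f) (Q i s' f)) g) <= Rabs (s - s') * A i f * A i g.
Hypothesis A_le : forall i f, A i f <= kap i * norm f.
Hypothesis A_sum : forall f n, sum_n (fun i => (kap i * A i f) ^ 2) n <= (M * norm f) ^ 2.
Hypothesis Q0_sum : forall f n, sum_n (fun i => norm (Q i 0 f) ^ 2) n <= norm f ^ 2.

Definition complete_at (s : R) : Prop :=
  forall f g, is_series (V := C_NormedModule) (fun i => inner (Q i s f) g) (inner f g).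

Definition similar (s s' : R) : Prop :=
  exists U V : H -> H, bounded_inverse U V /\ forall i f, U (Q i s f) = Q i s' (U f).

Lemma Q_diff_norm i s s' f : 0 <= s <= 1 -> 0 <= s' <= 1 ->
  norm (minus (Q i s f) (Q i s' f) : H) <= Rabs (s - s') * A i f * kap i.
Proof.
intros Hs Hs'; apply norm_le_of_inner.
- repeat apply Rmult_le_pos; auto; apply Rabs_pos.
- intros v; apply Rle_trans with (1 := Q_lipschitz i s s' f v Hs Hs').
  rewrite !Rmult_assoc; apply Rmult_le_compat_l; [apply Rabs_pos|].
  apply Rmult_le_compat_l; auto.
Qed.

(** Square summability holds at [0] by orthogonality and is inherited with a constant
    that does not depend on [s]; this uniformity fixes the step length below. *)
Lemma Q_square_sum s f n : 0 <= s <= 1 ->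
  sum_n (fun i => norm (Q i s f) ^ 2) n <= (2 * (1 + M) * norm f) ^ 2.
Proof.
intros Hs.
apply Rle_trans with (sum_n (fun i => 2 * norm (Q i 0 f) ^ 2 + 2 * (kap i * A i f) ^ 2) n).
- apply sum_n_le_sum_n; intros i.
  assert (Hi : norm (Q i s f) <= norm (Q i 0 f) + kap i * A i f).
  { pose proof (Q_diff_norm i s 0 f Hs ltac:(lra)) as Hd.
    assert (Ht : norm (Q i s f) <= norm (minus (Q i s f) (Q i 0 f) : H) + norm (Q i 0 f)).
    { replace (Q i s f) with (plus (minus (Q i s f) (Q i 0 f)) (Q i 0 f) : H) at 1.
      - exact (norm_triangle (minus (Q i s f) (Q i 0 f) : H) (Q i 0 f)).
      - apply inner_ext; intros w; rewrite inner_plus_l inner_minus_l; ring. }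
    rewrite Rminus_0_r Rabs_pos_eq in Hd; [|lra].
    pose proof (Rmult_le_pos _ _ (kap_nonneg i) (A_nonneg i f)).
    assert (s * A i f * kap i <= kap i * A i f) by nra. lra. }
  pose proof (norm_ge_0 (Q i s f)).
  pose proof (pow2_ge_0 (norm (Q i 0 f) - kap i * A i f)). nra.
- rewrite (sum_n_plus (fun i => 2 * norm (Q i 0 f) ^ 2)).
  rewrite (sum_n_mult_l (K := R_Ring) 2 (fun i => norm (Q i 0 f) ^ 2)).
  rewrite (sum_n_mult_l (K := R_Ring) 2 (fun i => (kap i * A i f) ^ 2)).
  pose proof (Q0_sum f n) as HQ; pose proof (A_sum f n) as HA.
  change (2 * sum_n (fun i => norm (Q i 0 f) ^ 2) n + 2 * sum_n (fun i => (kap i * A i f) ^ 2) n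
    <= (2 * (1 + M) * norm f) ^ 2).
  pose proof (norm_ge_0 f). rewrite !Rpow_mult_distr in HA |- *.
  pose proof (pow2_ge_0 (norm f)). nra.
Qed.

(** [U = sum_i Q_i(s') Q_i(s)] intertwines the two families. Completeness at [s] gives
    [U - 1 = sum_i (Q_i(s') - Q_i(s)) Q_i(s)], and the form of this operator is at most
    [|s - s'| sum_i |Q_i(s) f| kap_i A_i(g)], small by Cauchy-Schwarz. *)
Lemma similar_step s s' : 0 <= s <= 1 -> 0 <= s' <= 1 ->
  Rabs (s - s') * (2 * (1 + M) * M) <= 1 / 2 ->
  complete_at s -> similar s s' /\ complete_at s'.
Proof.
intros Hs Hs' Hstep Hc.
set (term := fun f g i => inner (minus (Q i s' (Q i s f)) (Q i s (Q i s f))) g).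
set (w := fun f g i => Rabs (s - s') * (norm (Q i s f) * (kap i * A i g))).
assert (Hterm : forall f g i, Cmod (term f g i) <= w f g i).
{ intros f g i; unfold term, w.
  apply Rle_trans with (1 := Q_lipschitz i s' s (Q i s f) g Hs' Hs).
  rewrite Rabs_minus_sym Rmult_assoc; apply Rmult_le_compat_l; [apply Rabs_pos|].
  pose proof (A_le i (Q i s f)); pose proof (A_nonneg i g).
  replace (norm (Q i s f) * (kap i * A i g)) with (kap i * norm (Q i s f) * A i g) by ring.
  apply Rmult_le_compat_r; auto. }
assert (Hw : forall f g, ex_series (w f g) /\ Series (w f g) <= 1 / 2 * norm f * norm g).
{ intros f g.
  destruct (nonneg_series _ _ (fun i => pow2_ge_0 (norm (Q i s f))) (fun n => Q_square_sum s f n Hs)) as [E1 S1].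
  destruct (nonneg_series _ _ (fun i => pow2_ge_0 (kap i * A i g)) (A_sum g)) as [E2 S2].
  assert (Hp : forall i, 0 <= kap i * A i g) by (intros; now apply Rmult_le_pos).
  destruct (series_cauchy_schwarz (fun i => norm (Q i s f)) (fun i => kap i * A i g)) as [E S]; auto.
  { intros i; apply norm_ge_0. }
  split; [now apply ex_series_scal_R|].
  unfold w; rewrite Series_scal_l.
  set (T := Series _) in S |- *.
  assert (HT : T <= 2 * (1 + M) * norm f * (M * norm g)).
  { pose proof (norm_ge_0 f); pose proof (norm_ge_0 g).
    assert (0 <= 2 * (1 + M) * norm f * (M * norm g)).
    { apply Rmult_le_pos; [apply Rmult_le_pos; auto; lra|now apply Rmult_le_pos]. }
    apply Rsqr_incr_0_var; auto. rewrite !Rsqr_pow2 Rpow_mult_distr.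
    apply Rle_trans with (1 := S).
    apply Rmult_le_compat; auto; apply Series_nonneg; auto; intros; apply pow2_ge_0. }
  pose proof (norm_ge_0 f); pose proof (norm_ge_0 g); pose proof (Rabs_pos (s - s')).
  apply Rle_trans with (Rabs (s - s') * (2 * (1 + M) * norm f * (M * norm g))).
  { now apply Rmult_le_compat_l. }
  replace (Rabs (s - s') * (2 * (1 + M) * norm f * (M * norm g)))
    with (Rabs (s - s') * (2 * (1 + M) * M) * (norm f * norm g)) by ring.
  rewrite (Rmult_assoc (1 / 2)); apply Rmult_le_compat_r; auto. now apply Rmult_le_pos. }
set (B := fun f g => epsilon (inhabits (RtoC 0)) (fun l => is_series (V := C_NormedModule) (term f g) l)).
assert (HB : forall f g, is_series (V := C_NormedModule) (term f g) (B f g)).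
{ intros f g. apply (epsilon_spec (inhabits (RtoC 0)) (fun l => is_series (V := C_NormedModule) (term f g) l)).
  apply (ex_series_le (V := C_CompleteNormedModule) (term f g) (w f g)); [apply Hterm|apply Hw]. }
assert (HlinQ : forall f g i, minus (Q i s' (Q i s (plus f g))) (Q i s (Q i s (plus f g)))
   = plus (minus (Q i s' (Q i s f)) (Q i s (Q i s f))) (minus (Q i s' (Q i s g)) (Q i s (Q i s g))) :> H).
{ intros f g i. rewrite !(linear_plus _ (Q_linear i s Hs)) !(linear_plus _ (Q_linear i s' Hs')).
  apply inner_ext; intros x; rewrite !inner_plus_l !inner_opp_l !inner_plus_l; ring. }
assert (HscQ : forall (c : C) f i, minus (Q i s' (Q i s (scal c f))) (Q i s (Q i s (scal c f)))
   = scal c (minus (Q i s' (Q i s f)) (Q i s (Q i s f))) :> H).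
{ intros c f i. rewrite !(linear_scal _ (Q_linear i s Hs)) !(linear_scal _ (Q_linear i s' Hs')).
  apply inner_ext; intros x; rewrite !inner_scal_l !inner_minus_l !inner_scal_l; ring. }
destruct (form_to_operator H e e_orthonormal e_expansion (1 / 2) B) as [E [HE [EB Eb]]]; [lra| |].
{ split.
  - intros u v x; apply (is_series_C_unique (term (plus u v) x)); auto.
    apply (is_series_ext (V := C_NormedModule)) with (2 := is_series_plus (V := C_NormedModule) _ _ _ _ (HB u x) (HB v x)).
    intros i; unfold term; rewrite HlinQ. symmetry; apply inner_plus_l.
  - intros c u x; apply (is_series_C_unique (term (scal c u) x)); auto.
    apply (is_series_ext (V := C_NormedModule)) with (2 := is_series_scal (V := C_NormedModule) c _ _ (HB u x)).
    intros i; unfold term; rewrite HscQ. symmetry; apply inner_scal_l.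
  - intros u v x; apply (is_series_C_unique (term x (plus u v))); auto.
    apply (is_series_ext (V := C_NormedModule)) with (2 := is_series_plus (V := C_NormedModule) _ _ _ _ (HB x u) (HB x v)).
    intros i; unfold term; symmetry; apply inner_plus_r.
  - intros c u x; apply (is_series_C_unique (term x (scal c u))); auto.
    apply (is_series_ext (V := C_NormedModule)) with (2 := is_series_scal (V := C_NormedModule) (Cconj c) _ _ (HB x u)).
    intros i; unfold term; symmetry; apply inner_scal_r.
  - intros u v. apply Rle_trans with (2 := proj2 (Hw u v)).
    apply is_series_C_Series_bound with (1 := HB u v); [apply Hterm|apply Hw]. }
destruct (neumann H E (1 / 2) HE ltac:(lra) Eb) as [V [HV [VU UV]]].
set (U := fun f => plus f (E f) : H).
assert (HU : is_linear U).
{ split.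
  - intros x y; unfold U; rewrite (linear_plus E HE); apply inner_ext; intros z; rewrite !inner_plus_l; ring.
  - intros c x; unfold U; rewrite (linear_scal E HE); apply inner_ext; intros z.
    rewrite inner_plus_l !inner_scal_l inner_plus_l; ring.
  - exists 2; split; [lra|]; intros x; unfold U.
    apply Rle_trans with (1 := norm_triangle x (E x)); specialize (Eb x); pose proof (norm_ge_0 x).
    change (norm x + norm (E x) <= 2 * norm x); lra. }
(* only the term [i] of the series survives on the range of [Q_i(s)] *)
assert (HUQ : forall i f, U (Q i s f) = Q i s' (Q i s f)).
{ intros i f; apply inner_ext; intros g; unfold U; rewrite inner_plus_l EB.
  assert (Hone : is_series (V := C_NormedModule) (term (Q i s f) g)
            (inner (Q i s' (Q i s f)) g - inner (Q i s f) g)%C).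
  { apply is_series_C_single with i; intros k.
    unfold term; rewrite inner_minus_l !Q_product; auto.
    destruct (Nat.eq_dec k i) as [->|Hne].
    - rewrite Q_product; auto. now destruct (Nat.eq_dec i i).
    - rewrite (linear_zero _ _ (Q_linear k s' Hs')) (linear_zero _ _ (Q_linear k s Hs)) inner_zero_l; ring. }
  rewrite (is_series_C_unique _ _ _ (HB _ _) Hone). ring. }
assert (HQU : forall i f, Q i s' (U f) = Q i s' (Q i s f)).
{ intros i f; apply inner_ext; intros g.
  destruct (adjoint_exists H e e_orthonormal e_expansion _ (Q_linear i s' Hs')) as [L [HL EL]].
  rewrite EL; unfold U; rewrite inner_plus_l EB.
  pose proof (is_series_plus (V := C_NormedModule) _ _ _ _ (Hc f (L g)) (HB f (L g))) as Hp.
  apply is_series_C_unique with (1 := Hp).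
  apply is_series_C_single with i; intros k.
  unfold term; rewrite inner_minus_l (Q_product k k s f Hs).
  destruct (Nat.eq_dec k k); [|lia].
  transitivity (inner (Q k s' (Q k s f)) (L g)).
  { change (inner (Q k s f) (L g) + (inner (Q k s' (Q k s f)) (L g) - inner (Q k s f) (L g))
      = inner (Q k s' (Q k s f)) (L g))%C; ring. }
  rewrite -EL Q_product; auto.
  destruct (Nat.eq_dec i k), (Nat.eq_dec k i); try lia; subst; auto.
  apply inner_zero_l. }
split.
- exists U, V; split; [split; [|split; [|split]]|]; auto.
  intros i f; now rewrite HUQ HQU.
- intros f g.
  destruct (adjoint_exists H e e_orthonormal e_expansion _ HU) as [L [HL EL]].
  rewrite <- (UV f). change (plus (V f) (E (V f))) with (U (V f)).
  rewrite EL.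
  apply (is_series_ext (V := C_NormedModule)) with (2 := Hc (V f) (L g)).
  intros i; now rewrite -EL HUQ HQU.
Qed.

Lemma similar_refl s : similar s s.
Proof.
exists (fun f => f), (fun f => f); split; [|auto].
assert (is_linear (fun f : H => f)).
{ split; auto. exists 1; split; [lra|intros; lra]. }
split; [|split; [|split]]; auto.
Qed.

Lemma similar_trans s1 s2 s3 : similar s1 s2 -> similar s2 s3 -> similar s1 s3.
Proof.
intros [U [V [[HU [HV [UV VU]]] E]]] [U' [V' [[HU' [HV' [UV' VU']]] E']]].
exists (fun f => U' (U f)), (fun f => V (V' f)); split; [split; [|split; [|split]]|].
- now apply linear_compose.
- now apply linear_compose.
- intros f; now rewrite UV UV'.
- intros f; now rewrite VU' VU.
- intros i f; now rewrite E E'.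
Qed.

(** The step length allowed by [similar_step] does not depend on the position, so
    finitely many steps lead from 0 to 1. *)
Lemma similar_0_1 : complete_at 0 -> similar 0 1.
Proof.
intros Hc.
set (c := 2 * (1 + M) * M).
assert (Hcpos : 0 <= c) by (unfold c; nra).
destruct (INR_unbounded (2 * c + 1)) as [n Hn].
assert (Hn0 : 0 < INR n) by lra.
assert (Hk : forall k, (k <= n)%nat -> similar 0 (INR k / INR n) /\ complete_at (INR k / INR n)).
{ induction k as [|k IH]; intros Hk.
  - replace (INR 0 / INR n) with 0 by (simpl; field; lra). split; auto; apply similar_refl.
  - destruct (IH ltac:(lia)) as [IH1 IH2].
    assert (Hin : forall j, (j <= n)%nat -> 0 <= INR j / INR n <= 1).
    { intros j Hj; apply le_INR in Hj; pose proof (pos_INR j); split.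
      - apply Rmult_le_pos; auto; apply Rlt_le, Rinv_0_lt_compat; auto.
      - apply Rmult_le_reg_r with (INR n); auto; unfold Rdiv; rewrite Rmult_assoc Rinv_l; lra. }
    destruct (similar_step (INR k / INR n) (INR (S k) / INR n)) as [S1 S2]; auto.
    { apply Hin; lia. }
    { replace (INR k / INR n - INR (S k) / INR n) with (- / INR n) by (rewrite S_INR; field; lra).
      rewrite Rabs_Ropp Rabs_pos_eq; [|apply Rlt_le, Rinv_0_lt_compat; auto].
      fold c. apply Rmult_le_reg_l with (INR n); auto.
      rewrite -Rmult_assoc Rinv_r; lra. }
    split; auto. now apply similar_trans with (1 := IH1). }
destruct (Hk n (Nat.le_refl n)) as [S1 _].
now replace (INR n / INR n) with 1 in S1 by (field; lra).
Qed.

End Similarity.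

(** * Integrals over a rectangle *)

Lemma continuous_eps (f : R -> R) (x : R) :
  (forall eps : posreal, exists del : posreal, forall y, Rabs (y - x) < del -> Rabs (f y - f x) < eps) ->
  continuous f x.
Proof.
intros Hf; apply (filterlim_locally (U := R_UniformSpace)); intros eps.
destruct (Hf eps) as [del Hd]; exists del; intros y Hy; apply Hd, Hy.
Qed.

Lemma continuous_2d_left (f : R -> R -> R) (x y : R) :
  continuity_2d_pt f x y -> continuous (fun u => f u y) x.
Proof.
intros Hf; apply continuous_eps; intros eps.
destruct (Hf eps) as [del Hd]; exists del; intros u Hu; apply Hd; auto.
rewrite Rminus_diag Rabs_R0; apply cond_pos.
Qed.

Lemma continuous_2d_right (f : R -> R -> R) (x y : R) :
  continuity_2d_pt f x y -> continuous (f x) y.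
Proof.
intros Hf; apply continuous_eps; intros eps.
destruct (Hf eps) as [del Hd]; exists del; intros u Hu; apply Hd; auto.
rewrite Rminus_diag Rabs_R0; apply cond_pos.
Qed.

Lemma continuity_2d_swap (f : R -> R -> R) (x y : R) :
  continuity_2d_pt f x y -> continuity_2d_pt (fun u v => f v u) y x.
Proof.
intros Hf eps; destruct (Hf eps) as [del Hd]; exists del; intros u v Hu Hv; now apply Hd.
Qed.

Lemma ex_RInt_continuous_R (f : R -> R) a b :
  (forall x, Rmin a b <= x <= Rmax a b -> continuous f x) -> ex_RInt f a b.
Proof. apply (ex_RInt_continuous (V := R_CompleteNormedModule)). Qed.

Lemma RInt_minus_R (f g : R -> R) a b : ex_RInt f a b -> ex_RInt g a b ->
  RInt (fun x => f x - g x) a b = RInt f a b - RInt g a b.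
Proof. apply (RInt_minus (V := R_CompleteNormedModule)). Qed.

Lemma RInt_plus_R (f g : R -> R) a b : ex_RInt f a b -> ex_RInt g a b ->
  RInt (fun x => f x + g x) a b = RInt f a b + RInt g a b.
Proof. apply (RInt_plus (V := R_CompleteNormedModule)). Qed.

Lemma RInt_scal_R (f : R -> R) (l : R) a b : ex_RInt f a b ->
  RInt (fun x => l * f x) a b = l * RInt f a b.
Proof. apply (RInt_scal (V := R_CompleteNormedModule)). Qed.

Lemma ex_RInt_right (f : R -> R -> R) (x c d : R) :
  (forall y, continuity_2d_pt f x y) -> ex_RInt (f x) c d.
Proof. intros Hf; apply ex_RInt_continuous_R; intros y _; now apply continuous_2d_right. Qed.

Lemma continuous_RInt_right (f : R -> R -> R) (c d x0 : R) :
  (forall x y, continuity_2d_pt f x y) -> continuous (fun x => RInt (f x) c d) x0.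
Proof.
intros Hf.
assert (Hord : forall c d, c <= d -> continuous (fun x => RInt (f x) c d) x0).
{ clear c d; intros c d Hcd; apply continuous_eps; intros eps.
  assert (Hpos : 0 < eps / (d - c + 1)) by (apply Rdiv_lt_0_compat; [apply cond_pos|lra]).
  destruct (uniform_continuity_2d f (x0 - 1) (x0 + 1) c d (fun x y _ _ => Hf x y) (mkposreal _ Hpos))
    as [del Hd]; simpl in Hd.
  assert (Hm : 0 < Rmin del 1) by (apply Rmin_pos; [apply cond_pos|lra]).
  exists (mkposreal _ Hm); intros x Hx; simpl in Hx.
  pose proof (Rmin_l del 1); pose proof (Rmin_r del 1).
  assert (Hx1 : -1 < x - x0 < 1) by (apply Rabs_def2 in Hx; lra).
  rewrite -RInt_minus_R; try (now apply ex_RInt_right).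
  apply Rle_lt_trans with ((d - c) * (eps / (d - c + 1))).
  - apply abs_RInt_le_const; auto.
    + apply (ex_RInt_minus (V := R_NormedModule)); now apply ex_RInt_right.
    + intros y Hy; apply Rlt_le, Hd; try lra. rewrite Rminus_diag Rabs_R0; apply cond_pos.
  - apply Rlt_le_trans with ((d - c + 1) * (eps / (d - c + 1))).
    + apply Rmult_lt_compat_r; auto; lra.
    + right; field; lra. }
destruct (Rle_dec c d) as [Hcd|Hcd]; [now apply Hord|].
apply continuous_ext with (fun x => - RInt (f x) d c).
- intros x; apply (opp_RInt_swap (V := R_CompleteNormedModule)); now apply ex_RInt_right.
- apply (continuous_opp (V := R_NormedModule)); apply Hord; lra.
Qed.

(** Both iterated integrals, as functions of the upper bound of the outer one,
    vanish at [a] and have the same derivative. *)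
Lemma fubini_global (f : R -> R -> R) (a b c d : R) :
  (forall x y, continuity_2d_pt f x y) ->
  RInt (fun x => RInt (f x) c d) a b = RInt (fun y => RInt (fun x => f x y) a b) c d.
Proof.
intros Hf.
assert (Hf' : forall x y, continuity_2d_pt (fun u v => f v u) x y) by (intros; now apply continuity_2d_swap).
set (F := fun t y => RInt (fun x => f x y) a t).
assert (HF : forall t y, is_derive (fun u => F u y) t (f t y)).
{ intros t y; apply (is_derive_RInt (V := R_NormedModule) (fun x => f x y) (fun u => F u y) a t).
  - exists (mkposreal 1 Rlt_0_1); intros u _; apply (RInt_correct (V := R_CompleteNormedModule)).
    now apply (ex_RInt_right (fun u v => f v u)).
  - now apply (continuous_2d_left f). }
assert (HD : forall t y, Derive (fun u => F u y) t = f t y) by (intros; now apply is_derive_unique).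
assert (HP : forall t, is_derive (fun t => RInt (F t) c d) t (RInt (f t) c d)).
{ intros t.
  rewrite -(RInt_ext (V := R_CompleteNormedModule) (fun y => Derive (fun u => F u y) t)); [|intros; apply HD].
  apply (is_derive_RInt_param F c d t).
  - exists (mkposreal 1 Rlt_0_1); intros u _ y _; eexists; apply HF.
  - intros y _. apply continuity_2d_pt_ext with (2 := Hf t y). intros u v; symmetry; apply HD.
  - exists (mkposreal 1 Rlt_0_1); intros u _.
    apply ex_RInt_continuous_R; intros y _.
    now apply (continuous_RInt_right (fun u v => f v u)). }
assert (HI : is_RInt (fun t => RInt (f t) c d) a b (minus (RInt (F b) c d) (RInt (F a) c d))).
{ apply (is_RInt_derive (V := R_CompleteNormedModule) (fun t => RInt (F t) c d)).
  - intros t _; apply HP.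
  - intros t _; now apply continuous_RInt_right. }
rewrite (is_RInt_unique (V := R_CompleteNormedModule) _ _ _ _ HI).
replace (RInt (F a) c d) with 0.
- change (RInt (F b) c d - 0 = RInt (F b) c d); ring.
- rewrite (RInt_ext (V := R_CompleteNormedModule) (F a) (fun _ => 0)).
  + rewrite RInt_const; change (0 = (d - c) * 0); ring.
  + intros y _; unfold F. apply (RInt_point (V := R_CompleteNormedModule)).
Qed.

(** Clamping the variables to the rectangle reduces to functions that are
    continuous on the whole plane. *)
Lemma fubini (f : R -> R -> R) (a b c d : R) : a <= b -> c <= d ->
  (forall x y, a <= x <= b -> c <= y <= d -> continuity_2d_pt f x y) ->
  RInt (fun x => RInt (f x) c d) a b = RInt (fun y => RInt (fun x => f x y) a b) c d.
Proof.
intros Hab Hcd Hf.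
set (cl := fun p q x => Rmax p (Rmin q x)).
assert (Hin : forall p q x, p <= q -> p <= cl p q x <= q).
{ intros p q x Hpq; unfold cl; split; [apply Rmax_l|apply Rmax_lub; auto; apply Rmin_l]. }
assert (Hid : forall p q x, p <= x <= q -> cl p q x = x).
{ intros p q x Hx; unfold cl; rewrite Rmin_right; [apply Rmax_right|]; lra. }
assert (Hlip : forall p q x y, Rabs (cl p q x - cl p q y) <= Rabs (x - y)).
{ intros p q x y; unfold cl, Rmax, Rmin; repeat destruct Rle_dec; apply Rabs_le_between'; split_Rabs; lra. }
assert (Hcl : forall x y, continuity_2d_pt (fun u v => f (cl a b u) (cl c d v)) x y).
{ intros x y eps; destruct (Hf _ _ (Hin a b x Hab) (Hin c d y Hcd) eps) as [del Hd].
  exists del; intros u v Hu Hv; apply Hd.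
  - apply Rle_lt_trans with (2 := Hu), Hlip.
  - apply Rle_lt_trans with (2 := Hv), Hlip. }
transitivity (RInt (fun x => RInt (fun y => f (cl a b x) (cl c d y)) c d) a b).
- apply (RInt_ext (V := R_CompleteNormedModule)); intros x Hx.
  rewrite Rmin_left in Hx; auto; rewrite Rmax_right in Hx; auto.
  apply (RInt_ext (V := R_CompleteNormedModule)); intros y Hy.
  rewrite Rmin_left in Hy; auto; rewrite Rmax_right in Hy; auto.
  rewrite !Hid; auto; lra.
- rewrite (fubini_global _ a b c d Hcl).
  apply (RInt_ext (V := R_CompleteNormedModule)); intros y Hy.
  rewrite Rmin_left in Hy; auto; rewrite Rmax_right in Hy; auto.
  apply (RInt_ext (V := R_CompleteNormedModule)); intros x Hx.
  rewrite Rmin_left in Hx; auto; rewrite Rmax_right in Hx; auto.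
  rewrite !Hid; auto; lra.
Qed.

(** * Calculus of complex-valued functions *)

Definition continuousC {T : UniformSpace} (f : T -> C) (x : T) : Prop :=
  continuous (fun t => Re (f t)) x /\ continuous (fun t => Im (f t)) x.

Definition continuous_atC (phi : C -> C) (z : C) : Prop :=
  forall eps, 0 < eps -> exists del, 0 < del /\
    forall w, Cmod (w - z)%C < del -> Cmod (phi w - phi z)%C < eps.

Definition derivative_R (f : R -> C) (x : R) (l : C) : Prop :=
  is_derive (fun t => Re (f t)) x (Re l) /\ is_derive (fun t => Im (f t)) x (Im l).

Definition derivative_C (phi : C -> C) (z l : C) : Prop :=
  forall eps, 0 < eps -> exists del, 0 < del /\
    forall w, Cmod (w - z)%C < del ->
      Cmod (phi w - phi z - l * (w - z))%C <= eps * Cmod (w - z)%C.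

Definition CInt (f : R -> C) (a b : R) : C :=
  (RInt (fun t => Re (f t)) a b, RInt (fun t => Im (f t)) a b).

Lemma Cmod_le_Re_Im (z : C) : Cmod z <= Rabs (Re z) + Rabs (Im z).
Proof.
apply Rsqr_incr_0_var.
- rewrite !Rsqr_pow2 Cmod2_alt.
  rewrite -(pow2_abs (Re z)) -(pow2_abs (Im z)).
  pose proof (Rabs_pos (Re z)); pose proof (Rabs_pos (Im z)); nra.
- pose proof (Rabs_pos (Re z)); pose proof (Rabs_pos (Im z)); lra.
Qed.

Lemma im_le_Cmod (z : C) : Rabs (Im z) <= Cmod z.
Proof.
apply Rsqr_incr_0_var; [|apply Cmod_ge_0].
rewrite !Rsqr_pow2 Cmod2_alt pow2_abs; pose proof (pow2_ge_0 (Re z)); lra.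
Qed.

Section Continuity.

Context {T : UniformSpace}.
Implicit Types f g : T -> C.

Lemma continuousC_const (c : C) (x : T) : continuousC (fun _ => c) x.
Proof. split; apply continuous_const. Qed.

Lemma continuousC_plus f g x : continuousC f x -> continuousC g x -> continuousC (fun t => f t + g t)%C x.
Proof.
intros [H1 H2] [H3 H4]; split.
- exact (continuous_plus (V := R_NormedModule) _ _ x H1 H3).
- exact (continuous_plus (V := R_NormedModule) _ _ x H2 H4).
Qed.

Lemma continuousC_opp f x : continuousC f x -> continuousC (fun t => - f t)%C x.
Proof.
intros [H1 H2]; split.
- exact (continuous_opp (V := R_NormedModule) _ x H1).
- exact (continuous_opp (V := R_NormedModule) _ x H2).
Qed.

Lemma continuousC_minus f g x : continuousC f x -> continuousC g x -> continuousC (fun t => f t - g t)%C x.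
Proof. intros H1 H2; apply continuousC_plus; auto; now apply continuousC_opp. Qed.

Lemma continuousC_mult f g x : continuousC f x -> continuousC g x -> continuousC (fun t => f t * g t)%C x.
Proof.
intros [H1 H2] [H3 H4]; split.
- apply (continuous_minus (V := R_NormedModule)); now apply (continuous_mult (K := R_AbsRing)).
- apply (continuous_plus (V := R_NormedModule)); now apply (continuous_mult (K := R_AbsRing)).
Qed.

Lemma continuousC_eps f x : continuousC f x <->
  (forall eps, 0 < eps -> locally x (fun t => Cmod (f t - f x)%C < eps)).
Proof.
split.
- intros [H1 H2] eps He.
  assert (He2 : 0 < eps / 2) by lra.
  pose proof (proj1 (filterlim_locally (U := R_UniformSpace) _ _) H1 (mkposreal _ He2)) as L1.
  pose proof (proj1 (filterlim_locally (U := R_UniformSpace) _ _) H2 (mkposreal _ He2)) as L2.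
  generalize (filter_and _ _ L1 L2); apply filter_imp; intros t [B1 B2].
  apply Rle_lt_trans with (1 := Cmod_le_Re_Im _).
  change (Rabs (Re (f t) - Re (f x)) < eps / 2) in B1.
  change (Rabs (Im (f t) - Im (f x)) < eps / 2) in B2.
  change (Rabs (Re (f t) - Re (f x)) + Rabs (Im (f t) - Im (f x)) < eps); lra.
- intros Hf; split; apply (filterlim_locally (U := R_UniformSpace)); intros eps;
    generalize (Hf eps (cond_pos eps)); apply filter_imp; intros t Ht.
  + change (Rabs (Re (f t) - Re (f x)) < eps). apply Rle_lt_trans with (2 := Ht).
    apply (re_le_Cmod (f t - f x)%C).
  + change (Rabs (Im (f t) - Im (f x)) < eps). apply Rle_lt_trans with (2 := Ht).
    apply (im_le_Cmod (f t - f x)%C).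
Qed.

Lemma continuousC_comp (phi : C -> C) f x :
  continuous_atC phi (f x) -> continuousC f x -> continuousC (fun t => phi (f t)) x.
Proof.
intros Hp Hf; apply continuousC_eps; intros eps He.
destruct (Hp eps He) as [del [Hd Hw]].
generalize (proj1 (continuousC_eps f x) Hf del Hd); apply filter_imp; auto.
Qed.

End Continuity.

Lemma continuousC_fst (f : R -> C) (p : R * R) :
  continuousC f (fst p) -> continuousC (fun q : R * R => f (fst q)) p.
Proof.
destruct p as [x y]; intros [H1 H2]; split.
- exact (continuous_comp (U := prod_UniformSpace R_UniformSpace R_UniformSpace)
    fst (fun t => Re (f t)) (x, y) (continuous_fst x y) H1).
- exact (continuous_comp (U := prod_UniformSpace R_UniformSpace R_UniformSpace)
    fst (fun t => Im (f t)) (x, y) (continuous_fst x y) H2).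
Qed.

Lemma continuousC_snd (f : R -> C) (p : R * R) :
  continuousC f (snd p) -> continuousC (fun q : R * R => f (snd q)) p.
Proof.
destruct p as [x y]; intros [H1 H2]; split.
- exact (continuous_comp (U := prod_UniformSpace R_UniformSpace R_UniformSpace)
    snd (fun t => Re (f t)) (x, y) (continuous_snd x y) H1).
- exact (continuous_comp (U := prod_UniformSpace R_UniformSpace R_UniformSpace)
    snd (fun t => Im (f t)) (x, y) (continuous_snd x y) H2).
Qed.

Lemma continuousC_RtoC (x : R) : continuousC RtoC x.
Proof. split; [apply continuous_id|apply continuous_const]. Qed.

Lemma continuous_atC_inv (z : C) : z <> 0 -> continuous_atC Cinv z.
Proof.
intros Hz eps He.
assert (Hm : 0 < Cmod z) by now apply Cmod_gt_0.
exists (Rmin (Cmod z / 2) (eps * Cmod z ^ 2 / 2)); split.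
{ apply Rmin_pos; [lra|]. assert (0 < Cmod z ^ 2) by nra. nra. }
intros w Hw.
assert (H1 := Rlt_le_trans _ _ _ Hw (Rmin_l _ _)).
assert (H2 := Rlt_le_trans _ _ _ Hw (Rmin_r _ _)).
assert (Hwm : Cmod z / 2 < Cmod w).
{ pose proof (Cmod_triangle w (z - w)%C) as Ht.
  replace (w + (z - w))%C with z in Ht by ring.
  replace (z - w)%C with (- (w - z))%C in Ht by ring. rewrite Cmod_opp in Ht; lra. }
assert (Hw0 : w <> 0) by (apply Cmod_gt_0; lra).
replace (/ w - / z)%C with (- (w - z) / (w * z))%C by (field; auto).
rewrite Cmod_div; [|now apply Cmult_neq_0]. rewrite Cmod_opp Cmod_mult.
assert (Hwz : 0 < Cmod w * Cmod z) by (apply Rmult_lt_0_compat; lra).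
apply Rmult_lt_reg_r with (Cmod w * Cmod z); auto.
unfold Rdiv; rewrite Rmult_assoc Rinv_l; [|lra].
assert (eps * (Cmod z / 2 * Cmod z) <= eps * (Cmod w * Cmod z)).
{ apply Rmult_le_compat_l; [lra|]; apply Rmult_le_compat_r; lra. }
simpl in H2; lra.
Qed.

Lemma derivative_C_continuous (phi : C -> C) (z l : C) :
  derivative_C phi z l -> continuous_atC phi z.
Proof.
intros Hp eps He.
destruct (Hp 1 Rlt_0_1) as [del [Hd Hw]].
pose proof (Cmod_ge_0 l) as Hl.
exists (Rmin del (eps / (Cmod l + 2))); split.
{ apply Rmin_pos; auto; apply Rdiv_lt_0_compat; lra. }
intros w Hlt.
assert (H1 := Rlt_le_trans _ _ _ Hlt (Rmin_l _ _)).
assert (H2 := Rlt_le_trans _ _ _ Hlt (Rmin_r _ _)).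
specialize (Hw w H1).
pose proof (Cmod_triangle (phi w - phi z - l * (w - z))%C (l * (w - z))%C) as Ht.
replace (phi w - phi z - l * (w - z) + l * (w - z))%C with (phi w - phi z)%C in Ht by ring.
rewrite Cmod_mult in Ht.
assert (Cmod (w - z)%C * (Cmod l + 2) < eps).
{ apply Rmult_lt_reg_r with (/ (Cmod l + 2)); [apply Rinv_0_lt_compat; lra|].
  rewrite Rmult_assoc Rinv_r; [|lra]. unfold Rdiv in H2; lra. }
pose proof (Cmod_ge_0 (w - z)%C); nra.
Qed.

Lemma derivative_R_continuous (f : R -> C) x l : derivative_R f x l -> continuousC f x.
Proof.
intros [H1 H2]; split; apply (ex_derive_continuous (V := R_NormedModule)); eexists; eassumption.
Qed.

Lemma derivative_R_mult (f g : R -> C) x lf lg :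
  derivative_R f x lf -> derivative_R g x lg ->
  derivative_R (fun t => f t * g t)%C x (lf * g x + f x * lg)%C.
Proof.
intros [H1 H2] [H3 H4]; split.
- replace (Re (lf * g x + f x * lg)%C) with
    ((Re lf * Re (g x) + Re (f x) * Re lg) - (Im lf * Im (g x) + Im (f x) * Im lg))
    by (unfold Re, Im; simpl; ring).
  apply (is_derive_minus (V := R_NormedModule)); apply (is_derive_mult (K := R_AbsRing)); auto; intros; apply Rmult_comm.
- replace (Im (lf * g x + f x * lg)%C) with
    ((Re lf * Im (g x) + Re (f x) * Im lg) + (Im lf * Re (g x) + Im (f x) * Re lg))
    by (unfold Re, Im; simpl; ring).
  apply (is_derive_plus (V := R_NormedModule)); apply (is_derive_mult (K := R_AbsRing)); auto; intros; apply Rmult_comm.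
Qed.

Lemma is_derive_eps (f : R -> R) (x l : R) : is_derive f x l <->
  (forall eps, 0 < eps -> exists del, 0 < del /\
     forall y, Rabs (y - x) < del -> Rabs (f y - f x - l * (y - x)) <= eps * Rabs (y - x)).
Proof.
split.
- intros Hf eps He. apply is_derive_Reals in Hf.
  destruct (Hf eps He) as [del Hd]; exists del; split; [apply cond_pos|].
  intros y Hy. destruct (Req_dec (y - x) 0) as [H0|H0].
  + replace y with x by lra. rewrite !Rminus_diag Rmult_0_r Rminus_diag Rabs_R0; lra.
  + specialize (Hd (y - x) H0 Hy). replace (x + (y - x)) with y in Hd by ring.
    replace (f y - f x - l * (y - x)) with (((f y - f x) / (y - x) - l) * (y - x)) by (field; auto).
    rewrite Rabs_mult; apply Rmult_le_compat_r; [apply Rabs_pos|lra].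
- intros Hf; apply is_derive_Reals; intros eps He.
  destruct (Hf (eps / 2) ltac:(lra)) as [del [Hd Hy]]; exists (mkposreal _ Hd); simpl.
  intros h Hh0 Hh. specialize (Hy (x + h)). replace (x + h - x) with h in Hy by ring.
  specialize (Hy Hh).
  replace ((f (x + h) - f x) / h - l) with ((f (x + h) - f x - l * h) / h) by (field; auto).
  unfold Rdiv; rewrite Rabs_mult Rabs_inv.
  assert (0 < Rabs h) by now apply Rabs_pos_lt.
  apply Rle_lt_trans with (eps / 2); [|lra].
  apply Rmult_le_reg_r with (Rabs h); auto. rewrite Rmult_assoc Rinv_l; lra.
Qed.

Lemma derivative_R_eps (f : R -> C) (x : R) (l : C) : derivative_R f x l <->
  (forall eps, 0 < eps -> exists del, 0 < del /\
     forall y, Rabs (y - x) < del ->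
       Cmod (f y - f x - l * RtoC (y - x))%C <= eps * Rabs (y - x)).
Proof.
assert (ERe : forall y, Re (f y - f x - l * RtoC (y - x))%C = Re (f y) - Re (f x) - Re l * (y - x))
  by (intros; unfold Re, Im; simpl; ring).
assert (EIm : forall y, Im (f y - f x - l * RtoC (y - x))%C = Im (f y) - Im (f x) - Im l * (y - x))
  by (intros; unfold Re, Im; simpl; ring).
split.
- intros [H1 H2] eps He.
  destruct (proj1 (is_derive_eps _ _ _) H1 (eps / 2) ltac:(lra)) as [d1 [Hd1 L1]].
  destruct (proj1 (is_derive_eps _ _ _) H2 (eps / 2) ltac:(lra)) as [d2 [Hd2 L2]].
  exists (Rmin d1 d2); split; [now apply Rmin_pos|].
  intros y Hy.
  specialize (L1 y (Rlt_le_trans _ _ _ Hy (Rmin_l _ _))).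
  specialize (L2 y (Rlt_le_trans _ _ _ Hy (Rmin_r _ _))).
  apply Rle_trans with (1 := Cmod_le_Re_Im _). rewrite ERe EIm; lra.
- intros Hf; split; apply is_derive_eps; intros eps He;
    destruct (Hf eps He) as [del [Hd Hy]]; exists del; split; auto; intros y Hlt;
    apply Rle_trans with (2 := Hy y Hlt).
  + rewrite -ERe; apply re_le_Cmod.
  + rewrite -EIm; apply im_le_Cmod.
Qed.

Lemma derivative_chain (phi : C -> C) (g : R -> C) (x : R) (l l' : C) :
  derivative_C phi (g x) l -> derivative_R g x l' ->
  derivative_R (fun t => phi (g t)) x (l * l')%C.
Proof.
intros Hp Hg; apply derivative_R_eps; intros eps He.
pose proof (Cmod_ge_0 l) as Hl; pose proof (Cmod_ge_0 l') as Hl'.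
set (e1 := eps / (2 * (Cmod l' + 1))).
assert (He1 : 0 < e1) by (apply Rdiv_lt_0_compat; lra).
set (e2 := Rmin 1 (eps / (2 * (Cmod l + 1)))).
assert (He2 : 0 < e2) by (apply Rmin_pos; [lra|apply Rdiv_lt_0_compat; lra]).
destruct (Hp e1 He1) as [d1 [Hd1 L1]].
destruct (proj1 (derivative_R_eps _ _ _) Hg e2 He2) as [d2 [Hd2 L2]].
exists (Rmin d2 (d1 / (Cmod l' + 1))); split.
{ apply Rmin_pos; auto; apply Rdiv_lt_0_compat; lra. }
intros y Hy.
assert (Y1 := Rlt_le_trans _ _ _ Hy (Rmin_l _ _)).
assert (Y2 := Rlt_le_trans _ _ _ Hy (Rmin_r _ _)).
specialize (L2 y Y1).
pose proof (Rabs_pos (y - x)) as Hab.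
assert (Hg1 : Cmod (g y - g x)%C <= (Cmod l' + 1) * Rabs (y - x)).
{ pose proof (Cmod_triangle (g y - g x - l' * RtoC (y - x))%C (l' * RtoC (y - x))%C) as Ht.
  replace (g y - g x - l' * RtoC (y - x) + l' * RtoC (y - x))%C with (g y - g x)%C in Ht by ring.
  rewrite Cmod_mult Cmod_R in Ht. pose proof (Rmin_l 1 (eps / (2 * (Cmod l + 1)))). fold e2 in H. nra. }
assert (Hg2 : Cmod (g y - g x)%C < d1).
{ apply Rle_lt_trans with (1 := Hg1).
  apply Rmult_lt_reg_r with (/ (Cmod l' + 1)); [apply Rinv_0_lt_compat; lra|].
  rewrite (Rmult_comm (Cmod l' + 1)) Rmult_assoc Rinv_r; [|lra]. unfold Rdiv in Y2; lra. }
specialize (L1 (g y) Hg2).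
pose proof (Cmod_triangle (phi (g y) - phi (g x) - l * (g y - g x))%C (l * (g y - g x - l' * RtoC (y - x)))%C) as Ht.
replace (phi (g y) - phi (g x) - l * (g y - g x) + l * (g y - g x - l' * RtoC (y - x)))%C
  with (phi (g y) - phi (g x) - l * l' * RtoC (y - x))%C in Ht by ring.
rewrite (Cmod_mult l) in Ht.
apply Rle_trans with (1 := Ht).
assert (E1 : e1 * Cmod (g y - g x)%C <= eps / 2 * Rabs (y - x)).
{ apply Rle_trans with (e1 * ((Cmod l' + 1) * Rabs (y - x))).
  - apply Rmult_le_compat_l; lra.
  - right; unfold e1; field; lra. }
assert (E2 : Cmod l * Cmod (g y - g x - l' * RtoC (y - x))%C <= eps / 2 * Rabs (y - x)).
{ apply Rle_trans with ((Cmod l + 1) * (e2 * Rabs (y - x))).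
  - apply Rmult_le_compat; try lra; apply Cmod_ge_0.
  - rewrite -Rmult_assoc; apply Rmult_le_compat_r; auto.
    apply Rle_trans with ((Cmod l + 1) * (eps / (2 * (Cmod l + 1)))).
    + apply Rmult_le_compat_l; [lra|]; apply Rmin_r.
    + right; field; lra. }
lra.
Qed.

(** ** Integrals *)

Definition integrableC (f : R -> C) (a b : R) : Prop :=
  ex_RInt (fun t => Re (f t)) a b /\ ex_RInt (fun t => Im (f t)) a b.

Lemma continuous_integrableC (f : R -> C) a b : a <= b ->
  (forall t, a <= t <= b -> continuousC f t) -> integrableC f a b.
Proof.
intros Hab Hf; split; apply ex_RInt_continuous_R; intros t Ht;
  rewrite Rmin_left in Ht; auto; rewrite Rmax_right in Ht; auto; now apply Hf.
Qed.

Lemma CInt_ext (f g : R -> C) a b : a <= b ->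
  (forall t, a <= t <= b -> f t = g t) -> CInt f a b = CInt g a b.
Proof.
intros Hab E; unfold CInt; f_equal; apply (RInt_ext (V := R_CompleteNormedModule)); intros t Ht;
  rewrite Rmin_left in Ht; auto; rewrite Rmax_right in Ht; auto; rewrite E; auto; lra.
Qed.

Lemma CInt_plus (f g : R -> C) a b : integrableC f a b -> integrableC g a b ->
  CInt (fun t => f t + g t)%C a b = (CInt f a b + CInt g a b)%C.
Proof.
intros [H1 H2] [H3 H4]; unfold CInt, Cplus; simpl; f_equal; rewrite -RInt_plus_R; auto.
Qed.

Lemma CInt_minus (f g : R -> C) a b : integrableC f a b -> integrableC g a b ->
  CInt (fun t => f t - g t)%C a b = (CInt f a b - CInt g a b)%C.
Proof.
intros [H1 H2] [H3 H4].
transitivity ((RInt (fun t => Re (f t)) a b - RInt (fun t => Re (g t)) a b,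
  RInt (fun t => Im (f t)) a b - RInt (fun t => Im (g t)) a b) : C).
- unfold CInt; f_equal; rewrite -RInt_minus_R; auto.
- apply injective_projections; simpl; ring.
Qed.

Lemma CInt_mult_l (c : C) (f : R -> C) a b : integrableC f a b ->
  CInt (fun t => c * f t)%C a b = (c * CInt f a b)%C.
Proof.
intros [H1 H2].
assert (S1 : forall r, ex_RInt (fun t => r * Re (f t)) a b)
  by (intros r; exact (ex_RInt_scal (V := R_NormedModule) _ _ _ r H1)).
assert (S2 : forall r, ex_RInt (fun t => r * Im (f t)) a b)
  by (intros r; exact (ex_RInt_scal (V := R_NormedModule) _ _ _ r H2)).
unfold CInt; apply injective_projections; simpl.
- rewrite -!RInt_scal_R; auto. rewrite -RInt_minus_R; auto.
- rewrite -!RInt_scal_R; auto. rewrite -RInt_plus_R; auto.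
Qed.

Lemma CInt_bound (f : R -> C) a b M : a <= b -> integrableC f a b ->
  (forall t, a <= t <= b -> Cmod (f t) <= M) -> Cmod (CInt f a b) <= 2 * ((b - a) * M).
Proof.
intros Hab [H1 H2] HM; apply Rle_trans with (1 := Cmod_le_Re_Im _).
assert (Rabs (RInt (fun t => Re (f t)) a b) <= (b - a) * M).
{ apply abs_RInt_le_const; auto; intros t Ht; apply Rle_trans with (2 := HM t Ht); apply re_le_Cmod. }
assert (Rabs (RInt (fun t => Im (f t)) a b) <= (b - a) * M).
{ apply abs_RInt_le_const; auto; intros t Ht; apply Rle_trans with (2 := HM t Ht); apply im_le_Cmod. }
change (Rabs (RInt (fun t => Re (f t)) a b) + Rabs (RInt (fun t => Im (f t)) a b) <= 2 * ((b - a) * M)); lra.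
Qed.

Lemma CInt_derivative (f f' : R -> C) a b : a <= b ->
  (forall t, a <= t <= b -> derivative_R f t (f' t)) ->
  (forall t, a <= t <= b -> continuousC f' t) ->
  CInt f' a b = (f b - f a)%C.
Proof.
intros Hab Hd Hc; unfold CInt; apply injective_projections;
  apply (is_RInt_unique (V := R_CompleteNormedModule)); simpl.
- apply (is_RInt_derive (V := R_CompleteNormedModule) (fun t => Re (f t)));
    intros t Ht; rewrite Rmin_left in Ht; auto; rewrite Rmax_right in Ht; auto;
    [apply (Hd t Ht)|apply (Hc t Ht)].
- apply (is_RInt_derive (V := R_CompleteNormedModule) (fun t => Im (f t)));
    intros t Ht; rewrite Rmin_left in Ht; auto; rewrite Rmax_right in Ht; auto;
    [apply (Hd t Ht)|apply (Hc t Ht)].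
Qed.

Lemma CInt_fubini (f : R -> R -> C) (a b c d : R) : a <= b -> c <= d ->
  (forall x y, a <= x <= b -> c <= y <= d ->
     continuousC (fun p : R * R => f (fst p) (snd p)) (x, y)) ->
  CInt (fun x => CInt (f x) c d) a b = CInt (fun y => CInt (fun x => f x y) a b) c d.
Proof.
intros Hab Hcd Hf; unfold CInt; simpl; f_equal.
- apply (fubini (fun x y => Re (f x y))); auto.
  intros x y Hx Hy; apply continuity_2d_pt_filterlim, (Hf x y Hx Hy).
- apply (fubini (fun x y => Im (f x y))); auto.
  intros x y Hx Hy; apply continuity_2d_pt_filterlim, (Hf x y Hx Hy).
Qed.

(** * Contours *)

Record path := Path {
  at_time : R -> C;
  speed : R -> C;
  lo : R;
  hi : R;
  max_speed : R;
  lo_le_hi : lo <= hi;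
  speed_derivative : forall t, derivative_R at_time t (speed t);
  speed_continuous : forall t, continuousC speed t;
  speed_bound : forall t, lo <= t <= hi -> Cmod (speed t) <= max_speed
}.

Definition path_int (phi : C -> C) (p : path) : C :=
  CInt (fun t => speed p t * phi (at_time p t))%C (lo p) (hi p).

Definition contour_int (phi : C -> C) (g : list path) : C :=
  fold_right (fun p acc => path_int phi p + acc)%C (RtoC 0) g.

Definition on_contour (g : list path) (z : C) : Prop :=
  exists p t, In p g /\ lo p <= t <= hi p /\ z = at_time p t.

(** The factor 2 comes from bounding real and imaginary parts separately. *)
Definition contour_length (g : list path) : R :=
  fold_right (fun p acc => 2 * ((hi p - lo p) * max_speed p) + acc) 0 g.

Lemma at_time_continuous (p : path) t : continuousC (at_time p) t.
Proof. exact (derivative_R_continuous _ _ _ (speed_derivative p t)). Qed.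

Lemma path_integrable (phi : C -> C) (p : path) :
  (forall t, lo p <= t <= hi p -> continuous_atC phi (at_time p t)) ->
  integrableC (fun t => speed p t * phi (at_time p t))%C (lo p) (hi p).
Proof.
intros Hp; apply continuous_integrableC; [apply lo_le_hi|]; intros t Ht.
apply continuousC_mult; [apply speed_continuous|].
apply continuousC_comp; auto. apply at_time_continuous.
Qed.

Lemma max_speed_nonneg (p : path) : 0 <= max_speed p.
Proof.
apply Rle_trans with (Cmod (speed p (lo p))); [apply Cmod_ge_0|].
apply speed_bound; pose proof (lo_le_hi p); lra.
Qed.

Lemma path_int_bound (phi : C -> C) (p : path) (M : R) :
  (forall t, lo p <= t <= hi p -> continuous_atC phi (at_time p t)) ->
  (forall t, lo p <= t <= hi p -> Cmod (phi (at_time p t)) <= M) ->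
  Cmod (path_int phi p) <= 2 * ((hi p - lo p) * max_speed p) * M.
Proof.
intros Hc HM.
replace (2 * ((hi p - lo p) * max_speed p) * M) with (2 * ((hi p - lo p) * (max_speed p * M))) by ring.
apply CInt_bound; [apply lo_le_hi|now apply path_integrable|].
intros t Ht; rewrite Cmod_mult; apply Rmult_le_compat; try apply Cmod_ge_0; auto.
now apply speed_bound.
Qed.

Section ContourInt.

Implicit Types (phi : C -> C) (g : list path).

Definition continuous_on_contour phi g : Prop :=
  forall z, on_contour g z -> continuous_atC phi z.

Lemma on_contour_head p g t : lo p <= t <= hi p -> on_contour (p :: g) (at_time p t).
Proof. intros Ht; exists p, t; split; [now left|auto]. Qed.

Lemma on_contour_tail p g z : on_contour g z -> on_contour (p :: g) z.
Proof. intros [q [t [Hq Ht]]]; exists q, t; split; [now right|auto]. Qed.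

Lemma contour_int_ext phi phi' g :
  (forall z, on_contour g z -> phi z = phi' z) -> contour_int phi g = contour_int phi' g.
Proof.
induction g as [|p g IH]; intros E; simpl; auto.
rewrite IH; [|intros z Hz; now apply E, on_contour_tail].
f_equal; apply CInt_ext; [apply lo_le_hi|]; intros t Ht.
rewrite E; auto. now apply on_contour_head.
Qed.

Lemma contour_int_plus phi phi' g : continuous_on_contour phi g -> continuous_on_contour phi' g ->
  contour_int (fun z => phi z + phi' z)%C g = (contour_int phi g + contour_int phi' g)%C.
Proof.
induction g as [|p g IH]; intros H1 H2; simpl; [ring|].
rewrite IH; [|intros z Hz; now apply H1, on_contour_tail|intros z Hz; now apply H2, on_contour_tail].
assert (E : path_int (fun z => phi z + phi' z)%C p = (path_int phi p + path_int phi' p)%C).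
{ unfold path_int; rewrite -CInt_plus.
  - apply CInt_ext; [apply lo_le_hi|intros; ring].
  - apply path_integrable; intros; now apply H1, on_contour_head.
  - apply path_integrable; intros; now apply H2, on_contour_head. }
rewrite E; ring.
Qed.

Lemma contour_int_mult_l c phi g : continuous_on_contour phi g ->
  contour_int (fun z => c * phi z)%C g = (c * contour_int phi g)%C.
Proof.
induction g as [|p g IH]; intros H1; simpl; [ring|].
rewrite IH; [|intros z Hz; now apply H1, on_contour_tail].
assert (E : path_int (fun z => c * phi z)%C p = (c * path_int phi p)%C).
{ unfold path_int; rewrite -CInt_mult_l.
  - apply CInt_ext; [apply lo_le_hi|intros; ring].
  - apply path_integrable; intros; now apply H1, on_contour_head. }
rewrite E; ring.
Qed.

Lemma contour_int_minus phi phi' g : continuous_on_contour phi g -> continuous_on_contour phi' g ->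
  contour_int (fun z => phi z - phi' z)%C g = (contour_int phi g - contour_int phi' g)%C.
Proof.
induction g as [|p g IH]; intros H1 H2; simpl; [ring|].
rewrite IH; [|intros z Hz; now apply H1, on_contour_tail|intros z Hz; now apply H2, on_contour_tail].
assert (E : path_int (fun z => phi z - phi' z)%C p = (path_int phi p - path_int phi' p)%C).
{ unfold path_int; rewrite -CInt_minus.
  - apply CInt_ext; [apply lo_le_hi|intros; ring].
  - apply path_integrable; intros; now apply H1, on_contour_head.
  - apply path_integrable; intros; now apply H2, on_contour_head. }
rewrite E; ring.
Qed.

Lemma contour_length_nonneg g : 0 <= contour_length g.
Proof.
induction g as [|p g IH]; simpl; [lra|].
pose proof (lo_le_hi p); pose proof (max_speed_nonneg p).
pose proof (Rmult_le_pos (hi p - lo p) (max_speed p) ltac:(lra) ltac:(auto)); lra.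
Qed.

Lemma contour_int_bound phi g (M : R) : continuous_on_contour phi g ->
  (forall z, on_contour g z -> Cmod (phi z) <= M) ->
  Cmod (contour_int phi g) <= contour_length g * M.
Proof.
induction g as [|p g IH]; intros Hc HM; simpl; [rewrite Cmod_0; lra|].
apply Rle_trans with (1 := Cmod_triangle _ _).
rewrite Rmult_plus_distr_r; apply Rplus_le_compat.
- apply path_int_bound; intros t Ht; [apply Hc|apply HM]; now apply on_contour_head.
- apply IH; intros z Hz; [apply Hc|apply HM]; now apply on_contour_tail.
Qed.

End ContourInt.

(** ** The kernel [1 / (w - z)] *)

Lemma continuous_atC_mult (phi psi : C -> C) z :
  continuous_atC phi z -> continuous_atC psi z -> continuous_atC (fun w => phi w * psi w)%C z.
Proof.
intros H1 H2 eps He.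
set (e1 := eps / (2 * (Cmod (psi z) + 1))).
set (e2 := Rmin 1 (eps / (2 * (Cmod (phi z) + 1)))).
pose proof (Cmod_ge_0 (phi z)); pose proof (Cmod_ge_0 (psi z)).
assert (He1 : 0 < e1) by (apply Rdiv_lt_0_compat; lra).
assert (He2 : 0 < e2) by (apply Rmin_pos; [lra|apply Rdiv_lt_0_compat; lra]).
destruct (H1 e1 He1) as [d1 [Hd1 L1]]; destruct (H2 e2 He2) as [d2 [Hd2 L2]].
exists (Rmin d1 d2); split; [now apply Rmin_pos|]; intros w Hw.
specialize (L1 w (Rlt_le_trans _ _ _ Hw (Rmin_l _ _))).
specialize (L2 w (Rlt_le_trans _ _ _ Hw (Rmin_r _ _))).
replace (phi w * psi w - phi z * psi z)%C
  with ((phi w - phi z) * psi w + phi z * (psi w - psi z))%C by ring.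
apply Rle_lt_trans with (1 := Cmod_triangle _ _); rewrite !Cmod_mult.
assert (Hpw : Cmod (psi w) <= Cmod (psi z) + 1).
{ pose proof (Cmod_triangle (psi w - psi z)%C (psi z)) as Ht.
  replace (psi w - psi z + psi z)%C with (psi w) in Ht by ring.
  pose proof (Rmin_l 1 (eps / (2 * (Cmod (phi z) + 1)))) as Hm; fold e2 in Hm; lra. }
assert (A1 : Cmod (phi w - phi z)%C * Cmod (psi w) <= eps / 2).
{ apply Rle_trans with (e1 * (Cmod (psi z) + 1)).
  - apply Rmult_le_compat; try apply Cmod_ge_0; lra.
  - right; unfold e1; field; lra. }
assert (A2 : Cmod (phi z) * Cmod (psi w - psi z)%C < eps / 2).
{ apply Rle_lt_trans with (Cmod (phi z) * (eps / (2 * (Cmod (phi z) + 1)))).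
  - apply Rmult_le_compat_l; auto. apply Rlt_le, Rlt_le_trans with (1 := L2), Rmin_r.
  - apply Rlt_le_trans with ((Cmod (phi z) + 1) * (eps / (2 * (Cmod (phi z) + 1)))).
    + apply Rmult_lt_compat_r; [apply Rdiv_lt_0_compat|]; lra.
    + right; field; lra. }
lra.
Qed.

Lemma continuous_atC_minus (phi psi : C -> C) z :
  continuous_atC phi z -> continuous_atC psi z -> continuous_atC (fun w => phi w - psi w)%C z.
Proof.
intros H1 H2 eps He.
destruct (H1 (eps / 2) ltac:(lra)) as [d1 [Hd1 L1]]; destruct (H2 (eps / 2) ltac:(lra)) as [d2 [Hd2 L2]].
exists (Rmin d1 d2); split; [now apply Rmin_pos|]; intros w Hw.
specialize (L1 w (Rlt_le_trans _ _ _ Hw (Rmin_l _ _))).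
specialize (L2 w (Rlt_le_trans _ _ _ Hw (Rmin_r _ _))).
replace (phi w - psi w - (phi z - psi z))%C with (phi w - phi z + - (psi w - psi z))%C by ring.
apply Rle_lt_trans with (1 := Cmod_triangle _ _); rewrite Cmod_opp; lra.
Qed.

Lemma continuous_atC_const (c z : C) : continuous_atC (fun _ => c) z.
Proof.
intros eps He; exists 1; split; [lra|]; intros w _.
replace (c - c)%C with (RtoC 0) by ring; rewrite Cmod_0; lra.
Qed.

Lemma continuous_atC_shift_inv (w z : C) : w <> z -> continuous_atC (fun u => / (w - u))%C z.
Proof.
intros Hwz eps He.
assert (Hne : (w - z)%C <> 0).
{ intros E; apply Hwz. replace w with (w - z + z)%C by ring. rewrite E; ring. }
destruct (continuous_atC_inv (w - z)%C Hne eps He) as [del [Hd L]].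
exists del; split; auto; intros u Hu; apply L.
replace (w - u - (w - z))%C with (- (u - z))%C by ring. now rewrite Cmod_opp.
Qed.

Lemma Cinv_minus_sym (x w : C) : (/ (x - w) = - / (w - x))%C.
Proof.
destruct (Ceq_dec (w - x)%C 0) as [Hz|Hz].
- replace (x - w)%C with (- (w - x))%C by ring. rewrite Hz.
  replace (- 0)%C with (RtoC 0) by ring. unfold Cinv; simpl. unfold Copp; simpl. unfold RtoC.
  f_equal; rewrite ?Ropp_0; unfold Rdiv; ring.
- field; split; auto. intros Hx; apply Hz.
  replace (w - x)%C with (- (x - w))%C by ring. rewrite Hx; ring.
Qed.

Lemma continuous_atC_inv_shift (w z : C) : w <> z -> continuous_atC (fun u => / (u - w))%C z.
Proof.
intros Hwz eps He.
destruct (continuous_atC_shift_inv w z Hwz eps He) as [del [Hd L]].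
exists del; split; auto; intros u Hu; specialize (L u Hu).
rewrite (Cinv_minus_sym u w) (Cinv_minus_sym z w). replace (- / (w - u) - - / (w - z))%C with (- (/ (w - u) - / (w - z)))%C by ring.
now rewrite Cmod_opp.
Qed.

Lemma derivative_C_inv_shift (w z : C) : z <> w ->
  derivative_C (fun u => / (u - w))%C z (- / ((z - w) * (z - w)))%C.
Proof.
intros Hzw eps He.
assert (Hne : (z - w)%C <> 0).
{ intros E; apply Hzw. replace z with (z - w + w)%C by ring. rewrite E; ring. }
assert (Hm : 0 < Cmod (z - w)%C) by now apply Cmod_gt_0.
set (m := Cmod (z - w)%C) in *.
exists (Rmin (m / 2) (eps * m ^ 3 / 2)); split.
{ apply Rmin_pos; [lra|]. assert (0 < m ^ 3) by now apply pow_lt. nra. }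
intros u Hu.
assert (U1 := Rlt_le_trans _ _ _ Hu (Rmin_l _ _)).
assert (U2 := Rlt_le_trans _ _ _ Hu (Rmin_r _ _)).
assert (Hum : m / 2 < Cmod (u - w)%C).
{ pose proof (Cmod_triangle (u - w)%C (- (u - z))%C) as Ht.
  replace (u - w + - (u - z))%C with (z - w)%C in Ht by ring. rewrite Cmod_opp in Ht; fold m in Ht; lra. }
assert (Hu0 : (u - w)%C <> 0) by (apply Cmod_gt_0; lra).
replace (/ (u - w) - / (z - w) - - / ((z - w) * (z - w)) * (u - z))%C
  with ((u - z) * (u - z) / ((u - w) * ((z - w) * (z - w))))%C by (field; auto).
rewrite Cmod_div; [|repeat apply Cmult_neq_0; auto].
rewrite !Cmod_mult; fold m. set (q := Cmod (u - z)%C) in *. set (r := Cmod (u - w)%C) in *.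
assert (Hq : 0 <= q) by apply Cmod_ge_0.
assert (Hden : 0 < r * (m * m)) by (apply Rmult_lt_0_compat; nra).
apply Rmult_le_reg_r with (r * (m * m)); auto.
unfold Rdiv; rewrite Rmult_assoc Rinv_l; [|lra].
assert (eps * (m / 2 * (m * m)) <= eps * (r * (m * m))).
{ apply Rmult_le_compat_l; [lra|]; apply Rmult_le_compat_r; nra. }
simpl in U2. nra.
Qed.

Lemma path_int_kernel_swap (phi : C -> C) (p q : path) :
  (forall t, lo q <= t <= hi q -> continuous_atC phi (at_time q t)) ->
  (forall s t, lo p <= s <= hi p -> lo q <= t <= hi q -> at_time q t <> at_time p s) ->
  path_int (fun z => path_int (fun w => phi w * / (w - z))%C q) p
  = path_int (fun w => phi w * path_int (fun z => / (w - z))%C p)%C q.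
Proof.
intros Hphi Hne.
set (k := fun s t => (speed p s * (speed q t * (phi (at_time q t) * / (at_time q t - at_time p s))))%C).
transitivity (CInt (fun s => CInt (k s) (lo q) (hi q)) (lo p) (hi p)).
{ apply CInt_ext; [apply lo_le_hi|]; intros s Hs.
  unfold path_int; rewrite -CInt_mult_l; auto.
  apply (path_integrable (fun w => phi w * / (w - at_time p s))%C); intros t Ht.
  apply continuous_atC_mult; auto.
  apply continuous_atC_inv_shift; intros E; now apply (Hne s t). }
rewrite CInt_fubini; try apply lo_le_hi.
- apply CInt_ext; [apply lo_le_hi|]; intros t Ht.
  assert (I1 : integrableC (fun s => speed p s * / (at_time q t - at_time p s))%C (lo p) (hi p)).
  { apply (path_integrable (fun z => / (at_time q t - z))%C); intros s Hs.
    apply continuous_atC_shift_inv; auto. }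
  assert (I2 : integrableC (fun s => phi (at_time q t) * (speed p s * / (at_time q t - at_time p s)))%C (lo p) (hi p)).
  { apply continuous_integrableC; [apply lo_le_hi|]; intros s Hs.
    apply continuousC_mult; [apply continuousC_const|].
    apply continuousC_mult; [apply speed_continuous|].
    apply (continuousC_comp (fun z => / (at_time q t - z))%C); [|apply at_time_continuous].
    apply continuous_atC_shift_inv; auto. }
  unfold path_int; rewrite -(CInt_mult_l (phi (at_time q t))); auto. rewrite -CInt_mult_l; auto.
  apply CInt_ext; [apply lo_le_hi|]; intros s Hs. unfold k; ring.
- intros s t Hs Ht; unfold k.
  apply continuousC_mult.
  { apply (continuousC_fst (speed p)); apply speed_continuous. }
  apply continuousC_mult.
  { apply (continuousC_snd (speed q)); apply speed_continuous. }
  apply continuousC_mult.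
  { apply (continuousC_snd (fun t => phi (at_time q t))).
    apply continuousC_comp; auto; apply at_time_continuous. }
  apply (continuousC_comp Cinv (fun x : R * R => at_time q (snd x) - at_time p (fst x))%C).
  + apply continuous_atC_inv; simpl. intros E; apply (Hne s t Hs Ht).
    replace (at_time q t) with (at_time q t - at_time p s + at_time p s)%C by ring. rewrite E; ring.
  + apply continuousC_minus.
    * apply (continuousC_snd (at_time q)); apply at_time_continuous.
    * apply (continuousC_fst (at_time p)); apply at_time_continuous.
Qed.

(** The distance [rho] to the contour is given explicitly, so that no compactness
    argument is needed. *)
Lemma cauchy_transform_continuous (phi : C -> C) (d : list path) (B rho : R) (z0 : C) :
  continuous_on_contour phi d -> (forall w, on_contour d w -> Cmod (phi w) <= B) ->
  0 < rho -> (forall w, on_contour d w -> rho <= Cmod (w - z0)%C) ->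
  continuous_atC (fun z => contour_int (fun w => phi w * / (w - z))%C d) z0.
Proof.
intros Hc HB Hrho Hd eps He.
set (L := contour_length d). assert (HL : 0 <= L) by apply contour_length_nonneg.
set (B' := Rabs B). assert (HB0 : 0 <= B') by apply Rabs_pos.
assert (HBB : B <= B') by apply Rle_abs.
set (K := (L + 1) * (B' + 1) * (2 / rho ^ 2)).
assert (Hr2 : 0 < rho ^ 2) by now apply pow_lt.
assert (HK : 0 < K).
{ unfold K; apply Rmult_lt_0_compat; [apply Rmult_lt_0_compat; lra|apply Rdiv_lt_0_compat; lra]. }
exists (Rmin (rho / 2) (eps / K)); split.
{ apply Rmin_pos; [lra|now apply Rdiv_lt_0_compat]. }
intros z Hz.
assert (Z1 := Rlt_le_trans _ _ _ Hz (Rmin_l _ _)).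
assert (Z2 := Rlt_le_trans _ _ _ Hz (Rmin_r _ _)).
assert (Hd2 : forall w, on_contour d w -> rho / 2 <= Cmod (w - z)%C).
{ intros w Hw; specialize (Hd w Hw).
  pose proof (Cmod_triangle (w - z)%C (z - z0)%C) as Ht.
  replace (w - z + (z - z0))%C with (w - z0)%C in Ht by ring; lra. }
assert (Hne0 : forall w, on_contour d w -> (w - z0)%C <> 0).
{ intros w Hw; apply Cmod_gt_0; specialize (Hd w Hw); lra. }
assert (Hne : forall w, on_contour d w -> (w - z)%C <> 0).
{ intros w Hw; apply Cmod_gt_0; specialize (Hd2 w Hw); lra. }
assert (Hcont : forall v, (forall w, on_contour d w -> (w - v)%C <> 0) ->
  continuous_on_contour (fun w => phi w * / (w - v))%C d).
{ intros v Hv w Hw; apply continuous_atC_mult; auto. apply continuous_atC_inv_shift.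
  intros E; apply (Hv w Hw); rewrite E; ring. }
rewrite -contour_int_minus; auto.
apply Rle_lt_trans with (L * ((B' + 1) * (2 / rho ^ 2) * Cmod (z - z0)%C)).
- apply contour_int_bound.
  + intros w Hw; now apply continuous_atC_minus; apply Hcont.
  + intros w Hw.
    replace (phi w * / (w - z) - phi w * / (w - z0))%C
      with (phi w * ((z - z0) * / ((w - z) * (w - z0))))%C by (field; split; auto).
    rewrite !Cmod_mult Cmod_inv; [|now apply Cmult_neq_0; auto]. rewrite Cmod_mult.
    specialize (Hd w Hw); specialize (Hd2 w Hw); specialize (HB w Hw).
    assert (Hinv : / (Cmod (w - z)%C * Cmod (w - z0)%C) <= 2 / rho ^ 2).
    { replace (2 / rho ^ 2) with (/ (rho / 2 * rho)) by (field; lra).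
      apply Rinv_le_contravar; [nra|]. apply Rmult_le_compat; lra. }
    assert (Hinv0 : 0 <= / (Cmod (w - z)%C * Cmod (w - z0)%C)).
    { apply Rlt_le, Rinv_0_lt_compat, Rmult_lt_0_compat; lra. }
    pose proof (Cmod_ge_0 (z - z0)%C) as Hq. pose proof (Cmod_ge_0 (phi w)).
    replace ((B' + 1) * (2 / rho ^ 2) * Cmod (z - z0)%C) with ((B' + 1) * (Cmod (z - z0)%C * (2 / rho ^ 2))) by ring.
    apply Rmult_le_compat; auto; [now apply Rmult_le_pos|lra|].
    now apply Rmult_le_compat_l.
- pose proof (Cmod_ge_0 (z - z0)%C) as Hq.
  apply Rle_lt_trans with (K * Cmod (z - z0)%C).
  + unfold K. replace (L * ((B' + 1) * (2 / rho ^ 2) * Cmod (z - z0)%C))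
      with (L * (B' + 1) * (2 / rho ^ 2) * Cmod (z - z0)%C) by ring.
    apply Rmult_le_compat_r; auto. apply Rmult_le_compat_r; [apply Rlt_le, Rdiv_lt_0_compat; lra|nra].
  + apply Rmult_lt_reg_l with (/ K); [now apply Rinv_0_lt_compat|].
    rewrite -Rmult_assoc Rinv_l; [|lra]. unfold Rdiv in Z2; lra.
Qed.

Section KernelFubini.

Variables (phi : C -> C) (B rho : R).
Hypothesis rho_pos : 0 < rho.

Lemma kernel_continuous_right (g : list path) (w0 : C) :
  (forall z, on_contour g z -> rho <= Cmod (w0 - z)%C) ->
  continuous_atC (fun w => contour_int (fun z => / (w - z))%C g) w0.
Proof.
intros Hg.
assert (Hc : continuous_atC (fun w => contour_int (fun z => (- (1)) * / (z - w))%C g) w0).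
{ apply cauchy_transform_continuous with 1 rho; auto.
  - intros z _; apply continuous_atC_const.
  - intros z _; rewrite Cmod_opp Cmod_1; lra.
  - intros z Hz; specialize (Hg z Hz). replace (z - w0)%C with (- (w0 - z))%C by ring. now rewrite Cmod_opp. }
assert (E : forall w, contour_int (fun z => - (1) * / (z - w))%C g = contour_int (fun z => / (w - z))%C g).
{ intros w; apply contour_int_ext; intros z _; rewrite (Cinv_minus_sym z w); ring. }
intros eps He; destruct (Hc eps He) as [del [Hd L]]; exists del; split; auto.
intros w Hw; rewrite -!E; auto.
Qed.

Lemma contour_int_kernel_swap (g d : list path) :
  continuous_on_contour phi d -> (forall w, on_contour d w -> Cmod (phi w) <= B) ->
  (forall z w, on_contour g z -> on_contour d w -> rho <= Cmod (w - z)%C) ->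
  contour_int (fun z => contour_int (fun w => phi w * / (w - z))%C d) g
  = contour_int (fun w => phi w * contour_int (fun z => / (w - z))%C g)%C d.
Proof.
intros Hc HB Hsep.
assert (Hne : forall z w, on_contour g z -> on_contour d w -> w <> z).
{ intros z w Hz Hw E; specialize (Hsep z w Hz Hw). rewrite E in Hsep.
  replace (z - z)%C with (RtoC 0) in Hsep by ring. rewrite Cmod_0 in Hsep; lra. }
assert (Hpath : forall q, (forall t, lo q <= t <= hi q -> on_contour d (at_time q t)) ->
  contour_int (fun z => path_int (fun w => phi w * / (w - z))%C q) g
  = path_int (fun w => phi w * contour_int (fun z => / (w - z))%C g)%C q).
{ intros q Hq; clear HB; revert Hsep Hne; induction g as [|p g' IH]; intros Hsep Hne.
  - simpl; unfold path_int. rewrite -(CInt_ext (fun _ => 0 * 0)%C); [|apply lo_le_hi|intros; ring].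
    rewrite CInt_mult_l; [|apply continuous_integrableC; [apply lo_le_hi|intros; apply continuousC_const]].
    ring.
  - simpl; rewrite IH.
    2: { intros z w Hz; apply Hsep; now apply on_contour_tail. }
    2: { intros z w Hz; apply Hne; now apply on_contour_tail. }
    rewrite path_int_kernel_swap.
    + unfold path_int; rewrite -CInt_plus.
      * apply CInt_ext; [apply lo_le_hi|intros; ring].
      * apply (path_integrable (fun w => phi w * path_int (fun z => / (w - z))%C p)%C).
        intros t Ht; apply continuous_atC_mult; [now apply Hc, Hq|].
        pose proof (kernel_continuous_right (p :: nil) (at_time q t)) as Hk.
        assert (E : forall w, contour_int (fun z => / (w - z))%C (p :: nil) = path_int (fun z => / (w - z))%C p)
          by (intros; simpl; ring).
        intros eps He; destruct Hk with (eps := eps) as [del [Hd L]]; auto.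
        { intros z [p' [s [[<-|[]] [Hs ->]]]]; apply Hsep; auto; now apply on_contour_head. }
        exists del; split; auto; intros w Hw; rewrite -!E; auto.
      * apply (path_integrable (fun w => phi w * contour_int (fun z => / (w - z))%C g')%C).
        intros t Ht; apply continuous_atC_mult; [now apply Hc, Hq|].
        apply kernel_continuous_right; intros z Hz; apply Hsep; auto; now apply on_contour_tail.
    + intros t Ht; now apply Hc, Hq.
    + intros s t Hs Ht; apply Hne; auto; now apply on_contour_head. }
clear Hne; revert Hc HB Hsep Hpath; induction d as [|q d' IH]; intros Hc HB Hsep Hpath.
- simpl. rewrite -(contour_int_ext (fun _ => 0 * 0)%C); [|intros; ring].
  rewrite contour_int_mult_l; [ring|intros z _; apply continuous_atC_const].
- simpl. rewrite contour_int_plus. all: cycle 1.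
  + intros z Hz.
    assert (Hk : continuous_atC (fun z => contour_int (fun w => phi w * / (w - z))%C (q :: nil)) z).
    { apply cauchy_transform_continuous with B rho; auto.
      - intros w [p' [s [[<-|[]] [Hs ->]]]]; apply Hc; now apply on_contour_head.
      - intros w [p' [s [[<-|[]] [Hs ->]]]]; apply HB; now apply on_contour_head.
      - intros w [p' [s [[<-|[]] [Hs ->]]]]; apply Hsep; auto; now apply on_contour_head. }
    intros eps He; destruct (Hk eps He) as [del [Hd L]]; exists del; split; auto.
    intros w Hw; specialize (L w Hw); simpl in L.
    match type of L with Cmod ?x < _ => replace x with
      (path_int (fun w0 => phi w0 * / (w0 - w))%C q - path_int (fun w0 => phi w0 * / (w0 - z))%C q)%C in L by ring end.
    exact L.
  + intros z Hz; apply cauchy_transform_continuous with B rho; auto.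
    * intros w Hw; now apply Hc, on_contour_tail.
    * intros w Hw; now apply HB, on_contour_tail.
    * intros w Hw; apply Hsep; auto; now apply on_contour_tail.
  + rewrite Hpath; [|intros t Ht; now apply on_contour_head].
    rewrite IH; auto.
    * intros w Hw; now apply Hc, on_contour_tail.
    * intros w Hw; now apply HB, on_contour_tail.
    * intros z w Hz Hw; apply Hsep; auto; now apply on_contour_tail.
    * intros q' Hq'; apply Hpath; intros t Ht; now apply on_contour_tail, Hq'.
Qed.

(** The scalar computation behind the product of two Riesz projections, the
    resolvent identity having replaced the product of resolvents by the difference
    quotient [(phi z - phi w) / (w - z)]. *)
Lemma double_contour_int (g d : list path) (c : C) :
  continuous_on_contour phi g -> continuous_on_contour phi d ->
  (forall w, on_contour d w -> Cmod (phi w) <= B) ->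
  (forall z w, on_contour g z -> on_contour d w -> rho <= Cmod (w - z)%C) ->
  (forall z, on_contour g z -> contour_int (fun w => / (w - z))%C d = c) ->
  (forall w, on_contour d w -> contour_int (fun z => / (z - w))%C g = 0) ->
  contour_int (fun z => contour_int (fun w => (phi z - phi w) * / (w - z))%C d) g
  = (c * contour_int phi g)%C.
Proof.
intros Hcg Hcd HB Hsep Hwd Hwg.
assert (Hne : forall z w, on_contour g z -> on_contour d w -> w <> z).
{ intros z w Hz Hw E; specialize (Hsep z w Hz Hw). rewrite E in Hsep.
  replace (z - z)%C with (RtoC 0) in Hsep by ring. rewrite Cmod_0 in Hsep; lra. }
rewrite (contour_int_ext _ (fun z => c * phi z - contour_int (fun w => phi w * / (w - z)) d)%C).
2: { intros z Hz. rewrite -(Hwd z Hz) (Cmult_comm _ (phi z)) -contour_int_mult_l. all: cycle 1.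
  - intros w Hw; apply continuous_atC_inv_shift; intros E; apply (Hne z w); auto.
  - rewrite -contour_int_minus. all: cycle 1.
    + intros w Hw; apply continuous_atC_mult; [apply continuous_atC_const|apply continuous_atC_inv_shift; intros E; apply (Hne z w); auto].
    + intros w Hw; apply continuous_atC_mult; [auto|apply continuous_atC_inv_shift; intros E; apply (Hne z w); auto].
    + apply contour_int_ext; intros; ring. }
rewrite contour_int_minus. all: cycle 1.
- intros z Hz; apply continuous_atC_mult; auto; apply continuous_atC_const.
- intros z Hz; apply cauchy_transform_continuous with B rho; auto.
- rewrite contour_int_mult_l; auto.
  rewrite contour_int_kernel_swap; auto.
  rewrite (contour_int_ext (fun w => phi w * _)%C (fun w => 0 * 0)%C). all: cycle 1.
  + intros w Hw. transitivity (phi w * - contour_int (fun z => / (z - w)) g)%C.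
    * f_equal. transitivity (contour_int (fun z => - (1) * / (z - w))%C g).
      { apply contour_int_ext; intros z _; rewrite (Cinv_minus_sym z w); ring. }
      rewrite contour_int_mult_l; [ring|intros z Hz; apply continuous_atC_inv_shift; intros E; now apply (Hne z w)].
    * rewrite (Hwg w Hw); ring.
  + rewrite contour_int_mult_l; [ring|intros z _; apply continuous_atC_const].
Qed.

End KernelFubini.

(** ** Segments and arcs *)

Lemma segment_derivative (p q : C) t : derivative_R (fun t => p + RtoC t * (q - p))%C t (q - p)%C.
Proof.
split; unfold Re, Im; simpl.
- auto_derive; auto; ring.
- auto_derive; auto; ring.
Qed.

Definition segment (p q : C) : path :=
  Path (fun t => p + RtoC t * (q - p))%C (fun _ => q - p)%C 0 1 (Cmod (q - p)%C)
    Rle_0_1 (segment_derivative p q)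
    (fun t => continuousC_const (q - p)%C t)
    (fun t _ => Rle_refl _).

Definition polar (r x : R) : C := (r * cos x, r * sin x).

Lemma arc_derivative (c : C) (r th om : R) t :
  derivative_R (fun t => c + polar r (th + om * t))%C t
    (- (r * om) * sin (th + om * t), (r * om) * cos (th + om * t)).
Proof.
split; unfold polar, Re, Im; simpl.
- auto_derive; auto; ring.
- auto_derive; auto; ring.
Qed.

Lemma arc_speed_continuous (r th om : R) t :
  continuousC (fun t => (- (r * om) * sin (th + om * t), (r * om) * cos (th + om * t)) : C) t.
Proof.
split; unfold Re, Im; simpl; apply (ex_derive_continuous (V := R_NormedModule)); auto_derive; auto.
Qed.

Lemma Cmod_polar (r x : R) : Cmod (polar r x) = Rabs r.
Proof.
unfold Cmod, polar; simpl. rewrite -(sqrt_Rsqr_abs r). f_equal.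
pose proof (sin2_cos2 x) as E. unfold Rsqr in *. nra.
Qed.

Lemma arc_speed_bound (r th om : R) t :
  Cmod (- (r * om) * sin (th + om * t), (r * om) * cos (th + om * t)) <= Rabs (r * om).
Proof.
right. rewrite -(Cmod_polar (r * om) (th + om * t)).
unfold Cmod, polar; simpl; f_equal; ring.
Qed.

Definition arc (c : C) (r th om a b : R) (Hab : a <= b) : path :=
  Path (fun t => c + polar r (th + om * t))%C
    (fun t => (- (r * om) * sin (th + om * t), (r * om) * cos (th + om * t))) a b (Rabs (r * om))
    Hab (arc_derivative c r th om) (arc_speed_continuous r th om)
    (fun t _ => arc_speed_bound r th om t).

Lemma zero_le_2PI : 0 <= 2 * PI.
Proof. pose proof PI_RGT_0; lra. Qed.

Definition circle (c : C) (r : R) : path := arc c r 0 1 0 (2 * PI) zero_le_2PI.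

Definition rectangle (x1 x2 y1 y2 : R) : list path :=
  segment (x1, y1) (x2, y1) :: segment (x2, y1) (x2, y2) ::
  segment (x2, y2) (x1, y2) :: segment (x1, y2) (x1, y1) :: nil.

(** ** Homotopy invariance *)

(** For [g x y = (1 - x) p(y) + x q(y)] the functions [d/dx (phi(g) dg/dy)] and
    [d/dy (phi(g) dg/dx)] coincide; integrating over the parameter rectangle, once in
    each order, gives the two sides. *)
Lemma homotopy (phi phi' : C -> C) (p q : path) :
  lo q = lo p -> hi q = hi p ->
  (forall x y, 0 <= x <= 1 -> lo p <= y <= hi p ->
     let z := (at_time p y + RtoC x * (at_time q y - at_time p y))%C in
     derivative_C phi z (phi' z) /\ continuous_atC phi' z) ->
  (path_int phi q - path_int phi p)%C =
  (path_int phi (segment (at_time p (hi p)) (at_time q (hi p)))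
   - path_int phi (segment (at_time p (lo p)) (at_time q (lo p))))%C.
Proof.
intros El Eh Hphi.
set (g := fun x y => (at_time p y + RtoC x * (at_time q y - at_time p y))%C).
set (w := fun y => (at_time q y - at_time p y)%C).
set (w' := fun y => (speed q y - speed p y)%C).
set (gy := fun x y => (speed p y + RtoC x * w' y)%C).
set (K := fun x y => (w' y * phi (g x y) + gy x y * (phi' (g x y) * w y))%C).
assert (Dgx : forall x y, derivative_R (fun u => g u y) x (w y)).
{ intros x y; split; unfold g, w, Re, Im; simpl; auto_derive; auto; ring. }
assert (Dgyx : forall x y, derivative_R (fun u => gy u y) x (w' y)).
{ intros x y; split; unfold gy, w', Re, Im; simpl; auto_derive; auto; ring. }
assert (Dw : forall y, derivative_R w y (w' y)).
{ intros y; destruct (speed_derivative p y) as [P1 P2]; destruct (speed_derivative q y) as [Q1 Q2].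
  split; unfold w, w'; apply (is_derive_minus (V := R_NormedModule)); auto. }
assert (Dgy : forall x y, derivative_R (fun v => g x v) y (gy x y)).
{ intros x y. unfold g, gy. destruct (speed_derivative p y) as [P1 P2]; destruct (Dw y) as [W1 W2].
  assert (ER : forall u v : C, Re (u + RtoC x * v)%C = Re u + x * Re v) by (intros; unfold Re, Im; simpl; ring).
  assert (EI : forall u v : C, Im (u + RtoC x * v)%C = Im u + x * Im v) by (intros; unfold Re, Im; simpl; ring).
  split; rewrite ?ER ?EI.
  - apply (is_derive_ext (fun v => Re (at_time p v) + x * Re (w v))); [intros v; now rewrite ER|].
    apply (is_derive_plus (V := R_NormedModule)); auto. exact (is_derive_scal _ y x _ W1).
  - apply (is_derive_ext (fun v => Im (at_time p v) + x * Im (w v))); [intros v; now rewrite EI|].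
    apply (is_derive_plus (V := R_NormedModule)); auto. exact (is_derive_scal _ y x _ W2). }
assert (Cw' : forall y, continuousC w' y) by (intros; apply continuousC_minus; apply speed_continuous).
assert (Cw : forall y, continuousC w y) by (intros; eapply derivative_R_continuous; apply Dw).
assert (CK : forall x y, 0 <= x <= 1 -> lo p <= y <= hi p ->
  continuousC (fun P : R * R => K (fst P) (snd P)) (x, y)).
{ intros x y Hx Hy; destruct (Hphi x y Hx Hy) as [H1 H2].
  assert (Cg : continuousC (fun P : R * R => g (fst P) (snd P)) (x, y)).
  { unfold g; apply continuousC_plus; [apply (continuousC_snd (at_time p)); apply at_time_continuous|].
    apply continuousC_mult; [apply (continuousC_fst RtoC); apply continuousC_RtoC|].
    apply (continuousC_snd w); apply Cw. }
  assert (Cgy : continuousC (fun P : R * R => gy (fst P) (snd P)) (x, y)).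
  { unfold gy; apply continuousC_plus; [apply (continuousC_snd (speed p)); apply speed_continuous|].
    apply continuousC_mult; [apply (continuousC_fst RtoC); apply continuousC_RtoC|].
    apply (continuousC_snd w'); apply Cw'. }
  unfold K; apply continuousC_plus; apply continuousC_mult.
  - apply (continuousC_snd w'); apply Cw'.
  - apply (continuousC_comp phi (fun P : R * R => g (fst P) (snd P))); auto.
    eapply derivative_C_continuous; apply H1.
  - exact Cgy.
  - apply continuousC_mult; [|apply (continuousC_snd w); apply Cw].
    now apply (continuousC_comp phi' (fun P : R * R => g (fst P) (snd P))). }
assert (C1 : forall x y, 0 <= x <= 1 -> lo p <= y <= hi p -> continuousC (fun u => K u y) x).
{ intros x y Hx Hy; destruct (CK x y Hx Hy) as [H1 H2]; split.
  - apply (continuous_2d_left (fun u v => Re (K u v)) x y). now apply continuity_2d_pt_filterlim.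
  - apply (continuous_2d_left (fun u v => Im (K u v)) x y). now apply continuity_2d_pt_filterlim. }
assert (C2 : forall x y, 0 <= x <= 1 -> lo p <= y <= hi p -> continuousC (fun v => K x v) y).
{ intros x y Hx Hy; destruct (CK x y Hx Hy) as [H1 H2]; split.
  - apply (continuous_2d_right (fun u v => Re (K u v)) x y). now apply continuity_2d_pt_filterlim.
  - apply (continuous_2d_right (fun u v => Im (K u v)) x y). now apply continuity_2d_pt_filterlim. }
assert (g1 : forall y, g 1 y = at_time q y) by (intros; unfold g; ring).
assert (g0 : forall y, g 0 y = at_time p y) by (intros; unfold g; ring).
assert (Hlh := lo_le_hi p).
assert (I1 : forall y, lo p <= y <= hi p ->
  CInt (fun x => K x y) 0 1 = (speed q y * phi (at_time q y) - speed p y * phi (at_time p y))%C).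
{ intros y Hy. rewrite (CInt_derivative (fun x => gy x y * phi (g x y))%C).
  - rewrite g1 g0; unfold gy, w'; ring.
  - lra.
  - intros x Hx; destruct (Hphi x y Hx Hy) as [H1 _].
    exact (derivative_R_mult (fun u => gy u y) (fun u => phi (g u y)) x _ _ (Dgyx x y)
      (derivative_chain phi (fun u => g u y) x _ _ H1 (Dgx x y))).
  - intros x Hx; now apply C1. }
assert (I2 : forall x, 0 <= x <= 1 ->
  CInt (fun y => K x y) (lo p) (hi p) = (w (hi p) * phi (g x (hi p)) - w (lo p) * phi (g x (lo p)))%C).
{ intros x Hx. rewrite (CInt_derivative (fun y => w y * phi (g x y))%C); auto.
  intros y Hy; destruct (Hphi x y Hx Hy) as [H1 _].
  unfold K. replace (w' y * phi (g x y) + gy x y * (phi' (g x y) * w y))%C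
    with (w' y * phi (g x y) + w y * (phi' (g x y) * gy x y))%C by ring.
  exact (derivative_R_mult w (fun v => phi (g x v)) y _ _ (Dw y)
    (derivative_chain phi (fun v => g x v) y _ _ H1 (Dgy x y))). }
transitivity (CInt (fun y => CInt (fun x => K x y) 0 1) (lo p) (hi p)).
- unfold path_int; rewrite El Eh -CInt_minus.
  + apply CInt_ext; auto; intros y Hy; now rewrite I1.
  + rewrite -El -Eh; apply path_integrable; rewrite El Eh; intros y Hy.
    destruct (Hphi 1 y ltac:(lra) Hy) as [H1 _]; fold (g 1 y) in H1; rewrite g1 in H1.
    eapply derivative_C_continuous; apply H1.
  + apply path_integrable; intros y Hy.
    destruct (Hphi 0 y ltac:(lra) Hy) as [H1 _]; fold (g 0 y) in H1; rewrite g0 in H1.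
    eapply derivative_C_continuous; apply H1.
- rewrite -CInt_fubini; auto; try lra.
  unfold path_int; simpl; rewrite -CInt_minus.
  + apply CInt_ext; [lra|]; intros x Hx; now rewrite I2.
  + apply (path_integrable phi (segment (at_time p (hi p)) (at_time q (hi p)))); simpl; intros x Hx.
    destruct (Hphi x (hi p) Hx ltac:(lra)) as [H1 _]. eapply derivative_C_continuous; apply H1.
  + apply (path_integrable phi (segment (at_time p (lo p)) (at_time q (lo p)))); simpl; intros x Hx.
    destruct (Hphi x (lo p) Hx ltac:(lra)) as [H1 _]. eapply derivative_C_continuous; apply H1.
Qed.

Definition holomorphic_at (phi phi' : C -> C) (z : C) : Prop :=
  derivative_C phi z (phi' z) /\ continuous_atC phi' z.

(** The connecting segment is run through once in each direction. *)
Lemma homotopy_closed (phi phi' : C -> C) (p q : path) :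
  lo q = lo p -> hi q = hi p ->
  at_time p (lo p) = at_time p (hi p) -> at_time q (lo p) = at_time q (hi p) ->
  (forall x y, 0 <= x <= 1 -> lo p <= y <= hi p ->
     holomorphic_at phi phi' (at_time p y + RtoC x * (at_time q y - at_time p y))%C) ->
  path_int phi q = path_int phi p.
Proof.
intros El Eh Ep Eq Hphi.
pose proof (homotopy phi phi' p q El Eh Hphi) as E. rewrite Ep Eq in E.
transitivity (path_int phi q - path_int phi p + path_int phi p)%C; [ring|]. rewrite E; ring.
Qed.

(** Each connecting segment occurs in the homotopies of two consecutive sides, with
    opposite signs. *)
Lemma homotopy_quadrilateral (phi phi' : C -> C) (p1 p2 p3 p4 q1 q2 q3 q4 : path) :
  (forall p q, In (p, q) ((p1, q1) :: (p2, q2) :: (p3, q3) :: (p4, q4) :: nil) ->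
     lo p = 0 /\ hi p = 1 /\ lo q = 0 /\ hi q = 1 /\
     (forall x y, 0 <= x <= 1 -> 0 <= y <= 1 ->
       holomorphic_at phi phi' (at_time p y + RtoC x * (at_time q y - at_time p y))%C)) ->
  at_time p1 1 = at_time p2 0 -> at_time p2 1 = at_time p3 0 ->
  at_time p3 1 = at_time p4 0 -> at_time p4 1 = at_time p1 0 ->
  at_time q1 1 = at_time q2 0 -> at_time q2 1 = at_time q3 0 ->
  at_time q3 1 = at_time q4 0 -> at_time q4 1 = at_time q1 0 ->
  contour_int phi (q1 :: q2 :: q3 :: q4 :: nil) = contour_int phi (p1 :: p2 :: p3 :: p4 :: nil).
Proof.
intros Hall P1 P2 P3 P4 Q1 Q2 Q3 Q4.
assert (Hside : forall p q, In (p, q) ((p1, q1) :: (p2, q2) :: (p3, q3) :: (p4, q4) :: nil) ->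
  (path_int phi q = path_int phi p + (path_int phi (segment (at_time p 1) (at_time q 1))
   - path_int phi (segment (at_time p 0) (at_time q 0))))%C).
{ intros p q Hin; destruct (Hall p q Hin) as [L1 [L2 [L3 [L4 Hphi]]]].
  pose proof (homotopy phi phi' p q) as E. rewrite L1 L2 L3 L4 in E.
  specialize (E eq_refl eq_refl Hphi). rewrite -E; ring. }
simpl.
rewrite (Hside p1 q1); [|simpl; auto]. rewrite (Hside p2 q2); [|simpl; auto].
rewrite (Hside p3 q3); [|simpl; auto]. rewrite (Hside p4 q4); [|simpl; auto].
rewrite P1 P2 P3 P4 Q1 Q2 Q3 Q4. ring.
Qed.

Lemma path_int_at_rest (phi : C -> C) (p : path) :
  (forall t, speed p t = 0) -> path_int phi p = 0.
Proof.
intros Hs; unfold path_int, CInt; rewrite /Re /Im.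
assert (E : forall t, (speed p t * phi (at_time p t))%C = 0) by (intros; rewrite Hs; ring).
unfold RtoC; f_equal; rewrite (RInt_ext (V := R_CompleteNormedModule) _ (fun _ => 0));
  try (intros; now rewrite E); rewrite RInt_const; apply Rmult_0_r.
Qed.

(** ** Winding numbers *)

Lemma inv_shift_holomorphic (w z : C) : z <> w ->
  holomorphic_at (fun u => / (u - w))%C (fun u => - / ((u - w) * (u - w)))%C z.
Proof.
intros Hzw; split; [now apply derivative_C_inv_shift|].
assert (Hi := continuous_atC_inv_shift w z ltac:(auto)).
assert (Hm := continuous_atC_mult _ _ z (continuous_atC_const (- (1))%C z) (continuous_atC_mult _ _ z Hi Hi)).
assert (Hz : (z - w)%C <> 0).
{ intros E; apply Hzw. replace z with (z - w + w)%C by ring. rewrite E; ring. }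
assert (Hpos : 0 < Cmod (z - w)%C) by now apply Cmod_gt_0.
intros eps He; destruct (Hm eps He) as [del [Hd L]].
exists (Rmin del (Cmod (z - w)%C)); split; [now apply Rmin_pos|].
intros u Hu. specialize (L u (Rlt_le_trans _ _ _ Hu (Rmin_l _ _))).
assert (Hu2 := Rlt_le_trans _ _ _ Hu (Rmin_r _ _)).
assert (Huw : (u - w)%C <> 0).
{ intros E. replace (u - z)%C with (u - w - (z - w))%C in Hu2 by ring. rewrite E in Hu2.
  replace (0 - (z - w))%C with (- (z - w))%C in Hu2 by ring. rewrite Cmod_opp in Hu2; lra. }
replace (- / ((u - w) * (u - w)) - - / ((z - w) * (z - w)))%C
  with (- (1) * (/ (u - w) * / (u - w)) - - (1) * (/ (z - w) * / (z - w)))%C by (field; auto).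
auto.
Qed.

Lemma arc_int_center (w : C) (r th om a b : R) (Hab : a <= b) : r <> 0 ->
  path_int (fun u => / (u - w))%C (arc w r th om a b Hab) = (RtoC (om * (b - a)) * Ci)%C.
Proof.
intros Hr; unfold path_int; simpl.
rewrite (CInt_ext _ (fun _ => RtoC om * Ci)%C); auto.
- unfold CInt, Re, Im; simpl. rewrite !RInt_const.
  unfold scal; simpl; unfold mult; simpl. unfold Cmult, Ci, RtoC; simpl; f_equal; ring.
- intros t _.
  replace (w + polar r (th + om * t) - w)%C
    with (polar r (th + om * t)) by ring. unfold polar.
  set (c := cos (th + om * t)); set (s := sin (th + om * t)).
  assert (E : s * s + c * c = 1) by (pose proof (sin2_cos2 (th + om * t)) as E; unfold Rsqr in E; exact E).
  assert (Hne : ((r * c, r * s) : C) <> 0).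
  { intros Z; injection Z; intros Z2 Z1. apply Hr.
    assert (r * (s * s + c * c) = 0) by (replace (r * (s * s + c * c)) with ((r * s) * s + (r * c) * c) by ring; rewrite Z1 Z2; ring).
    rewrite E in H; lra. }
  replace ((- (r * om) * s, r * om * c) : C) with (RtoC om * Ci * ((r * c)%R, (r * s)%R))%C
    by (unfold Cmult, Ci, RtoC; simpl; f_equal; ring).
  rewrite -Cmult_assoc Cinv_r; auto. ring.
Qed.

Lemma circle_closed (c : C) (r : R) : at_time (circle c r) 0 = at_time (circle c r) (2 * PI).
Proof.
simpl; unfold polar. rewrite !Rplus_0_l !Rmult_1_l cos_2PI sin_2PI cos_0 sin_0. reflexivity.
Qed.

Lemma winding_circle_inside (c w : C) (r : R) : Cmod (w - c)%C < r ->
  path_int (fun u => / (u - w))%C (circle c r) = (RtoC (2 * PI) * Ci)%C.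
Proof.
intros Hw. pose proof (Cmod_ge_0 (w - c)%C).
transitivity (path_int (fun u => / (u - w))%C (circle w r)).
- symmetry; apply homotopy_closed with (fun u => - / ((u - w) * (u - w)))%C; auto.
  + apply circle_closed.
  + apply circle_closed.
  + intros x y Hx Hy; apply inv_shift_holomorphic; simpl.
    set (e := polar r (0 + 1 * y)).
    intros E.
    assert (Ee : e = (RtoC (1 - x) * (w - c))%C).
    { replace e with (c + e + RtoC x * (w + e - (c + e)) - (c + RtoC x * (w - c)))%C by ring.
      rewrite E RtoC_minus; ring. }
    assert (Em : Cmod e = r) by (unfold e; rewrite Cmod_polar; apply Rabs_pos_eq; lra).
    rewrite Ee Cmod_mult Cmod_R Rabs_pos_eq in Em; nra.
- unfold circle; rewrite arc_int_center; [|lra]. f_equal; f_equal; ring.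
Qed.

Lemma winding_circle_outside (c w : C) (r : R) : 0 <= r -> r < Cmod (w - c)%C ->
  path_int (fun u => / (u - w))%C (circle c r) = 0.
Proof.
intros Hr Hw.
transitivity (path_int (fun u => / (u - w))%C (circle c 0)).
- symmetry; apply homotopy_closed with (fun u => - / ((u - w) * (u - w)))%C; auto.
  + apply circle_closed.
  + apply circle_closed.
  + intros x y Hx Hy; apply inv_shift_holomorphic; simpl.
    set (e := polar r (0 + 1 * y)).
    intros E.
    assert (Ee : (w - c)%C = (RtoC (1 - x) * e)%C).
    { rewrite -E RtoC_minus; apply injective_projections; unfold e, polar; simpl; ring. }
    assert (Em : Cmod e = r) by (unfold e; rewrite Cmod_polar; apply Rabs_pos_eq; lra).
    rewrite Ee Cmod_mult Cmod_R Rabs_pos_eq in Hw; nra.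
- apply path_int_at_rest; intros t; simpl. unfold RtoC; f_equal; ring.
Qed.

Lemma same_side (a b x : R) : 0 <= x <= 1 -> a * b > 0 -> a + x * (b - a) <> 0.
Proof.
intros Hx Hab E.
assert (Haa : 0 < a * a) by (destruct (Req_dec a 0) as [->|]; nra).
assert (E2 : (1 - x) * (a * a) + x * (a * b) = 0).
{ replace (_ + _) with (a * (a + x * (b - a))) by ring. rewrite E; ring. }
assert (0 <= (1 - x) * (a * a)) by (apply Rmult_le_pos; lra).
assert (0 <= x * (a * b)) by (apply Rmult_le_pos; lra).
destruct (Req_dec x 0) as [->|]; nra.
Qed.

(** Each side lies, together with the arc it is deformed to, in a half plane that
    does not contain [w]. *)
Lemma winding_rectangle_inside (x1 x2 y1 y2 : R) (w : C) :
  x1 < Re w < x2 -> y1 < Im w < y2 ->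
  contour_int (fun u => / (u - w))%C (rectangle x1 x2 y1 y2) = (RtoC (2 * PI) * Ci)%C.
Proof.
intros Hx Hy.
set (a := fun th => arc w 1 th (PI / 2) 0 1 Rle_0_1).
assert (HPI := PI_RGT_0).
rewrite -(homotopy_quadrilateral _ (fun u => - / ((u - w) * (u - w)))%C _ _ _ _
   (a (- 3 * (PI / 4))) (a (- (PI / 4))) (a (PI / 4)) (a (3 * (PI / 4)))).
- simpl; unfold a; rewrite !arc_int_center; try lra.
  unfold Cmult, Cplus, Ci, RtoC; simpl; f_equal; field.
- assert (Hside : forall p q : path,
    (forall t, 0 <= t <= 1 ->
       (Re (at_time p t) - Re w) * (Re (at_time q t) - Re w) > 0 \/
       (Im (at_time p t) - Im w) * (Im (at_time q t) - Im w) > 0) ->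
    forall x y, 0 <= x <= 1 -> 0 <= y <= 1 ->
    holomorphic_at (fun u => / (u - w))%C (fun u => - / ((u - w) * (u - w)))%C
      (at_time p y + RtoC x * (at_time q y - at_time p y))%C).
  { intros p q Hpq x y Hx' Hy'; apply inv_shift_holomorphic; intros E.
    assert (ER : Re (at_time p y) + x * (Re (at_time q y) - Re (at_time p y)) = Re w).
    { rewrite -E; unfold Re, Im; simpl; ring. }
    assert (EI : Im (at_time p y) + x * (Im (at_time q y) - Im (at_time p y)) = Im w).
    { rewrite -E; unfold Re, Im; simpl; ring. }
    destruct (Hpq y Hy') as [Hs|Hs].
    - apply (same_side (Re (at_time p y) - Re w) (Re (at_time q y) - Re w) x Hx' Hs); lra.
    - apply (same_side (Im (at_time p y) - Im w) (Im (at_time q y) - Im w) x Hx' Hs); lra. }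
  intros p q Hin.
  destruct Hin as [E|[E|[E|[E|[]]]]]; apply pair_equal_spec in E; destruct E as [<- <-];
    (do 4 (split; [reflexivity|]); apply Hside; intros t Ht; simpl; unfold polar, Re, Im; simpl;
     rewrite ?Rmult_1_l).
  + right. assert (sin (- 3 * (PI / 4) + PI / 2 * t) < 0) by (apply sin_lt_0_var; nra).
    unfold Re, Im in *; nra.
  + left. assert (0 < cos (- (PI / 4) + PI / 2 * t)) by (apply cos_gt_0; nra).
    unfold Re, Im in *; nra.
  + right. assert (0 < sin (PI / 4 + PI / 2 * t)) by (apply sin_gt_0; nra).
    unfold Re, Im in *; nra.
  + left. assert (cos (3 * (PI / 4) + PI / 2 * t) < 0) by (apply cos_lt_0; nra).
    unfold Re, Im in *; nra.
- simpl; apply injective_projections; simpl; ring.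
- simpl; apply injective_projections; simpl; ring.
- simpl; apply injective_projections; simpl; ring.
- simpl; apply injective_projections; simpl; ring.
- simpl; f_equal; f_equal; field.
- simpl; f_equal; f_equal; field.
- simpl; f_equal; f_equal; field.
- simpl; f_equal; unfold polar.
  set (th := - 3 * (PI / 4) + PI / 2 * 0).
  replace (3 * (PI / 4) + PI / 2 * 1) with (th + 2 * PI) by (unfold th; field).
  rewrite cos_plus sin_plus cos_2PI sin_2PI; f_equal; ring.
Qed.

(** A point outside the rectangle is separated from it by one of its sides, so the
    rectangle can be shrunk to a corner without meeting it. *)
Lemma winding_rectangle_outside (x1 x2 y1 y2 : R) (w : C) :
  x1 <= x2 -> y1 <= y2 ->
  Re w < x1 \/ x2 < Re w \/ Im w < y1 \/ y2 < Im w ->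
  contour_int (fun u => / (u - w))%C (rectangle x1 x2 y1 y2) = 0.
Proof.
intros Hx Hy Hw.
set (o := segment (x1, y1) (x1, y1)).
assert (Hrest : contour_int (fun u => / (u - w))%C (o :: o :: o :: o :: nil) = 0).
{ simpl; rewrite path_int_at_rest; [ring|]. intros t; simpl; ring. }
rewrite -Hrest; symmetry.
apply homotopy_quadrilateral with (fun u => - / ((u - w) * (u - w)))%C;
  try (simpl; apply injective_projections; simpl; ring).
assert (Hmix : forall x y d : R, 0 <= x <= 1 -> 0 <= y <= 1 -> 0 <= d ->
  0 <= y * d <= d /\ 0 <= x * d <= d /\ 0 <= x * (y * d) <= y * d /\ x * (y * d) <= x * d /\
  x * d + y * d - x * (y * d) <= d).
{ intros x y d Hx' Hy' Hd. assert (0 <= y * d) by nra. assert (0 <= (1 - y) * d) by nra.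
  assert (0 <= x * ((1 - y) * d)) by nra. assert (0 <= (1 - x) * ((1 - y) * d)) by nra.
  repeat split; nra. }
intros p q Hin.
destruct Hin as [E|[E|[E|[E|[]]]]]; apply pair_equal_spec in E; destruct E as [<- <-];
  (do 4 (split; [reflexivity|]); intros x y Hx' Hy'; apply inv_shift_holomorphic; intros E;
   assert (Mx := Hmix x y (x2 - x1) Hx' Hy' ltac:(lra)); assert (My := Hmix x y (y2 - y1) Hx' Hy' ltac:(lra));
   assert (ER := f_equal Re E); assert (EI := f_equal Im E);
   unfold Re, Im in ER, EI, Hw; simpl in ER, EI; destruct Hw as [?|[?|[?|?]]]; nra).
Qed.

(** * Vector-valued contour integrals *)

Lemma Riemann_sum_linear (V : NormedModule R_AbsRing) (L : V -> R) (f : R -> V) (p : SF_seq.SF_seq) :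
  is_linear (V := R_NormedModule) L ->
  L (SF_seq.Riemann_sum f p) = SF_seq.Riemann_sum (fun t => L (f t)) p.
Proof.
intros HL; unfold SF_seq.Riemann_sum.
set (x0 := (SF_seq.SF_h p, _)). clearbody x0. revert x0.
induction (SF_seq.SF_t p) as [|y l IH]; intros x0; simpl.
- pose proof (linear_scal L HL 0 zero) as E. rewrite scal_zero_l in E. rewrite E.
  exact (Rmult_0_l _).
- rewrite (linear_plus L HL) (linear_scal L HL) IH; reflexivity.
Qed.

Lemma RInt_linear (V : CompleteNormedModule R_AbsRing) (L : V -> R) (f : R -> V) (a b : R) :
  is_linear (V := R_NormedModule) L -> ex_RInt f a b ->
  RInt (fun t => L (f t)) a b = L (RInt f a b).
Proof.
intros HL Hf; apply (is_RInt_unique (V := R_CompleteNormedModule)).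
pose proof (RInt_correct f a b Hf) as HI. unfold is_RInt in *.
apply filterlim_ext with (fun p => L (scal (sign (b - a)) (SF_seq.Riemann_sum f p))).
- intros p; rewrite (linear_scal L HL) (Riemann_sum_linear V L f p HL); auto.
- apply filterlim_comp with (1 := HI). exact (linear_cont L (RInt f a b) HL).
Qed.

Section VectorIntegral.

Variable H : HilbertSpace.

Lemma Re_inner_linear (y : H) :
  is_linear (U := restrict_scalars H) (V := R_NormedModule) (fun x => Re (inner (x : H) y)).
Proof.
split.
- intros x x'. change (Re (inner (plus (x : H) x') y) = Re (inner (x : H) y) + Re (inner (x' : H) y)).
  now rewrite inner_plus_l.
- intros k x. change (Re (inner (scal (RtoC k : C_AbsRing) (x : H)) y) = k * Re (inner (x : H) y)).
  rewrite inner_scal_l; unfold Re; simpl; ring.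
- exists (norm y + 1); split; [pose proof (norm_ge_0 y); lra|]; intros x.
  change (Rabs (Re (inner (x : H) y)) <= (norm y + 1) * norm (x : H)).
  apply Rle_trans with (1 := re_le_Cmod _), Rle_trans with (1 := cauchy_schwarz H x y).
  pose proof (norm_ge_0 (x : H)); pose proof (norm_ge_0 y); nra.
Qed.

Definition continuous_atH (F : C -> H) (z : C) : Prop :=
  forall eps, 0 < eps -> exists del, 0 < del /\
    forall w, Cmod (w - z)%C < del -> norm (minus (F w) (F z) : H) < eps.

Lemma continuous_speed_scal (F : C -> H) (p : path) t :
  continuous_atH F (at_time p t) ->
  continuous (U := restrict_scalars H) (fun s => scal (speed p s : C_AbsRing) (F (at_time p s))) t.
Proof.
intros HF.
apply (filterlim_locally_ball_norm (U := restrict_scalars H) (F := locally t)); intros eps.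
set (v0 := F (at_time p t)). set (c0 := speed p t).
pose proof (norm_ge_0 v0) as Hv0; pose proof (Cmod_ge_0 c0) as Hc0.
set (e1 := Rmin 1 (eps / (2 * (Cmod c0 + 1)))).
set (e2 := eps / (2 * (norm v0 + 1))).
pose proof (cond_pos eps) as He.
assert (He1 : 0 < e1) by (apply Rmin_pos; [lra|apply Rdiv_lt_0_compat; lra]).
assert (He2 : 0 < e2) by (apply Rdiv_lt_0_compat; lra).
destruct (HF e1 He1) as [del [Hd L1]].
pose proof (proj1 (continuousC_eps _ _) (at_time_continuous p t) del Hd) as N1.
pose proof (proj1 (continuousC_eps _ _) (speed_continuous p t) _ (Rmin_pos 1 e2 Rlt_0_1 He2)) as N2.
generalize (filter_and _ _ N1 N2); apply filter_imp; intros s [S1 S2].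
specialize (L1 _ S1). fold v0 in L1.
set (v := F (at_time p s)) in *. set (c := speed p s) in *.
change (norm (minus (scal (c : C_AbsRing) v) (scal (c0 : C_AbsRing) v0) : H) < eps).
set (a1 := scal (c : C_AbsRing) (minus v v0) : H). set (a2 := scal (c - c0 : C_AbsRing)%C v0 : H).
assert (E : minus (scal (c : C_AbsRing) v) (scal (c0 : C_AbsRing) v0) = plus a1 a2 :> H).
{ apply inner_ext; intros w; unfold a1, a2.
  rewrite inner_minus_l inner_plus_l !inner_scal_l inner_minus_l; ring. }
rewrite E. apply Rle_lt_trans with (1 := norm_triangle a1 a2).
change (norm a1 + norm a2 < eps). unfold a1, a2.
rewrite !(norm_scal_eq H).
pose proof (Rmin_l 1 e2); pose proof (Rmin_r 1 e2).
fold c0 in S2.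
assert (Hc : Cmod c <= Cmod c0 + 1).
{ pose proof (Cmod_triangle c0 (c - c0)%C) as Ht.
  replace (c0 + (c - c0))%C with c in Ht by ring. lra. }
assert (A1 : Cmod c * norm (minus v v0 : H) <= (Cmod c0 + 1) * (eps / (2 * (Cmod c0 + 1)))).
{ apply Rmult_le_compat; auto; [apply Cmod_ge_0|apply norm_ge_0|].
  apply Rlt_le, Rlt_le_trans with (1 := L1), Rmin_r. }
assert (A2 : Cmod (c - c0)%C * norm v0 < (norm v0 + 1) * e2).
{ pose proof (Cmod_ge_0 (c - c0)%C).
  apply Rle_lt_trans with (norm v0 * e2); [nra|]. nra. }
replace ((Cmod c0 + 1) * (eps / (2 * (Cmod c0 + 1)))) with (eps / 2) in A1 by (field; lra).
replace ((norm v0 + 1) * e2) with (eps / 2) in A2 by (unfold e2; field; lra).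
lra.
Qed.

Lemma path_derive_speed (p : path) t : path_derive (at_time p) t = speed p t.
Proof.
destruct (speed_derivative p t) as [D1 D2]; unfold path_derive.
rewrite (is_derive_unique _ _ _ D1) (is_derive_unique _ _ _ D2).
symmetry; apply surjective_pairing.
Qed.

Lemma inner_path_integral (F : C -> H) (p : path) (y : H) :
  (forall t, lo p <= t <= hi p -> continuous_atH F (at_time p t)) ->
  inner (path_integral H (at_time p) (lo p) (hi p) F) y = path_int (fun z => inner (F z) y) p.
Proof.
intros HF.
set (f := fun s => scal (speed p s : C_AbsRing) (F (at_time p s)) : restrict_scalars H).
assert (Hlh := lo_le_hi p).
assert (Hex : ex_RInt f (lo p) (hi p)).
{ apply (ex_RInt_continuous (V := restrict_scalars H)); intros t Ht.
  rewrite Rmin_left in Ht; auto; rewrite Rmax_right in Ht; auto.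
  now apply continuous_speed_scal, HF. }
assert (E : path_integral H (at_time p) (lo p) (hi p) F = RInt f (lo p) (hi p)).
{ unfold path_integral; apply (RInt_ext (V := restrict_scalars H)); intros t _.
  now rewrite path_derive_speed. }
rewrite E; unfold path_int, CInt.
assert (EI : forall x : H, Im (inner x y) = Re (inner x (scal (Ci : C_AbsRing) y))).
{ intros x; rewrite inner_scal_r; unfold Re, Im; simpl; ring. }
assert (L1 := RInt_linear (restrict_scalars H) _ f _ _ (Re_inner_linear y) Hex).
assert (L2 := RInt_linear (restrict_scalars H) _ f _ _ (Re_inner_linear (scal (Ci : C_AbsRing) y)) Hex).
transitivity ((Re (inner (RInt f (lo p) (hi p) : H) y), Im (inner (RInt f (lo p) (hi p) : H) y)) : C).
{ apply surjective_pairing. }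
apply injective_projections; cbn [fst snd].
- rewrite -L1; apply (RInt_ext (V := R_CompleteNormedModule)); intros t _.
  unfold f; rewrite inner_scal_l; auto.
- rewrite EI -L2; apply (RInt_ext (V := R_CompleteNormedModule)); intros t _.
  rewrite -EI; unfold f; rewrite inner_scal_l; auto.
Qed.

Lemma inner_circle_integral (F : C -> H) (c : C) (r : R) (y : H) :
  (forall z, on_contour (circle c r :: nil) z -> continuous_atH F z) ->
  inner (circle_integral c r F) y = contour_int (fun z => inner (F z) y) (circle c r :: nil).
Proof.
intros HF; simpl. rewrite Cplus_0_r.
rewrite -(inner_path_integral F (circle c r)).
- unfold circle_integral; f_equal; f_equal; simpl.
  apply functional_extensionality; intros t; unfold polar.
  now rewrite Rplus_0_l Rmult_1_l.
- intros t Ht; apply HF; now apply on_contour_head.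
Qed.

Lemma inner_rectangle_integral (F : C -> H) (x1 x2 y1 y2 : R) (y : H) :
  (forall z, on_contour (rectangle x1 x2 y1 y2) z -> continuous_atH F z) ->
  inner (rectangle_integral x1 x2 y1 y2 F) y
  = contour_int (fun z => inner (F z) y) (rectangle x1 x2 y1 y2).
Proof.
intros HF.
assert (Hseg : forall p q, In (segment p q) (rectangle x1 x2 y1 y2) ->
  inner (segment_integral H p q F) y = path_int (fun z => inner (F z) y) (segment p q)).
{ intros p q Hin; rewrite -(inner_path_integral F (segment p q)); auto.
  intros t Ht; apply HF; now exists (segment p q), t. }
unfold rectangle_integral; rewrite !inner_plus_l !Hseg; try (simpl; tauto).
simpl; ring.
Qed.

End VectorIntegral.

(** * Riesz projections of a pseudo-resolvent *)

Section Riesz.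

Variable H : HilbertSpace.
Variable e : nat -> H.
Hypothesis e_orthonormal : forall j k, inner (e j) (e k) = if Nat.eq_dec j k then RtoC 1 else RtoC 0.
Hypothesis e_expansion : forall f, is_series (fun k => scal (inner f (e k)) (e k)) f.

Variables (Res : C -> H -> H) (G : C -> Prop) (B : R).
Hypothesis G_open : forall z, G z -> exists del, 0 < del /\ forall w, Cmod (w - z)%C < del -> G w.
Hypothesis Res_linear : forall z, G z -> is_linear (Res z).
Hypothesis Res_bound : forall z f, G z -> norm (Res z f) <= B * norm f.
Hypothesis Res_identity : forall z w f, G z -> G w ->
  minus (Res z f) (Res w f) = scal (w - z : C_AbsRing)%C (Res z (Res w f)).

Lemma resolvent_bound_nonneg z (f : H) : G z -> 0 <= B * norm f.
Proof. intros Hz; apply Rle_trans with (2 := Res_bound z f Hz), norm_ge_0. Qed.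

Lemma resolvent_lipschitz z w f : G z -> G w ->
  norm (minus (Res z f) (Res w f) : H) <= Cmod (z - w)%C * (B * (B * norm f)).
Proof.
intros Hz Hw; rewrite Res_identity; auto.
rewrite (norm_scal_eq H). replace (w - z)%C with (- (z - w))%C by ring. rewrite Cmod_opp.
apply Rmult_le_compat_l; [apply Cmod_ge_0|].
apply Rle_trans with (1 := Res_bound z _ Hz).
destruct (Rle_dec 0 B).
- apply Rmult_le_compat_l; auto.
- pose proof (resolvent_bound_nonneg z f Hz); pose proof (norm_ge_0 f).
  pose proof (resolvent_bound_nonneg z (Res w f) Hz); pose proof (norm_ge_0 (Res w f)).
  assert (norm f = 0) by nra. assert (norm (Res w f) = 0) by nra. rewrite H4 H5; lra.
Qed.

Lemma continuous_atH_resolvent z f : G z -> continuous_atH H (fun w => Res w f) z.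
Proof.
intros Hz eps He. destruct (G_open z Hz) as [d [Hd HG]].
set (K := Rabs (B * (B * norm f)) + 1).
assert (HK : 0 < K) by (pose proof (Rabs_pos (B * (B * norm f))); unfold K; lra).
exists (Rmin d (eps / K)); split; [apply Rmin_pos; auto; now apply Rdiv_lt_0_compat|].
intros w Hw.
assert (W1 := Rlt_le_trans _ _ _ Hw (Rmin_l _ _)); assert (W2 := Rlt_le_trans _ _ _ Hw (Rmin_r _ _)).
apply Rle_lt_trans with (1 := resolvent_lipschitz w z f (HG w W1) Hz).
pose proof (Cmod_ge_0 (w - z)%C).
apply Rle_lt_trans with (Cmod (w - z)%C * K).
- apply Rmult_le_compat_l; auto. pose proof (Rle_abs (B * (B * norm f))); unfold K; lra.
- apply Rmult_lt_reg_r with (/ K); [now apply Rinv_0_lt_compat|].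
  rewrite Rmult_assoc Rinv_r; [|lra]. unfold Rdiv in W2; lra.
Qed.

Lemma continuous_atC_inner (F : C -> H) (y : H) z :
  continuous_atH H F z -> continuous_atC (fun w => inner (F w) y) z.
Proof.
intros HF eps He. pose proof (norm_ge_0 y).
destruct (HF (eps / (norm y + 1))) as [del [Hd L]]; [apply Rdiv_lt_0_compat; lra|].
exists del; split; auto; intros w Hw; specialize (L w Hw).
rewrite -inner_minus_l. apply Rle_lt_trans with (1 := cauchy_schwarz H _ _).
set (q := norm (minus (F w) (F z) : H)) in *. assert (0 <= q) by apply norm_ge_0.
apply Rle_lt_trans with (q * (norm y + 1)); [nra|].
apply Rmult_lt_reg_r with (/ (norm y + 1)); [apply Rinv_0_lt_compat; lra|].
rewrite Rmult_assoc Rinv_r; [|lra]. unfold Rdiv in L; lra.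
Qed.

Lemma resolvent_square_continuous z f : G z -> continuous_atH H (fun w => Res w (Res w f)) z.
Proof.
intros Hz eps He.
destruct (continuous_atH_resolvent z (Res z f) Hz (eps / 2) ltac:(lra)) as [d1 [D1 L1]].
destruct (continuous_atH_resolvent z f Hz (eps / 2 / (Rabs B + 1))) as [d2 [D2 L2]].
{ pose proof (Rabs_pos B); apply Rdiv_lt_0_compat; lra. }
destruct (G_open z Hz) as [d [Hd HG]].
exists (Rmin d (Rmin d1 d2)); split; [repeat apply Rmin_pos; auto|].
intros w Hw.
assert (W0 := Rlt_le_trans _ _ _ Hw (Rmin_l _ _)); assert (W := Rlt_le_trans _ _ _ Hw (Rmin_r _ _)).
assert (W1 := Rlt_le_trans _ _ _ W (Rmin_l _ _)); assert (W2 := Rlt_le_trans _ _ _ W (Rmin_r _ _)).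
specialize (L1 w W1); specialize (L2 w W2); specialize (HG w W0).
set (a1 := Res w (minus (Res w f) (Res z f)) : H). set (a2 := minus (Res w (Res z f)) (Res z (Res z f)) : H).
assert (E : minus (Res w (Res w f)) (Res z (Res z f)) = plus a1 a2 :> H).
{ apply inner_ext; intros y; unfold a1, a2.
  rewrite (linear_minus H (Res w)); auto. rewrite inner_minus_l inner_plus_l !inner_minus_l; ring. }
rewrite E. apply Rle_lt_trans with (1 := norm_triangle a1 a2). change (norm a1 + norm a2 < eps).
change (norm a2 < eps / 2) in L1.
assert (norm a1 <= eps / 2).
{ apply Rle_trans with (1 := Res_bound w _ HG).
  set (q := norm (minus (Res w f) (Res z f) : H)) in *. change (B * q <= eps / 2).
  assert (0 <= q) by apply norm_ge_0. pose proof (Rle_abs B); pose proof (Rabs_pos B).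
  apply Rle_trans with ((Rabs B + 1) * (eps / 2 / (Rabs B + 1))).
  - apply Rle_trans with ((Rabs B + 1) * q); [nra|]. apply Rmult_le_compat_l; lra.
  - right; field; lra. }
lra.
Qed.

Lemma resolvent_holomorphic z f y : G z ->
  holomorphic_at (fun w => inner (Res w f) y) (fun w => - inner (Res w (Res w f)) y)%C z.
Proof.
intros Hz; split.
- intros eps He.
  destruct (G_open z Hz) as [d [Hd HG]].
  destruct (continuous_atC_inner _ y z (continuous_atH_resolvent z (Res z f) Hz) eps He) as [d1 [D1 L1]].
  exists (Rmin d d1); split; [now apply Rmin_pos|]; intros w Hw.
  assert (W0 := Rlt_le_trans _ _ _ Hw (Rmin_l _ _)); assert (W1 := Rlt_le_trans _ _ _ Hw (Rmin_r _ _)).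
  specialize (L1 w W1); specialize (HG w W0).
  rewrite -inner_minus_l Res_identity; auto. rewrite inner_scal_l.
  replace ((z - w) * inner (Res w (Res z f)) y - - inner (Res z (Res z f)) y * (w - z))%C
    with (- ((inner (Res w (Res z f)) y - inner (Res z (Res z f)) y) * (w - z)))%C by ring.
  rewrite Cmod_opp Cmod_mult. apply Rmult_le_compat_r; [apply Cmod_ge_0|lra].
- intros eps He.
  destruct (continuous_atC_inner _ y z (resolvent_square_continuous z f Hz) eps He) as [d1 [D1 L1]].
  exists d1; split; auto; intros w Hw; specialize (L1 w Hw).
  replace (- inner (Res w (Res w f)) y - - inner (Res z (Res z f)) y)%C
    with (- (inner (Res w (Res w f)) y - inner (Res z (Res z f)) y))%C by ring.
  now rewrite Cmod_opp.
Qed.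

Lemma resolvent_continuous z f y : G z -> continuous_atC (fun w => inner (Res w f) y) z.
Proof. intros Hz; apply (derivative_C_continuous _ _ _ (proj1 (resolvent_holomorphic z f y Hz))). Qed.

Definition two_pi_i : C := Cmult (RtoC (2 * PI)) Ci.

Lemma two_pi_i_neq_0 : two_pi_i <> 0.
Proof.
unfold two_pi_i; apply Cmult_neq_0.
- intros E; injection E; pose proof PI_RGT_0; lra.
- intros E; injection E; lra.
Qed.

(** Stated weakly, so that one operator can be represented over several contours and
    scalar integrals suffice. *)
Definition riesz_integral (g : list path) (P : H -> H) : Prop :=
  forall f y, inner (P f) y = (/ two_pi_i * contour_int (fun z => inner (Res z f) y) g)%C.

Lemma riesz_integral_linear (g : list path) (P : H -> H) :
  (forall z, on_contour g z -> G z) -> riesz_integral g P -> is_linear P.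
Proof.
intros Hg HP; split.
- intros x x'; apply inner_ext; intros y.
  rewrite inner_plus_l !HP -Cmult_plus_distr_l -contour_int_plus.
  + f_equal; apply contour_int_ext; intros z Hz.
    rewrite (linear_plus _ (Res_linear z (Hg z Hz))); apply inner_plus_l.
  + intros z Hz; now apply resolvent_continuous, Hg.
  + intros z Hz; now apply resolvent_continuous, Hg.
- intros c x; apply inner_ext; intros y. rewrite inner_scal_l !HP.
  rewrite Cmult_assoc (Cmult_comm c) -Cmult_assoc -(contour_int_mult_l c).
  + f_equal; apply contour_int_ext; intros z Hz.
    rewrite (linear_scal _ (Res_linear z (Hg z Hz))); apply inner_scal_l.
  + intros z Hz; now apply resolvent_continuous, Hg.
- set (M := Cmod (/ two_pi_i)%C * (contour_length g * Rabs B)).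
  assert (HM : 0 <= M).
  { repeat apply Rmult_le_pos; [apply Cmod_ge_0|apply contour_length_nonneg|apply Rabs_pos]. }
  exists (M + 1); split; [lra|]; intros f.
  pose proof (norm_ge_0 f) as Hf.
  apply Rle_trans with (M * norm f); [|nra].
  apply norm_le_of_inner; [nra|]; intros y.
  rewrite HP Cmod_mult; unfold M; rewrite !Rmult_assoc.
  apply Rmult_le_compat_l; [apply Cmod_ge_0|].
  apply contour_int_bound.
  + intros z Hz; now apply resolvent_continuous, Hg.
  + intros z Hz; apply Rle_trans with (1 := cauchy_schwarz H _ _).
    rewrite -Rmult_assoc; apply Rmult_le_compat_r; [apply norm_ge_0|].
    apply Rle_trans with (1 := Res_bound z f (Hg z Hz)).
    apply Rmult_le_compat_r; auto; apply Rle_abs.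
Qed.

(** Nested contours ([n = 1]) give idempotency, contours outside each other ([n = 0])
    give products that vanish. *)
Lemma riesz_integral_product (g d : list path) (P P' : H -> H) (n : C) (rho : R) :
  (forall z, on_contour g z -> G z) -> (forall z, on_contour d z -> G z) ->
  0 < rho -> (forall z w, on_contour g z -> on_contour d w -> rho <= Cmod (w - z)%C) ->
  (forall z, on_contour g z -> contour_int (fun w => / (w - z))%C d = (n * two_pi_i)%C) ->
  (forall w, on_contour d w -> contour_int (fun z => / (z - w))%C g = 0) ->
  riesz_integral g P -> riesz_integral d P' ->
  forall f, P (P' f) = scal (n : C_AbsRing) (P f).
Proof.
intros Hg Hd Hrho Hsep Wd Wg HP HP' f; apply inner_ext; intros y.
set (phi := fun z => inner (Res z f) y).
assert (Hin : forall z, on_contour g z ->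
  inner (Res z (P' f)) y = (/ two_pi_i * contour_int (fun w => (phi z - phi w) * / (w - z))%C d)%C).
{ intros z Hz.
  destruct (adjoint_exists H e e_orthonormal e_expansion _ (Res_linear z (Hg z Hz))) as [L [_ EL]].
  rewrite EL HP'. f_equal; apply contour_int_ext; intros w Hw.
  rewrite -EL; unfold phi. rewrite -inner_minus_l (Res_identity z w f (Hg z Hz) (Hd w Hw)) inner_scal_l.
  field. intros E; specialize (Hsep z w Hz Hw); rewrite E Cmod_0 in Hsep; lra. }
assert (Cg : continuous_on_contour phi g) by (intros z Hz; now apply resolvent_continuous, Hg).
assert (Cd : continuous_on_contour phi d) by (intros z Hz; now apply resolvent_continuous, Hd).
assert (Bd : forall w, on_contour d w -> Cmod (phi w) <= B * norm f * norm y).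
{ intros w Hw; apply Rle_trans with (1 := cauchy_schwarz H _ _).
  apply Rmult_le_compat_r; [apply norm_ge_0|]; auto. }
pose proof (double_contour_int phi _ rho Hrho g d (n * two_pi_i)%C Cg Cd Bd Hsep Wd Wg) as E.
set (psi := fun z => inner (Res z (P' f)) y).
assert (E2 : contour_int (fun z => contour_int (fun w => (phi z - phi w) * / (w - z)) d)%C g
  = (two_pi_i * contour_int psi g)%C).
{ rewrite -contour_int_mult_l.
  - apply contour_int_ext; intros z Hz; unfold psi; rewrite Hin; auto.
    field; apply two_pi_i_neq_0.
  - intros z Hz; now apply resolvent_continuous, Hg. }
rewrite inner_scal_l !HP. fold phi psi.
rewrite E in E2. pose proof two_pi_i_neq_0.
replace (contour_int psi g) with (/ two_pi_i * (two_pi_i * contour_int psi g))%C by (field; auto).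
rewrite -E2; field; auto.
Qed.

End Riesz.

(** * A convolution kernel *)

Section Kernel.

Variable a : R.
Hypothesis Ha : 0 < a <= 1 / 4.

Definition decay (x : R) : R := Rpower (1 + x) (- (1 + a)).

Definition weight (k : nat) : R := Rpower (INR k + 1) (- a).

Definition index_dist (n k : nat) : R := Rabs (INR n - INR k).

Lemma index_dist_nonneg n k : 0 <= index_dist n k.
Proof. apply Rabs_pos. Qed.

Lemma index_dist_sym n k : index_dist n k = index_dist k n.
Proof. apply Rabs_minus_sym. Qed.

Lemma weight_pos k : 0 < weight k.
Proof. apply exp_pos. Qed.

Lemma decay_pos x : 0 < decay x.
Proof. apply exp_pos. Qed.

Lemma Rpower_base_1 (c : R) : Rpower 1 c = 1.
Proof. unfold Rpower; rewrite ln_1 Rmult_0_r; apply exp_0. Qed.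

Lemma Rpower_neg_antitone (x y c : R) : 0 <= c -> 0 < x <= y -> Rpower y (- c) <= Rpower x (- c).
Proof.
intros Hc Hxy; unfold Rpower.
assert (Hl : ln x <= ln y).
{ destruct (Req_dec x y) as [->|]; [lra|apply Rlt_le, ln_increasing; lra]. }
assert (Hm : - c * ln y <= - c * ln x) by nra.
destruct Hm as [Hm|Hm]; [apply Rlt_le, exp_increasing; lra|rewrite Hm; lra].
Qed.

(** [x^(-1-a) <= ((x-1)^(-a) - x^(-a)) / a], from [1/x <= - ln (1 - 1/x)] and
    [1 + t <= exp t]. *)
Lemma Rpower_telescope (x : R) : 1 < x ->
  a * Rpower x (- (1 + a)) <= Rpower (x - 1) (- a) - Rpower x (- a).
Proof.
intros Hx.
assert (Hx0 : 0 < x) by lra.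
assert (E1 : Rpower x (- (1 + a)) = / x * Rpower x (- a)).
{ replace (- (1 + a)) with (- (1) + - a) by ring. rewrite Rpower_plus Rpower_Ropp Rpower_1; auto. }
assert (Hq : 0 < (x - 1) / x) by (apply Rdiv_lt_0_compat; lra).
assert (E2 : Rpower (x - 1) (- a) = Rpower x (- a) * exp (- a * ln ((x - 1) / x))).
{ unfold Rpower; rewrite -exp_plus; f_equal. rewrite ln_div; lra. }
assert (Hln : ln ((x - 1) / x) <= - / x).
{ pose proof (exp_ineq1_le (ln ((x - 1) / x))) as He. rewrite exp_ln in He; auto.
  replace ((x - 1) / x) with (1 - / x) in He at 2 by (field; lra). lra. }
assert (Hexp : 1 + a * / x <= exp (- a * ln ((x - 1) / x))).
{ apply Rle_trans with (1 + - a * ln ((x - 1) / x)); [nra|apply exp_ineq1_le]. }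
rewrite E1 E2. pose proof (exp_pos (- a * ln x)) as Hp. fold (Rpower x (- a)) in Hp. nra.
Qed.

Lemma decay_summable : ex_series (fun d => decay (INR d)).
Proof.
apply (nonneg_series _ (1 + / a)); [intros d; apply Rlt_le, decay_pos|].
assert (Hs : forall n, a * sum_n (fun d => decay (INR d)) n <= a + 1 - Rpower (1 + INR n) (- a)).
{ induction n as [|n IH].
  - rewrite sum_O; unfold decay; simpl; rewrite Rplus_0_r !Rpower_base_1. lra.
  - rewrite sum_Sn; change plus with Rplus.
    assert (Hn : 1 < 1 + INR (S n)) by (rewrite S_INR; pose proof (pos_INR n); lra).
    pose proof (Rpower_telescope _ Hn) as Ht.
    replace (1 + INR (S n) - 1) with (1 + INR n) in Ht by (rewrite S_INR; ring).
    unfold decay in *. lra. }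
intros n; specialize (Hs n). pose proof (exp_pos (- a * ln (1 + INR n))) as Hp.
fold (Rpower (1 + INR n) (- a)) in Hp.
apply Rmult_le_reg_l with a; [lra|]. rewrite Rmult_plus_distr_l Rinv_r; lra.
Qed.

Definition decay_total : R := Series (fun d => decay (INR d)).

Lemma decay_total_nonneg : 0 <= decay_total.
Proof. apply Series_nonneg; [intros; apply Rlt_le, decay_pos|apply decay_summable]. Qed.

Lemma sum_shift (r : nat -> R) n K :
  sum_n (fun k => if le_dec n k then r (k - n)%nat else 0) K
  = if le_dec n K then sum_n r (K - n) else 0.
Proof.
induction K as [|K IH]; rewrite ?sum_O ?sum_Sn.
- now destruct (le_dec n 0).
- rewrite IH; change plus with Rplus.
  destruct (le_dec n K), (le_dec n (S K)); try lia.
  + replace (S K - n)%nat with (S (K - n)) by lia. now rewrite sum_Sn.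
  + replace (S K - n)%nat with 0%nat by lia. rewrite sum_O; apply Rplus_0_l.
  + apply Rplus_0_l.
Qed.

Lemma sum_reverse (r : nat -> R) n K : (forall k, 0 <= r k) ->
  sum_n (fun k => if le_dec k n then r (n - k)%nat else 0) K <= sum_n r n.
Proof.
intros Hr.
assert (HK : forall K, (K <= n)%nat ->
  sum_n (fun k => if le_dec k n then r (n - k)%nat else 0) K
   + (if le_dec (S K) n then sum_n r (n - S K) else 0) = sum_n r n).
{ induction K0 as [|K0 IH]; intros HK0; rewrite ?sum_O ?sum_Sn.
  - destruct (le_dec 0 n); [|lia]. destruct (le_dec 1 n).
    + replace n with (S (n - 1)) at 3 by lia. rewrite sum_Sn; change plus with Rplus.
      replace (S (n - 1)) with (n - 0)%nat by lia. ring.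
    + replace n with 0%nat by lia. rewrite sum_O; simpl; ring.
  - rewrite -IH; [|lia]. change plus with Rplus.
    destruct (le_dec (S K0) n); [|lia]. destruct (le_dec (S (S K0)) n).
    + replace (n - S K0)%nat with (S (n - S (S K0))) at 2 by lia.
      rewrite sum_Sn; change plus with Rplus.
      replace (S (n - S (S K0))) with (n - S K0)%nat by lia. ring.
    + replace (n - S K0)%nat with 0%nat by lia. rewrite sum_O; ring. }
assert (Hpos : forall j, 0 <= sum_n r j) by (intros; now apply sum_n_nonneg).
induction K as [|K IH].
- specialize (HK 0%nat ltac:(lia)). destruct (le_dec 1 n); pose proof (Hpos (n - 1)%nat); simpl in *; lra.
- destruct (le_dec (S K) n) as [Hle|Hgt].
  + specialize (HK (S K) Hle). destruct (le_dec (S (S K)) n); pose proof (Hpos (n - S (S K))%nat); lra.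
  + rewrite sum_Sn. destruct (le_dec (S K) n); [lia|]. rewrite plus_zero_r; auto.
Qed.

Lemma decay_row_sum n : ex_series (fun k => decay (index_dist n k)) /\ Series (fun k => decay (index_dist n k)) <= 2 * decay_total.
Proof.
assert (Hd : forall k, 0 <= decay (INR k)) by (intros; apply Rlt_le, decay_pos).
apply nonneg_series; [intros; apply Rlt_le, decay_pos|]; intros K.
set (u := fun k => if le_dec k n then decay (INR (n - k)) else 0).
set (w := fun k => if le_dec n k then decay (INR (k - n)) else 0).
apply Rle_trans with (sum_n (fun k => u k + w k) K).
- apply sum_n_le_sum_n; intros k; unfold u, w, index_dist.
  destruct (le_dec k n) as [H1|H1], (le_dec n k) as [H2|H2]; try lia.
  + replace (n - k)%nat with 0%nat by lia; replace (k - n)%nat with 0%nat by lia.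
    replace (INR n) with (INR k) by (f_equal; lia). rewrite Rminus_diag Rabs_R0; simpl.
    pose proof (decay_pos 0); lra.
  + rewrite minus_INR; auto. apply le_INR in H1. rewrite Rabs_pos_eq; lra.
  + rewrite minus_INR; auto. apply le_INR in H2. rewrite Rabs_minus_sym Rabs_pos_eq; lra.
- rewrite (sum_n_plus u w). change plus with Rplus.
  assert (Hu : sum_n u K <= decay_total).
  { apply Rle_trans with (sum_n (fun d => decay (INR d)) n).
    - apply (sum_reverse (fun d => decay (INR d))); auto.
    - apply (sum_n_le_Series (fun d => decay (INR d))); auto; apply decay_summable. }
  assert (Hw : sum_n w K <= decay_total).
  { unfold w; rewrite (sum_shift (fun d => decay (INR d))). destruct (le_dec n K).
    - apply (sum_n_le_Series (fun d => decay (INR d))); auto; apply decay_summable.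
    - apply decay_total_nonneg. }
  lra.
Qed.

(** [(k + 1) (1 + |n - k|) >= n + 1]. *)
Lemma weight_ratio n k : weight k <= weight n * Rpower (1 + index_dist n k) a.
Proof.
unfold weight. pose proof (pos_INR k); pose proof (pos_INR n); pose proof (index_dist_nonneg n k).
assert (Hm : INR n + 1 <= (INR k + 1) * (1 + index_dist n k)).
{ unfold index_dist in *. pose proof (Rle_abs (INR n - INR k)). nra. }
assert (E : Rpower (INR k + 1) (- a) = Rpower ((INR k + 1) * (1 + index_dist n k)) (- a) * Rpower (1 + index_dist n k) a).
{ rewrite -Rpower_mult_distr; try lra.
  rewrite Rmult_assoc -Rpower_plus. replace (- a + a) with 0 by ring. rewrite Rpower_O; lra. }
rewrite E. apply Rmult_le_compat_r; [apply Rlt_le, exp_pos|]. apply Rpower_neg_antitone; lra.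
Qed.

Lemma weight_square_kernel n k : (weight k / (1 + index_dist n k)) ^ 2 <= weight n ^ 2 * decay (index_dist n k).
Proof.
pose proof (index_dist_nonneg n k) as Hd. pose proof (weight_ratio n k) as Hr.
pose proof (weight_pos k); pose proof (weight_pos n).
set (x := 1 + index_dist n k) in *. assert (Hx : 1 <= x) by (unfold x; lra).
apply Rle_trans with ((weight n * Rpower x a / x) ^ 2).
- apply pow_incr; split; [apply Rlt_le, Rdiv_lt_0_compat; lra|].
  unfold Rdiv; apply Rmult_le_compat_r; [apply Rlt_le, Rinv_0_lt_compat; lra|auto].
- replace ((weight n * Rpower x a / x) ^ 2) with (weight n ^ 2 * (Rpower x a * / x) ^ 2) by (unfold Rdiv; ring).
  apply Rmult_le_compat_l; [apply pow2_ge_0|].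
  assert (E : (Rpower x a * / x) ^ 2 = Rpower x (2 * a - 2)).
  { assert (E1 : Rpower x a * / x = Rpower x (a - 1)).
    { unfold Rminus; rewrite Rpower_plus (Rpower_Ropp x 1) Rpower_1; lra. }
    rewrite E1 -Rsqr_pow2; unfold Rsqr. rewrite -Rpower_plus. f_equal; ring. }
  rewrite E; unfold decay; fold x. apply Rle_Rpower; lra.
Qed.

(** The larger of [n + 1] and [k + 1] is at least [1 + |n - k|]. *)
Lemma weight_product_kernel n k : weight n * weight k / (1 + index_dist n k) <= decay (index_dist n k).
Proof.
pose proof (index_dist_nonneg n k) as Hd.
assert (Hw1 : forall j, weight j <= 1).
{ intros j; unfold weight. apply Rle_trans with (Rpower 1 (- a)); [|rewrite Rpower_base_1; lra].
  apply Rpower_neg_antitone; pose proof (pos_INR j); lra. }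
assert (Hmin : weight n * weight k <= Rpower (1 + index_dist n k) (- a)).
{ pose proof (weight_pos k); pose proof (weight_pos n).
  pose proof (Hw1 k); pose proof (Hw1 n); pose proof (pos_INR n); pose proof (pos_INR k).
  unfold index_dist in *. destruct (Rle_dec (INR k) (INR n)).
  - apply Rle_trans with (weight n); [nra|]. unfold weight. apply Rpower_neg_antitone; [lra|].
    rewrite Rabs_pos_eq; lra.
  - apply Rle_trans with (weight k); [nra|]. unfold weight. apply Rpower_neg_antitone; [lra|].
    rewrite Rabs_minus_sym Rabs_pos_eq; lra. }
set (x := 1 + index_dist n k) in *. assert (Hx : 1 <= x) by (unfold x; lra).
unfold decay; fold x. replace (- (1 + a)) with (- a + - (1)) by ring.
rewrite Rpower_plus (Rpower_Ropp x 1) Rpower_1; [|lra].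
unfold Rdiv; apply Rmult_le_compat_r; [apply Rlt_le, Rinv_0_lt_compat; lra|auto].
Qed.

Definition kernel_sum (f : nat -> R) (n : nat) : R := Series (fun k => weight k * f k / (1 + index_dist n k)).

Section Sequence.

Variable f : nat -> R.
Hypothesis f_nonneg : forall k, 0 <= f k.
Hypothesis f_square : ex_series (fun k => f k ^ 2).

Lemma kernel_sum_summable n : ex_series (fun k => weight k * f k / (1 + index_dist n k)) /\
  kernel_sum f n ^ 2 <= 2 * decay_total * weight n ^ 2 * Series (fun k => f k ^ 2).
Proof.
destruct (decay_row_sum n) as [Hex Hle].
assert (Hd : forall k, 0 < 1 + index_dist n k) by (intros; pose proof (index_dist_nonneg n k); lra).
assert (Hk0 : forall k, 0 <= weight k / (1 + index_dist n k)).
{ intros k; apply Rlt_le, Rdiv_lt_0_compat; auto; apply weight_pos. }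
assert (Hsq : ex_series (fun k => (weight k / (1 + index_dist n k)) ^ 2)).
{ apply ex_series_dominated with (fun k => weight n ^ 2 * decay (index_dist n k)).
  - intros k; split; [apply pow2_ge_0|apply weight_square_kernel].
  - now apply ex_series_scal_R. }
assert (Eq : forall k, weight k / (1 + index_dist n k) * f k = weight k * f k / (1 + index_dist n k))
  by (intros; unfold Rdiv; ring).
destruct (series_cauchy_schwarz (fun k => weight k / (1 + index_dist n k)) f) as [E CS]; auto.
split; [now apply ex_series_ext_R with (1 := Eq)|].
unfold kernel_sum; rewrite -(Series_ext _ _ Eq).
apply Rle_trans with (1 := CS). apply Rmult_le_compat_r.
- apply Series_nonneg; auto; intros; apply pow2_ge_0.
- apply Rle_trans with (Series (fun k => weight n ^ 2 * decay (index_dist n k))).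
  + apply Series_le; [intros k; split; [apply pow2_ge_0|apply weight_square_kernel]|now apply ex_series_scal_R].
  + rewrite Series_scal_l. pose proof (pow2_ge_0 (weight n)). nra.
Qed.

Lemma kernel_sum_nonneg n : 0 <= kernel_sum f n.
Proof.
apply Series_nonneg; [|apply kernel_sum_summable]. intros k.
apply Rmult_le_pos; [apply Rmult_le_pos; auto; apply Rlt_le, weight_pos|].
pose proof (index_dist_nonneg n k); apply Rlt_le, Rinv_0_lt_compat; lra.
Qed.

(** Schur's test: the rows and the columns of [decay |n - k|] have bounded sums. *)
Lemma kernel_sum_square N :
  sum_n (fun n => (weight n * kernel_sum f n) ^ 2) N <= (2 * decay_total) ^ 2 * Series (fun k => f k ^ 2).
Proof.
pose proof decay_total_nonneg as HD.
assert (Hdk : forall n k, 0 <= decay (index_dist n k)) by (intros; apply Rlt_le, decay_pos).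
assert (Hex : forall n, ex_series (fun k => decay (index_dist n k) * f k ^ 2)).
{ intros n; apply ex_series_dominated with (fun k => 1 * f k ^ 2); [|now apply ex_series_scal_R].
  intros k; pose proof (pow2_ge_0 (f k)); pose proof (Hdk n k). split; [nra|].
  apply Rmult_le_compat_r; auto. unfold decay.
  apply Rle_trans with (Rpower 1 (- (1 + a))); [|rewrite Rpower_base_1; lra].
  apply Rpower_neg_antitone; [lra|]. pose proof (index_dist_nonneg n k); lra. }
assert (Hrow : forall n, (weight n * kernel_sum f n) ^ 2 <= 2 * decay_total * Series (fun k => decay (index_dist n k) * f k ^ 2)).
{ intros n. destruct (decay_row_sum n) as [Hr1 Hr2].
  set (s := fun k => sqrt (decay (index_dist n k))).
  assert (Hs2 : forall k, s k ^ 2 = decay (index_dist n k)) by (intros; apply pow2_sqrt; auto).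
  assert (Hs0 : forall k, 0 <= s k) by (intros; apply sqrt_pos).
  assert (Eq : forall k, (s k * f k) ^ 2 = decay (index_dist n k) * f k ^ 2).
  { intros k; rewrite Rpow_mult_distr Hs2; reflexivity. }
  destruct (series_cauchy_schwarz s (fun k => s k * f k)) as [E CS]; auto.
  - intros k; now apply Rmult_le_pos.
  - now apply ex_series_ext_R with (fun k => decay (index_dist n k)).
  - apply ex_series_ext_R with (2 := Hex n); auto.
  - rewrite (Series_ext _ _ Eq) (Series_ext _ _ Hs2) in CS.
    assert (Hle : weight n * kernel_sum f n <= Series (fun k => s k * (s k * f k))).
    { unfold kernel_sum; rewrite -Series_scal_l; apply Series_le; auto.
      intros k; pose proof (index_dist_nonneg n k). pose proof (weight_pos n); pose proof (weight_pos k).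
      assert (Hi : 0 < / (1 + index_dist n k)) by (apply Rinv_0_lt_compat; lra). split.
      - unfold Rdiv. repeat apply Rmult_le_pos; auto; lra.
      - replace (s k * (s k * f k)) with (s k ^ 2 * f k) by ring. rewrite Hs2.
        replace (weight n * (weight k * f k / (1 + index_dist n k))) with (weight n * weight k / (1 + index_dist n k) * f k)
          by (unfold Rdiv; ring).
        apply Rmult_le_compat_r; auto. apply weight_product_kernel. }
    apply Rle_trans with (Series (fun k => s k * (s k * f k)) ^ 2).
    { apply pow_incr; split; auto. apply Rmult_le_pos; [apply Rlt_le, weight_pos|apply kernel_sum_nonneg]. }
    apply Rle_trans with (1 := CS). apply Rmult_le_compat_r; auto.
    apply Series_nonneg; auto. intros k; apply Rmult_le_pos; auto; apply pow2_ge_0. }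
apply Rle_trans with (1 := sum_n_le_sum_n _ _ N Hrow).
assert (Hsum : forall N, ex_series (fun k => sum_n (fun n => decay (index_dist n k)) N * f k ^ 2) /\
  sum_n (fun n => 2 * decay_total * Series (fun k => decay (index_dist n k) * f k ^ 2)) N
  = 2 * decay_total * Series (fun k => sum_n (fun n => decay (index_dist n k)) N * f k ^ 2)).
{ induction N0 as [|N0 [IH1 IH2]].
  - split; [apply ex_series_ext_R with (2 := Hex 0%nat); intros; now rewrite sum_O|].
    rewrite sum_O; f_equal; apply Series_ext; intros; now rewrite sum_O.
  - assert (Eq : forall k, sum_n (fun n => decay (index_dist n k)) N0 * f k ^ 2 + decay (index_dist (S N0) k) * f k ^ 2
      = sum_n (fun n => decay (index_dist n k)) (S N0) * f k ^ 2).
    { intros k; rewrite sum_Sn; symmetry; apply Rmult_plus_distr_r. }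
    split; [apply ex_series_ext_R with (1 := Eq), ex_series_plus_R; auto|].
    rewrite sum_Sn IH2 -(Series_ext _ _ Eq) Series_plus; auto. symmetry; apply Rmult_plus_distr_l. }
destruct (Hsum N) as [_ ->].
replace ((2 * decay_total) ^ 2 * Series (fun k => f k ^ 2))
  with (2 * decay_total * (2 * decay_total * Series (fun k => f k ^ 2))) by ring.
apply Rmult_le_compat_l; [lra|]. rewrite -Series_scal_l; apply Series_le; [|now apply ex_series_scal_R].
intros k; pose proof (pow2_ge_0 (f k)).
assert (Hcol : sum_n (fun n => decay (index_dist n k)) N <= 2 * decay_total).
{ rewrite (sum_n_ext _ (fun n => decay (index_dist k n))); [|intros; now rewrite index_dist_sym].
  destruct (decay_row_sum k) as [Hr1 Hr2]. apply Rle_trans with (2 := Hr2).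
  apply (sum_n_le_Series (fun n => decay (index_dist k n))); auto. }
split; [apply Rmult_le_pos; auto; now apply sum_n_nonneg|now apply Rmult_le_compat_r].
Qed.

End Sequence.

End Kernel.

(** * Resolvents of the perturbed form *)

Section Form.

Variable H : HilbertSpace.
Variable e : nat -> H.
Hypothesis e_orthonormal : forall j k, inner (e j) (e k) = if Nat.eq_dec j k then RtoC 1 else RtoC 0.
Hypothesis e_expansion : forall f, is_series (fun k => scal (inner f (e k)) (e k)) f.

Notation "f # k" := (inner f (e k)) (at level 9, k at level 9, format "f # k").

(** ** Diagonal operators *)

Definition diagonal (d : nat -> C) (f : H) : H := vec H e (fun k => (d k * f#k)%C).

Section Diagonal.

Variables (d : nat -> C) (B : R).
Hypothesis d_bound : forall k, Cmod (d k) <= B.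

Lemma diagonal_square_summable f : ex_series (fun k => Cmod (d k * f#k)%C ^ 2).
Proof.
apply ex_series_dominated with (fun k => B ^ 2 * Cmod (f#k) ^ 2).
- intros k; split; [apply pow2_ge_0|].
  rewrite Cmod_mult Rpow_mult_distr; apply Rmult_le_compat_r; [apply pow2_ge_0|].
  apply pow_incr; split; [apply Cmod_ge_0|apply d_bound].
- apply ex_series_scal_R, coord_square_summable; auto.
Qed.

Lemma diagonal_coord f k : (diagonal d f)#k = (d k * f#k)%C.
Proof. exact (coord_vec H e e_orthonormal _ k (diagonal_square_summable f)). Qed.

Lemma diagonal_norm f : norm (diagonal d f) <= B * norm f.
Proof.
assert (HB : 0 <= B) by (apply Rle_trans with (2 := d_bound 0), Cmod_ge_0).
apply (norm_le_of_coord H e e_expansion _ (fun k => B * Cmod (f#k))).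
- apply Rmult_le_pos; auto; apply norm_ge_0.
- intros k; rewrite diagonal_coord Cmod_mult; apply Rmult_le_compat_r; auto; apply Cmod_ge_0.
- apply ex_series_ext_R with (fun k => B ^ 2 * Cmod (f#k) ^ 2); [intros; ring|].
  apply ex_series_scal_R, coord_square_summable; auto.
- rewrite (Series_ext _ (fun k => B ^ 2 * Cmod (f#k) ^ 2)); [|intros k; simpl; ring].
  rewrite Series_scal_l (Series_coord_square H e e_expansion). right; ring.
Qed.

Lemma diagonal_linear : is_linear (diagonal d).
Proof.
assert (HB : 0 <= B) by (apply Rle_trans with (2 := d_bound 0), Cmod_ge_0).
split.
- intros x y; apply (coord_ext H e e_expansion); intros k.
  rewrite inner_plus_l !diagonal_coord inner_plus_l; ring.
- intros c x; apply (coord_ext H e e_expansion); intros k.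
  rewrite inner_scal_l !diagonal_coord inner_scal_l; ring.
- exists (B + 1); split; [lra|]; intros f.
  apply Rle_trans with (1 := diagonal_norm f); pose proof (norm_ge_0 f); nra.
Qed.

End Diagonal.

(** ** The forms *)

Variables (m v : nat -> R) (V : H -> Prop) (a b : H -> H -> C) (Mb : R).
Hypothesis m_ge_1 : forall k, 1 <= m k.
Hypothesis v_pos : forall k, 0 < v k.
Hypothesis Mb_pos : 0 < Mb.
Hypothesis V_iff : forall u, V u <-> ex_series (fun k => m k * Cmod (u#k) ^ 2).
Hypothesis a_series : forall u w, V u -> V w ->
  is_series (V := C_NormedModule) (fun k => RtoC (m k) * (u#k * Cconj (w#k)))%C (a u w).
Hypothesis b_plus_l : forall u u' w, V u -> V u' -> V w -> b (plus u u') w = Cplus (b u w) (b u' w).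
Hypothesis b_scal_l : forall (c : C) u w, V u -> V w -> b (scal c u) w = Cmult c (b u w).
Hypothesis b_plus_r : forall u u' w, V u -> V u' -> V w -> b w (plus u u') = Cplus (b w u) (b w u').
Hypothesis b_scal_r : forall (c : C) u w, V u -> V w -> b w (scal c u) = Cmult (Cconj c) (b w u).

(** The weighted l^1 norm by which [b] is bounded. *)
Definition weight_norm (u : H) : R := Series (fun k => v k * Cmod (u#k)).

Hypothesis V_weight : forall u, V u -> ex_series (fun k => v k * Cmod (u#k)).
Hypothesis b_bound : forall u w, V u -> V w -> Cmod (b u w) <= Mb * weight_norm u * weight_norm w.

Lemma V_plus u w : V u -> V w -> V (plus u w).
Proof.
rewrite !V_iff; intros Hu Hw.
apply ex_series_dominated with (fun k => 2 * (m k * Cmod (u#k) ^ 2) + 2 * (m k * Cmod (w#k) ^ 2)).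
- intros k; specialize (m_ge_1 k); split.
  + apply Rmult_le_pos; [lra|apply pow2_ge_0].
  + rewrite inner_plus_l. pose proof (Cmod_triangle (u#k) (w#k)) as Ht.
    pose proof (Cmod_ge_0 (u#k + w#k)%C).
    assert (Cmod (u#k + w#k)%C ^ 2 <= 2 * Cmod (u#k) ^ 2 + 2 * Cmod (w#k) ^ 2).
    { pose proof (pow2_ge_0 (Cmod (u#k) - Cmod (w#k))).
      assert (Cmod (u#k + w#k)%C ^ 2 <= (Cmod (u#k) + Cmod (w#k)) ^ 2) by (apply pow_incr; lra). nra. }
    nra.
- apply ex_series_plus_R; now apply ex_series_scal_R.
Qed.

Lemma V_scal (c : C) u : V u -> V (scal c u).
Proof.
rewrite !V_iff; intros Hu.
apply ex_series_ext_R with (fun k => Cmod c ^ 2 * (m k * Cmod (u#k) ^ 2)).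
- intros k; rewrite inner_scal_l Cmod_mult; ring.
- now apply ex_series_scal_R.
Qed.

Lemma is_series_single (u : nat -> R) i : (forall k, k <> i -> u k = 0) -> is_series u (u i).
Proof.
intros Hu.
assert (Hz : forall n, sum_n u n = if le_dec i n then u i else 0).
{ induction n as [|n IH]; rewrite ?sum_O ?sum_Sn.
  - destruct (le_dec i 0); [now replace i with 0%nat by lia|apply Hu; lia].
  - rewrite IH. change plus with Rplus.
    destruct (le_dec i n), (le_dec i (S n)); try lia.
    + rewrite (Hu (S n)); [apply Rplus_0_r|lia].
    + replace i with (S n) by lia; apply Rplus_0_l.
    + rewrite (Hu (S n)); [apply Rplus_0_l|lia]. }
apply is_series_R; intros eps; exists i; intros n Hn.
rewrite Hz; destruct (le_dec i n); [|lia].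
rewrite Rminus_diag Rabs_R0; apply cond_pos.
Qed.

Lemma V_basis k : V (e k).
Proof.
apply V_iff; eexists; apply (is_series_single (fun j => m j * Cmod ((e k)#j) ^ 2) k).
intros j Hj; rewrite e_orthonormal; destruct (Nat.eq_dec k j); [lia|]. rewrite Cmod_0; ring.
Qed.

Lemma weight_norm_basis k : weight_norm (e k) = v k.
Proof.
unfold weight_norm; rewrite (is_series_unique _ (v k * Cmod ((e k)#k))).
- rewrite e_orthonormal; destruct (Nat.eq_dec k k); [|lia]. rewrite Cmod_1; ring.
- apply (is_series_single (fun j => v j * Cmod ((e k)#j))).
  intros j Hj; rewrite e_orthonormal; destruct (Nat.eq_dec k j); [lia|]. rewrite Cmod_0; ring.
Qed.

Lemma weight_norm_nonneg u : V u -> 0 <= weight_norm u.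
Proof.
intros Hu; apply Series_nonneg; [|now apply V_weight].
intros k; apply Rmult_le_pos; [apply Rlt_le, v_pos|apply Cmod_ge_0].
Qed.

Lemma a_basis_r u k : V u -> a u (e k) = (RtoC (m k) * u#k)%C.
Proof.
intros Hu; apply (is_series_C_unique _ _ _ (a_series u (e k) Hu (V_basis k))).
apply is_series_C_single with k; intros j; rewrite e_orthonormal.
destruct (Nat.eq_dec k j) as [->|Hne].
- destruct (Nat.eq_dec j j); [|lia].
  replace (Cconj 1) with (RtoC 1) by (apply injective_projections; simpl; ring). ring.
- destruct (Nat.eq_dec j k); [lia|].
  replace (Cconj 0) with (RtoC 0) by (apply injective_projections; simpl; ring). ring.
Qed.

(** [u] solves [(z - A - s B) u = f] in the form sense. *)
Definition weak_solution (s : R) (z : C) (u f : H) : Prop :=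
  V u /\ forall w, V w -> (z * inner u w - a u w - RtoC s * b u w)%C = inner f w.

Lemma weak_combination s z u u' f f' (c : C) :
  weak_solution s z u f -> weak_solution s z u' f' ->
  weak_solution s z (plus u (scal c u')) (plus f (scal c f')).
Proof.
intros [Hu Hw] [Hu' Hw']. assert (Hn := V_scal c u' Hu').
split; [now apply V_plus|]; intros w Hvw.
assert (Ea : a (plus u (scal c u')) w = (a u w + c * a u' w)%C).
{ apply (is_series_C_unique _ _ _ (a_series _ w (V_plus _ _ Hu Hn) Hvw)).
  apply (is_series_ext (V := C_NormedModule))
    with (2 := is_series_plus (V := C_NormedModule) _ _ _ _ (a_series u w Hu Hvw)
                 (is_series_scal (V := C_NormedModule) c _ _ (a_series u' w Hu' Hvw))).
  intros k; rewrite inner_plus_l inner_scal_l.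
  change (RtoC (m k) * (u#k * Cconj (w#k)) + c * (RtoC (m k) * (u'#k * Cconj (w#k)))
    = RtoC (m k) * ((u#k + c * u'#k) * Cconj (w#k)))%C; ring. }
rewrite Ea b_plus_l; auto. rewrite b_scal_l; auto.
rewrite !inner_plus_l !inner_scal_l -Hw; auto. rewrite -Hw'; auto. ring.
Qed.

Definition resolvent_sum (z : C) : nat -> R := fun k => v k ^ 2 / Cmod (z - RtoC (m k))%C.

Definition contraction_point (z : C) : Prop :=
  (forall k, 3 / 8 <= Cmod (z - RtoC (m k))%C) /\
  ex_series (resolvent_sum z) /\ Mb * Series (resolvent_sum z) <= 2 / 3.

(** The value of [weight_norm] on [|z - A|^{-1} f]. *)
Definition dual_norm (z : C) (f : H) : R := Series (fun k => v k * Cmod (f#k) / Cmod (z - RtoC (m k))%C).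

Section ContractionPoint.

Variable z : C.
Hypothesis Hz : contraction_point z.

Lemma contraction_pos k : 0 < Cmod (z - RtoC (m k))%C.
Proof. destruct Hz as [H1 _]; specialize (H1 k); lra. Qed.

Lemma good_inv k : 0 < / Cmod (z - RtoC (m k))%C <= 8 / 3.
Proof.
split; [apply Rinv_0_lt_compat, contraction_pos|].
replace (8 / 3) with (/ (3 / 8)) by field. apply Rinv_le_contravar; [lra|]. apply Hz.
Qed.

Lemma resolvent_sum_nonneg k : 0 <= resolvent_sum z k.
Proof. apply Rmult_le_pos; [apply pow2_ge_0|apply Rlt_le, good_inv]. Qed.

Lemma dual_summable f : ex_series (fun k => v k * Cmod (f#k) / Cmod (z - RtoC (m k))%C) /\
  Mb * dual_norm z f ^ 2 <= 16 / 9 * norm f ^ 2.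
Proof.
destruct Hz as [_ [Hex HS]].
assert (Hsq : ex_series (fun k => (v k / Cmod (z - RtoC (m k))%C) ^ 2)).
{ apply ex_series_dominated with (fun k => 8 / 3 * resolvent_sum z k).
  - intros k; split; [apply pow2_ge_0|]. unfold resolvent_sum, Rdiv.
    pose proof (good_inv k). pose proof (pow2_ge_0 (v k)).
    replace ((v k * / Cmod (z - RtoC (m k))%C) ^ 2)
      with (/ Cmod (z - RtoC (m k))%C * (v k ^ 2 * / Cmod (z - RtoC (m k))%C)) by ring.
    apply Rmult_le_compat_r; [apply Rmult_le_pos|]; lra.
  - now apply ex_series_scal_R. }
assert (Hle : Series (fun k => (v k / Cmod (z - RtoC (m k))%C) ^ 2) <= 8 / 3 * Series (resolvent_sum z)).
{ rewrite -Series_scal_l; apply Series_le; [|now apply ex_series_scal_R].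
  intros k; split; [apply pow2_ge_0|]. unfold resolvent_sum, Rdiv.
  pose proof (good_inv k). pose proof (pow2_ge_0 (v k)).
  replace ((v k * / Cmod (z - RtoC (m k))%C) ^ 2)
    with (/ Cmod (z - RtoC (m k))%C * (v k ^ 2 * / Cmod (z - RtoC (m k))%C)) by ring.
  apply Rmult_le_compat_r; [apply Rmult_le_pos|]; lra. }
destruct (series_cauchy_schwarz (fun k => v k / Cmod (z - RtoC (m k))%C) (fun k => Cmod (f#k))) as [E CS]; auto.
- intros k; apply Rmult_le_pos; [apply Rlt_le, v_pos|apply Rlt_le, good_inv].
- intros k; apply Cmod_ge_0.
- apply coord_square_summable; auto.
- rewrite (Series_coord_square H e e_expansion) in CS.
  assert (Eq : forall k, v k / Cmod (z - RtoC (m k))%C * Cmod (f#k) = v k * Cmod (f#k) / Cmod (z - RtoC (m k))%C)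
    by (intros; unfold Rdiv; ring).
  split; [now apply ex_series_ext_R with (1 := Eq)|].
  unfold dual_norm; rewrite -(Series_ext _ _ Eq).
  apply Rle_trans with (Mb * (8 / 3 * Series (resolvent_sum z) * norm f ^ 2)).
  + apply Rmult_le_compat_l; [lra|]. apply Rle_trans with (1 := CS).
    apply Rmult_le_compat_r; [apply pow2_ge_0|auto].
  + pose proof (pow2_ge_0 (norm f)). nra.
Qed.

Lemma dual_norm_nonneg f : 0 <= dual_norm z f.
Proof.
apply Series_nonneg; [|apply dual_summable]. intros k; apply Rmult_le_pos; [|apply Rlt_le, good_inv].
apply Rmult_le_pos; [apply Rlt_le, v_pos|apply Cmod_ge_0].
Qed.

Lemma dual_norm_product f g : Mb * dual_norm z f * dual_norm z g <= 16 / 9 * norm f * norm g.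
Proof.
pose proof (proj2 (dual_summable f)) as Hf; pose proof (proj2 (dual_summable g)) as Hg.
pose proof (dual_norm_nonneg f); pose proof (dual_norm_nonneg g).
pose proof (norm_ge_0 f); pose proof (norm_ge_0 g).
assert (0 <= Mb * dual_norm z f * dual_norm z g) by (repeat apply Rmult_le_pos; lra).
assert (0 <= 16 / 9 * norm f * norm g) by (repeat apply Rmult_le_pos; lra).
apply Rsqr_incr_0_var; auto. rewrite !Rsqr_pow2.
replace ((Mb * dual_norm z f * dual_norm z g) ^ 2)
  with ((Mb * dual_norm z f ^ 2) * (Mb * dual_norm z g ^ 2)) by ring.
replace ((16 / 9 * norm f * norm g) ^ 2) with ((16 / 9 * norm f ^ 2) * (16 / 9 * norm g ^ 2)) by ring.
apply Rmult_le_compat; auto; apply Rmult_le_pos; try apply pow2_ge_0; lra.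
Qed.

Lemma weak_coord s u f k : weak_solution s z u f ->
  ((z - RtoC (m k)) * u#k)%C = (f#k + RtoC s * b u (e k))%C.
Proof.
intros [Hu Hw]; specialize (Hw (e k) (V_basis k)).
rewrite a_basis_r in Hw; auto. rewrite -Hw; ring.
Qed.

(** All a priori bounds come from this one: a coordinatewise estimate
    [|(z - m_k) u_k| <= |f_k| + c v_k] bounds [weight_norm u], since summing it
    against [v_k / |z - m_k|] multiplies [c] by [resolvent_sum]. *)
Lemma weight_norm_le u f c : V u -> 0 <= c ->
  (forall k, Cmod (z - RtoC (m k))%C * Cmod (u#k) <= Cmod (f#k) + c * v k) ->
  weight_norm u <= dual_norm z f + c * Series (resolvent_sum z).
Proof.
intros Hu Hc Hk. destruct Hz as [_ [Hex _]].
unfold weight_norm, dual_norm; rewrite -Series_scal_l -Series_plus.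
- apply Series_le.
  + intros k; pose proof (v_pos k); pose proof (contraction_pos k); pose proof (Cmod_ge_0 (u#k)); split.
    * apply Rmult_le_pos; lra.
    * apply Rmult_le_reg_r with (Cmod (z - RtoC (m k))%C); auto.
      replace ((v k * Cmod (f#k) / Cmod (z - RtoC (m k))%C + c * resolvent_sum z k) * Cmod (z - RtoC (m k))%C)
        with (v k * (Cmod (f#k) + c * v k)) by (unfold resolvent_sum; field; lra).
      specialize (Hk k). rewrite Rmult_assoc; apply Rmult_le_compat_l; lra.
  + apply ex_series_plus_R; [apply dual_summable|now apply ex_series_scal_R].
- apply dual_summable.
- now apply ex_series_scal_R.
Qed.

Lemma weak_weight_norm s u f : 0 <= s <= 1 -> weak_solution s z u f -> weight_norm u <= 3 * dual_norm z f.
Proof.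
intros Hs Hw. assert (Hu := proj1 Hw). assert (Hq := weight_norm_nonneg u Hu).
assert (HqM : 0 <= Mb * weight_norm u) by (apply Rmult_le_pos; lra).
assert (weight_norm u <= dual_norm z f + (Mb * weight_norm u) * Series (resolvent_sum z)).
{ apply weight_norm_le; auto; intros k.
  rewrite -Cmod_mult (weak_coord s u f k Hw).
  apply Rle_trans with (1 := Cmod_triangle _ _); apply Rplus_le_compat_l.
  rewrite Cmod_mult Cmod_R Rabs_pos_eq; [|lra].
  pose proof (b_bound u (e k) Hu (V_basis k)) as Hb; rewrite weight_norm_basis in Hb.
  pose proof (Cmod_ge_0 (b u (e k))). nra. }
destruct Hz as [_ [_ HS]].
assert (Mb * weight_norm u * Series (resolvent_sum z) <= 2 / 3 * weight_norm u) by nra. lra.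
Qed.

Lemma weak_unique s u u' f : 0 <= s <= 1 -> weak_solution s z u f -> weak_solution s z u' f -> u = u'.
Proof.
intros Hs Hw Hw'.
set (d := plus u (scal (- (1) : C_AbsRing)%C u') : H).
assert (Hd : weak_solution s z d zero).
{ replace (zero : H) with (plus f (scal (- (1) : C_AbsRing)%C f) : H); [now apply weak_combination|].
  apply inner_ext; intros w; rewrite inner_plus_l inner_scal_l inner_zero_l; ring. }
assert (HV := proj1 Hd).
assert (Hz0 : dual_norm z (zero : H) = 0).
{ unfold dual_norm; rewrite (Series_ext _ (fun k => 0 * 0)). all: cycle 1.
  - intros k; rewrite inner_zero_l Cmod_0; unfold Rdiv; ring.
  - rewrite Series_scal_l; ring. }
pose proof (weak_weight_norm s d zero Hs Hd) as Hn; rewrite Hz0 in Hn.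
apply (coord_ext H e e_expansion); intros k.
assert (Hk : v k * Cmod (d#k) <= 0).
{ apply Rle_trans with (weight_norm d); [|lra].
  apply (term_le_Series (fun k => v k * Cmod (d#k))); [|now apply V_weight].
  intros j; apply Rmult_le_pos; [apply Rlt_le, v_pos|apply Cmod_ge_0]. }
assert (Hdk : Cmod (d#k) = 0) by (pose proof (v_pos k); pose proof (Cmod_ge_0 (d#k)); nra).
apply Cmod_eq_0 in Hdk. unfold d in Hdk; rewrite inner_plus_l inner_scal_l in Hdk.
replace (u#k) with ((u#k + - (1) * u'#k) + u'#k)%C by ring. rewrite Hdk; ring.
Qed.

(** The difference [d] of the solutions satisfies
    [(z - m_k) d_k = s' b(d, e_k) + (s - s') b(u, e_k)], so [|(z - m_k) d_k| <= c v_k];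
    [weight_norm_le] with [f = 0] absorbs the part of [c] that comes from [d], and
    pairing with [g] leaves [c * dual_norm g]. *)
Lemma weak_difference s s' u u' f g : 0 <= s <= 1 -> 0 <= s' <= 1 ->
  weak_solution s z u f -> weak_solution s' z u' f ->
  Cmod (inner (minus u u') g) <= 9 * Mb * Rabs (s - s') * dual_norm z f * dual_norm z g.
Proof.
intros Hs Hs' Hw Hw'.
assert (Hu := proj1 Hw); assert (Hu' := proj1 Hw').
set (d := plus u (scal (- (1) : C_AbsRing)%C u') : H).
assert (Hn := V_scal (- (1))%C u' Hu').
assert (Hd : V d) by now apply V_plus.
set (c := Mb * (weight_norm d + Rabs (s - s') * weight_norm u)).
assert (Q0 := weight_norm_nonneg d Hd). assert (Q1 := weight_norm_nonneg u Hu).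
assert (Hab := Rabs_pos (s - s')).
assert (Qs : 0 <= Rabs (s - s') * weight_norm u) by now apply Rmult_le_pos.
assert (Hc : 0 <= c) by (apply Rmult_le_pos; lra).
assert (Hk : forall k, Cmod (z - RtoC (m k))%C * Cmod (d#k) <= c * v k).
{ intros k. rewrite -Cmod_mult.
  assert (E : ((z - RtoC (m k)) * d#k = RtoC s' * b d (e k) + RtoC (s - s') * b u (e k))%C).
  { unfold d at 1. rewrite inner_plus_l inner_scal_l.
    transitivity ((z - RtoC (m k)) * u#k - (z - RtoC (m k)) * u'#k)%C; [ring|].
    rewrite (weak_coord s u f k Hw) (weak_coord s' u' f k Hw').
    unfold d; rewrite b_plus_l; auto using V_basis. rewrite b_scal_l; auto using V_basis.
    rewrite RtoC_minus; ring. }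
  rewrite E. apply Rle_trans with (1 := Cmod_triangle _ _). rewrite !Cmod_mult !Cmod_R (Rabs_pos_eq s'); [|lra].
  pose proof (b_bound d (e k) Hd (V_basis k)) as B1; pose proof (b_bound u (e k) Hu (V_basis k)) as B2.
  rewrite weight_norm_basis in B1 B2.
  pose proof (Cmod_ge_0 (b d (e k))).
  assert (s' * Cmod (b d (e k)) <= Mb * weight_norm d * v k) by nra.
  assert (Rabs (s - s') * Cmod (b u (e k)) <= Rabs (s - s') * (Mb * weight_norm u * v k)) by now apply Rmult_le_compat_l.
  unfold c; lra. }
assert (Q2 : weight_norm d <= 0 + c * Series (resolvent_sum z)).
{ replace 0 with (dual_norm z (zero : H)).
  - apply weight_norm_le; auto; intros k. rewrite inner_zero_l Cmod_0 Rplus_0_l; auto.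
  - unfold dual_norm; rewrite (Series_ext _ (fun k => 0 * 0)). all: cycle 1.
    + intros k; rewrite inner_zero_l Cmod_0; unfold Rdiv; ring.
    + rewrite Series_scal_l; ring. }
assert (HS := proj2 (proj2 Hz)).
assert (Q3 : weight_norm d <= 2 * (Rabs (s - s') * weight_norm u)).
{ assert (c * Series (resolvent_sum z) <= 2 / 3 * (weight_norm d + Rabs (s - s') * weight_norm u)).
  { unfold c. replace (Mb * (weight_norm d + Rabs (s - s') * weight_norm u) * Series (resolvent_sum z))
      with (Mb * Series (resolvent_sum z) * (weight_norm d + Rabs (s - s') * weight_norm u)) by ring.
    apply Rmult_le_compat_r; lra. }
  lra. }
assert (Q4 := weak_weight_norm s u f Hs Hw).
assert (Hdn := dual_norm_nonneg f).
assert (Hc9 : c <= 9 * Mb * Rabs (s - s') * dual_norm z f).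
{ unfold c. replace (9 * Mb * Rabs (s - s') * dual_norm z f) with (Mb * (9 * (Rabs (s - s') * dual_norm z f))) by ring.
  apply Rmult_le_compat_l; [lra|].
  assert (Rabs (s - s') * weight_norm u <= Rabs (s - s') * (3 * dual_norm z f)) by now apply Rmult_le_compat_l.
  lra. }
assert (Ed : minus u u' = d :> H).
{ apply inner_ext; intros w; unfold d; rewrite inner_minus_l inner_plus_l inner_scal_l; ring. }
rewrite Ed.
apply Rle_trans with (Series (fun k => c * (v k * Cmod (g#k) / Cmod (z - RtoC (m k))%C))).
- apply (is_series_C_Series_bound _ _ _ (parseval_inner H e e_expansion d g)).
  + intros k; rewrite Cmod_mult Cmod_conj.
    assert (Hp := contraction_pos k). apply Rmult_le_reg_r with (Cmod (z - RtoC (m k))%C); auto.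
    replace (c * (v k * Cmod (g#k) / Cmod (z - RtoC (m k))%C) * Cmod (z - RtoC (m k))%C)
      with (c * v k * Cmod (g#k)) by (field; lra).
    specialize (Hk k); pose proof (Cmod_ge_0 (g#k)). nra.
  + apply ex_series_scal_R, dual_summable.
- rewrite Series_scal_l. fold (dual_norm z g).
  apply Rmult_le_compat_r; auto. apply dual_norm_nonneg.
Qed.

Lemma weak_norm s u f : 0 <= s <= 1 -> weak_solution s z u f -> norm u <= 8 * norm f.
Proof.
intros Hs Hw. assert (Hu := proj1 Hw).
apply norm_le_of_inner; [pose proof (norm_ge_0 f); lra|]; intros g.
assert (Q4 := weak_weight_norm s u f Hs Hw). assert (Q1 := weight_norm_nonneg u Hu).
set (c := 3 * Mb * dual_norm z f).
assert (Hc : 0 <= c) by (pose proof (dual_norm_nonneg f); unfold c; nra).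
destruct (series_cauchy_schwarz (fun k => Cmod (f#k)) (fun k => Cmod (g#k))) as [E CS];
  try (intros; apply Cmod_ge_0); try (apply coord_square_summable; auto).
rewrite !(Series_coord_square H e e_expansion) in CS.
assert (HT : Series (fun k => Cmod (f#k) * Cmod (g#k)) <= norm f * norm g).
{ apply Rsqr_incr_0_var; [rewrite !Rsqr_pow2 Rpow_mult_distr; auto|].
  apply Rmult_le_pos; apply norm_ge_0. }
assert (Hsum : Cmod (inner u g) <= Series (fun k => 8 / 3 * (Cmod (f#k) * Cmod (g#k))
   + c * (v k * Cmod (g#k) / Cmod (z - RtoC (m k))%C))).
{ apply (is_series_C_Series_bound _ _ _ (parseval_inner H e e_expansion u g)).
  - intros k; rewrite Cmod_mult Cmod_conj.
    assert (Hp := contraction_pos k); assert (Hi := good_inv k).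
    assert (Hk : Cmod (z - RtoC (m k))%C * Cmod (u#k) <= Cmod (f#k) + c * v k).
    { rewrite -Cmod_mult (weak_coord s u f k Hw).
      apply Rle_trans with (1 := Cmod_triangle _ _); apply Rplus_le_compat_l.
      rewrite Cmod_mult Cmod_R Rabs_pos_eq; [|lra].
      pose proof (b_bound u (e k) Hu (V_basis k)) as Hb; rewrite weight_norm_basis in Hb.
      pose proof (Cmod_ge_0 (b u (e k))). pose proof (v_pos k).
      apply Rle_trans with (Mb * weight_norm u * v k); [nra|]. apply Rmult_le_compat_r; [lra|].
      unfold c; nra. }
    pose proof (Cmod_ge_0 (g#k)); pose proof (Cmod_ge_0 (f#k)).
    assert (Hu1 : Cmod (u#k) <= 8 / 3 * Cmod (f#k) + c * v k * / Cmod (z - RtoC (m k))%C).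
    { apply Rle_trans with (/ Cmod (z - RtoC (m k))%C * (Cmod (f#k) + c * v k)).
      - apply Rmult_le_reg_l with (Cmod (z - RtoC (m k))%C); auto.
        rewrite -Rmult_assoc Rinv_r; lra.
      - nra. }
    unfold Rdiv in *. nra.
  - apply ex_series_plus_R; apply ex_series_scal_R; auto; apply dual_summable. }
apply Rle_trans with (1 := Hsum). rewrite Series_plus.
- rewrite !Series_scal_l. fold (dual_norm z g).
  pose proof (dual_norm_product f g). unfold c. nra.
- now apply ex_series_scal_R.
- apply ex_series_scal_R, dual_summable.
Qed.

(** Substituting [u = |z - A|^{-1/2} x] turns the weak equation into
    [x = sgn(z - A)^{-1} (|z - A|^{-1/2} f + s K x)], where [K] is the operator of
    the bounded form [b(|z - A|^{-1/2} x, |z - A|^{-1/2} y)] and has norm at most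
    [Mb * resolvent_sum <= 2/3]. *)
Lemma weak_exists s f : 0 <= s <= 1 -> exists u, weak_solution s z u f.
Proof.
intros Hs.
set (r := fun k => Cmod (z - RtoC (m k))%C).
set (om := fun k => / sqrt (r k)).
assert (Hr : forall k, 0 < r k) by apply contraction_pos.
assert (Hom : forall k, 0 < om k) by (intros; apply Rinv_0_lt_compat, sqrt_lt_R0, Hr).
assert (Hom2 : forall k, om k ^ 2 = / r k).
{ intros k; unfold om. rewrite pow_inv pow2_sqrt; auto. apply Rlt_le, Hr. }
assert (HomB : forall k, Cmod (RtoC (om k)) <= 2).
{ intros k; rewrite Cmod_R Rabs_pos_eq; [|apply Rlt_le, Hom].
  assert (Hi := proj2 (good_inv k)). fold (r k) in Hi. rewrite -Hom2 in Hi.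
  pose proof (Hom k). nra. }
set (th := fun k => (RtoC (r k) / (z - RtoC (m k)))%C).
assert (Hne : forall k, (z - RtoC (m k))%C <> 0) by (intros; apply Cmod_gt_0, Hr).
assert (Hth : forall k, Cmod (th k) <= 1).
{ intros k; unfold th; rewrite Cmod_div; auto. rewrite Cmod_R Rabs_pos_eq; [|apply Rlt_le, Hr].
  fold (r k). right; field; apply Rgt_not_eq, Hr. }
set (Om := diagonal (fun k => RtoC (om k))). set (Th := diagonal th).
assert (COm : forall x k, (Om x)#k = (RtoC (om k) * x#k)%C) by (intros; now apply diagonal_coord with 2).
assert (CTh : forall x k, (Th x)#k = (th k * x#k)%C) by (intros; now apply diagonal_coord with 1).
assert (LOm : is_linear Om) by now apply diagonal_linear with 2.
assert (LTh : is_linear Th) by now apply diagonal_linear with 1.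
assert (VOm : forall x, V (Om x)).
{ intros x; apply V_iff.
  apply ex_series_dominated with (fun k => (1 + 8 / 3 * Cmod z) * Cmod (x#k) ^ 2).
  - intros k; pose proof (m_ge_1 k); split; [apply Rmult_le_pos; [lra|apply pow2_ge_0]|].
    rewrite COm Cmod_mult Cmod_R Rpow_mult_distr pow2_abs Hom2 -Rmult_assoc.
    apply Rmult_le_compat_r; [apply pow2_ge_0|].
    assert (Hm : m k <= r k + Cmod z).
    { pose proof (Cmod_triangle (- (z - RtoC (m k)))%C z) as Ht.
      replace (- (z - RtoC (m k)) + z)%C with (RtoC (m k)) in Ht by ring.
      rewrite Cmod_opp Cmod_R Rabs_pos_eq in Ht; [exact Ht|lra]. }
    assert (Hi := good_inv k). fold (r k) in Hi. assert (Hrk := Hr k).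
    pose proof (Cmod_ge_0 z).
    apply Rle_trans with ((r k + Cmod z) * / r k); [apply Rmult_le_compat_r; lra|].
    rewrite Rmult_plus_distr_r Rinv_r; [|lra]. nra.
  - apply ex_series_scal_R, coord_square_summable; auto. }
assert (OmV : forall w, V w -> exists y, Om y = w).
{ intros w Hw; apply V_iff in Hw.
  assert (Hsq : ex_series (fun k => Cmod (w#k * RtoC (/ om k))%C ^ 2)).
  { apply ex_series_dominated with (fun k => (Cmod z + 1) * (m k * Cmod (w#k) ^ 2)).
    - intros k; split; [apply pow2_ge_0|].
      rewrite Cmod_mult Cmod_R Rpow_mult_distr pow2_abs pow_inv Hom2 Rinv_inv.
      assert (Hm : r k <= Cmod z + m k).
      { pose proof (Cmod_triangle z (- RtoC (m k))%C) as Ht.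
        rewrite Cmod_opp Cmod_R Rabs_pos_eq in Ht; [exact Ht|pose proof (m_ge_1 k); lra]. }
      pose proof (m_ge_1 k); pose proof (Cmod_ge_0 z); pose proof (pow2_ge_0 (Cmod (w#k))).
      rewrite Rmult_comm -Rmult_assoc; apply Rmult_le_compat_r; auto. nra.
    - now apply ex_series_scal_R. }
  destruct (riesz_fischer H e e_orthonormal _ Hsq) as [y Hy]; exists y.
  apply (coord_ext H e e_expansion); intros k. rewrite COm Hy.
  rewrite (Cmult_comm (w#k)) Cmult_assoc -RtoC_mult Rinv_r; [ring|apply Rgt_not_eq, Hom]. }
assert (HS := proj2 Hz). destruct HS as [Hex HS].
assert (HQ : forall x, 0 <= weight_norm (Om x) /\ weight_norm (Om x) ^ 2 <= Series (resolvent_sum z) * norm x ^ 2).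
{ intros x; split; [now apply weight_norm_nonneg|].
  assert (Eq : forall k, resolvent_sum z k = (v k * om k) ^ 2).
  { intros k; rewrite Rpow_mult_distr Hom2; reflexivity. }
  destruct (series_cauchy_schwarz (fun k => v k * om k) (fun k => Cmod (x#k))) as [_ CS].
  - intros k; apply Rmult_le_pos; apply Rlt_le; auto.
  - intros k; apply Cmod_ge_0.
  - now apply ex_series_ext_R with (1 := Eq).
  - apply coord_square_summable; auto.
  - rewrite (Series_coord_square H e e_expansion) -(Series_ext _ _ Eq) in CS.
    unfold weight_norm; erewrite Series_ext; [exact CS|].
    intros k; simpl; rewrite COm Cmod_mult Cmod_R Rabs_pos_eq; [ring|apply Rlt_le, Hom]. }
destruct (form_to_operator H e e_orthonormal e_expansion (2 / 3) (fun x y => b (Om x) (Om y)))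
  as [K [LK [EK NK]]]; [lra| |].
{ split.
  - intros; rewrite (linear_plus Om LOm); now apply b_plus_l.
  - intros; rewrite (linear_scal Om LOm); now apply b_scal_l.
  - intros; rewrite (linear_plus Om LOm); now apply b_plus_r.
  - intros; rewrite (linear_scal Om LOm); now apply b_scal_r.
  - intros x y; apply Rle_trans with (1 := b_bound _ _ (VOm x) (VOm y)).
    destruct (HQ x) as [X0 X1]; destruct (HQ y) as [Y0 Y1].
    pose proof (norm_ge_0 x) as Nx; pose proof (norm_ge_0 y) as Ny.
    assert (HS0 : 0 <= Series (resolvent_sum z)) by (apply Series_nonneg; auto; apply resolvent_sum_nonneg).
    apply Rle_trans with (Mb * Series (resolvent_sum z) * (norm x * norm y)).
    + rewrite !Rmult_assoc; apply Rmult_le_compat_l; [lra|].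
      assert (0 <= Series (resolvent_sum z) * (norm x * norm y)) by (repeat apply Rmult_le_pos; auto).
      apply Rsqr_incr_0_var; auto. rewrite !Rsqr_pow2.
      replace ((weight_norm (Om x) * weight_norm (Om y)) ^ 2)
        with (weight_norm (Om x) ^ 2 * weight_norm (Om y) ^ 2) by ring.
      replace ((Series (resolvent_sum z) * (norm x * norm y)) ^ 2)
        with ((Series (resolvent_sum z) * norm x ^ 2) * (Series (resolvent_sum z) * norm y ^ 2)) by ring.
      apply Rmult_le_compat; auto; apply pow2_ge_0.
    + rewrite (Rmult_assoc (2 / 3)); apply Rmult_le_compat_r; auto. now apply Rmult_le_pos. }
set (E := fun x => scal (RtoC (- s) : C_AbsRing) (Th (K x)) : H).
assert (LE : is_linear E).
{ assert (L1 := linear_compose H Th K LTh LK). destruct L1 as [P1 S1 [M1 [HM1 N1]]]. split.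
  - intros x y; unfold E; rewrite P1; apply inner_ext; intros w; rewrite inner_scal_l !inner_plus_l !inner_scal_l; ring.
  - intros c x; unfold E; rewrite S1; apply inner_ext; intros w; rewrite !inner_scal_l; ring.
  - exists M1; split; auto; intros x; unfold E. rewrite (norm_scal_eq H) Cmod_R Rabs_Ropp Rabs_pos_eq; [|lra].
    specialize (N1 x). pose proof (norm_ge_0 (Th (K x))). pose proof (norm_ge_0 x).
    change (s * norm (Th (K x)) <= M1 * norm x). nra. }
assert (NE : forall x, norm (E x) <= 2 / 3 * norm x).
{ intros x; unfold E; rewrite (norm_scal_eq H) Cmod_R Rabs_Ropp Rabs_pos_eq; [|lra].
  assert (N1 := diagonal_norm th 1 Hth (K x)). fold Th in N1. specialize (NK x).
  pose proof (norm_ge_0 (Th (K x))). pose proof (norm_ge_0 x). nra. }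
destruct (neumann H E (2 / 3) LE ltac:(lra) NE) as [W [_ [_ HW]]].
set (x := W (Th (Om f))). assert (Hx := HW (Th (Om f))). fold x in Hx.
exists (Om x); split; auto; intros w Hw.
destruct (OmV w Hw) as [y <-].
(* coordinates of x / th = Om f + s K x *)
assert (Hxk : forall k, (x#k / th k)%C = (RtoC (om k) * f#k + RtoC s * (K x)#k)%C).
{ intros k.
  assert (Hthk : th k <> 0).
  { unfold th; intros Et. assert (Ec : Cmod (RtoC (r k) / (z - RtoC (m k)))%C = 0) by (rewrite Et; apply Cmod_0).
    rewrite Cmod_div in Ec; auto. rewrite Cmod_R Rabs_pos_eq in Ec; [|apply Rlt_le, Hr].
    fold (r k) in Ec. unfold Rdiv in Ec; rewrite Rinv_r in Ec; [lra|apply Rgt_not_eq, Hr]. }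
  assert (Ek : inner (plus x (E x)) (e k) = (Th (Om f))#k) by now rewrite Hx.
  rewrite inner_plus_l in Ek; unfold E in Ek; rewrite inner_scal_l !CTh COm in Ek.
  rewrite RtoC_opp in Ek.
  replace (x#k) with ((x#k + - RtoC s * (th k * (K x)#k)) + RtoC s * (th k * (K x)#k))%C by ring.
  rewrite Ek; field; auto. }
rewrite -EK.
assert (S1 := is_series_scal (V := C_NormedModule) z _ _ (parseval_inner H e e_expansion (Om x) (Om y))).
assert (S2 := is_series_minus (V := C_NormedModule) _ _ _ _ S1 (a_series (Om x) (Om y) (VOm x) (VOm y))).
assert (S3 := is_series_scal (V := C_NormedModule) (RtoC s) _ _ (parseval_inner H e e_expansion (K x) y)).
assert (S4 := is_series_minus (V := C_NormedModule) _ _ _ _ S2 S3).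
apply (is_series_C_unique _ _ _ S4).
apply (is_series_ext (V := C_NormedModule)) with (2 := parseval_inner H e e_expansion f (Om y)).
intros k. rewrite !COm.
change ((f#k * Cconj (RtoC (om k) * y#k)) =
  z * (RtoC (om k) * x#k * Cconj (RtoC (om k) * y#k))
   - RtoC (m k) * (RtoC (om k) * x#k * Cconj (RtoC (om k) * y#k))
   - RtoC s * ((K x)#k * Cconj (y#k)))%C.
rewrite !Cmult_conj.
replace (Cconj (RtoC (om k))) with (RtoC (om k)) by (apply injective_projections; simpl; ring).
assert (Eom : (RtoC (om k) * RtoC (om k) * (z - RtoC (m k)) = / th k)%C).
{ rewrite -RtoC_mult. replace (om k * om k) with (/ r k) by (rewrite -Hom2; ring).
  unfold th. rewrite RtoC_inv; [|apply Rgt_not_eq, Hr].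
  field; split; auto. intros Er; injection Er; apply Rgt_not_eq, Hr. }
transitivity ((RtoC (om k) * RtoC (om k) * (z - RtoC (m k)) * x#k - RtoC s * (K x)#k) * Cconj (y#k))%C; [|ring].
rewrite Eom. replace (/ th k * x#k)%C with (x#k / th k)%C by (unfold Cdiv; ring). rewrite Hxk; ring.
Qed.

End ContractionPoint.

(** ** The resolvent family *)

Definition form_resolvent (s : R) (z : C) (f : H) : H :=
  epsilon (inhabits zero) (fun u => weak_solution s z u f).

Lemma form_resolvent_spec s z f : contraction_point z -> 0 <= s <= 1 -> weak_solution s z (form_resolvent s z f) f.
Proof. intros Hz Hs; exact (epsilon_spec (inhabits zero) _ (weak_exists z Hz s f Hs)). Qed.

Lemma form_resolvent_unique s z u f : contraction_point z -> 0 <= s <= 1 -> weak_solution s z u f ->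
  u = form_resolvent s z f.
Proof. intros Hz Hs Hu; apply (weak_unique z Hz s _ _ f Hs Hu); now apply form_resolvent_spec. Qed.

Lemma form_resolvent_linear s z : contraction_point z -> 0 <= s <= 1 -> is_linear (form_resolvent s z).
Proof.
intros Hz Hs.
assert (Hc : forall x y (c : C), form_resolvent s z (plus x (scal c y))
   = plus (form_resolvent s z x) (scal c (form_resolvent s z y))).
{ intros x y c; symmetry; apply form_resolvent_unique; auto.
  apply weak_combination; now apply form_resolvent_spec. }
assert (H1 : forall x : H, scal (RtoC 1 : C_AbsRing) x = x).
{ intros x; apply inner_ext; intros w; rewrite inner_scal_l; ring. }
assert (H0 : form_resolvent s z zero = zero).
{ assert (Z : plus zero (scal (- (1) : C_AbsRing)%C zero) = zero :> H).
  { apply inner_ext; intros w; rewrite inner_plus_l inner_scal_l !inner_zero_l; ring. }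
  pose proof (Hc zero zero (- (1))%C) as E. rewrite Z in E.
  rewrite E; apply inner_ext; intros w; rewrite inner_plus_l inner_scal_l inner_zero_l; ring. }
split.
- intros x y. specialize (Hc x y 1). now rewrite !H1 in Hc.
- intros c x. specialize (Hc zero x c).
  assert (Z : plus zero (scal c x) = scal c x :> H).
  { apply inner_ext; intros w; rewrite inner_plus_l inner_zero_l !inner_scal_l; ring. }
  rewrite Z H0 in Hc. rewrite Hc; apply inner_ext; intros w; rewrite inner_plus_l inner_zero_l !inner_scal_l; ring.
- exists 8; split; [lra|]; intros x. apply (weak_norm z Hz s); auto. now apply form_resolvent_spec.
Qed.

Lemma form_resolvent_bound s z f : contraction_point z -> 0 <= s <= 1 -> norm (form_resolvent s z f) <= 8 * norm f.
Proof. intros Hz Hs; apply (weak_norm z Hz s); auto; now apply form_resolvent_spec. Qed.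

Lemma form_resolvent_identity s z w f : 0 <= s <= 1 -> contraction_point z -> contraction_point w ->
  minus (form_resolvent s z f) (form_resolvent s w f)
  = scal (w - z : C_AbsRing)%C (form_resolvent s z (form_resolvent s w f)).
Proof.
intros Hs Hz Hw.
set (u := form_resolvent s w f).
assert (Hu := form_resolvent_spec s w f Hw Hs). fold u in Hu.
assert (E : u = form_resolvent s z (plus f (scal (z - w : C_AbsRing)%C u))).
{ apply form_resolvent_unique; auto. destruct Hu as [Vu Hu]; split; auto; intros y Hy.
  rewrite inner_plus_l inner_scal_l -Hu; auto. ring. }
assert (L := form_resolvent_linear s z Hz Hs).
rewrite (linear_plus _ L) (linear_scal _ L) in E.
apply inner_ext; intros y. rewrite inner_minus_l inner_scal_l.
rewrite {1}E inner_plus_l inner_scal_l; ring.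
Qed.

Lemma form_resolvent_0_coord z f k : contraction_point z ->
  inner (form_resolvent 0 z f) (e k) = (f#k * / (z - RtoC (m k)))%C.
Proof.
intros Hz. pose proof (weak_coord z 0 _ f k (form_resolvent_spec 0 z f Hz ltac:(lra))) as E.
assert (Hne : (z - RtoC (m k))%C <> 0) by now apply Cmod_gt_0, contraction_pos.
replace (f#k) with ((z - RtoC (m k)) * (form_resolvent 0 z f)#k)%C by (rewrite E; ring).
field; auto.
Qed.

(** Moving a base point by less than [1/8] multiplies each [|z - m_k|] by at least
    [3/4], so the sum stays below [2/3]: [near_base_contraction]. *)
Definition base_point (z : C) : Prop :=
  (forall k, 1 / 2 <= Cmod (z - RtoC (m k))%C) /\
  ex_series (resolvent_sum z) /\ Mb * Series (resolvent_sum z) <= 1 / 2.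

Definition near_base (z : C) : Prop := exists z0, base_point z0 /\ Cmod (z - z0)%C < 1 / 8.

Lemma near_base_contraction z : near_base z -> contraction_point z.
Proof.
intros [z0 [[H1 [H2 H3]] Hz]].
assert (Hd : forall k, 3 / 4 * Cmod (z0 - RtoC (m k))%C <= Cmod (z - RtoC (m k))%C).
{ intros k; specialize (H1 k).
  pose proof (Cmod_triangle (z - RtoC (m k))%C (- (z - z0))%C) as Ht.
  replace (z - RtoC (m k) + - (z - z0))%C with (z0 - RtoC (m k))%C in Ht by ring.
  rewrite Cmod_opp in Ht; lra. }
assert (Hr : forall k, 0 <= resolvent_sum z k <= 4 / 3 * resolvent_sum z0 k).
{ intros k; specialize (H1 k); specialize (Hd k); unfold resolvent_sum, Rdiv.
  pose proof (pow2_ge_0 (v k)). split.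
  - apply Rmult_le_pos; auto. apply Rlt_le, Rinv_0_lt_compat; lra.
  - replace (4 * / 3 * (v k ^ 2 * / Cmod (z0 - RtoC (m k))%C))
      with (v k ^ 2 * / (3 / 4 * Cmod (z0 - RtoC (m k))%C)) by (field; lra).
    apply Rmult_le_compat_l; auto. apply Rinv_le_contravar; lra. }
split; [|split].
- intros k; specialize (H1 k); specialize (Hd k); lra.
- apply ex_series_dominated with (1 := Hr); now apply ex_series_scal_R.
- assert (Series (resolvent_sum z) <= 4 / 3 * Series (resolvent_sum z0)).
  { rewrite -Series_scal_l; apply Series_le; auto; now apply ex_series_scal_R. }
  nra.
Qed.

Lemma near_base_open z : near_base z ->
  exists del, 0 < del /\ forall w, Cmod (w - z)%C < del -> near_base w.
Proof.
intros [z0 [H0 Hz]]; exists (1 / 8 - Cmod (z - z0)%C); split; [lra|]; intros w Hw.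
exists z0; split; auto.
pose proof (Cmod_triangle (w - z)%C (z - z0)%C) as Ht.
replace (w - z + (z - z0))%C with (w - z0)%C in Ht by ring. lra.
Qed.

Lemma base_near z : base_point z -> near_base z.
Proof. intros Hz; exists z; split; auto. replace (z - z)%C with (RtoC 0) by ring. rewrite Cmod_0; lra. Qed.

(** ** The contours *)

Variables (N : nat) (h : R).
Hypothesis m_gap : forall k, 1 <= m (S k) - m k.
Hypothesis h_gt1 : 1 < h.

Definition outer_contour (i : nat) : list path :=
  match i with
  | O => rectangle (- h) (m N + 1 / 2) (- h) h
  | S i => circle (RtoC (m (N + 1 + i)%nat)) (1 / 2) :: nil
  end.

(** The discs of two eigenvalues at distance 1 touch; shrinking the contours, which
    changes no integral, separates them and also nests each one in its original. *)
Definition inner_contour (i : nat) : list path :=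
  match i with
  | O => rectangle (- h + 1 / 20) (m N + 1 / 2 - 1 / 20) (- h + 1 / 20) (h - 1 / 20)
  | S i => circle (RtoC (m (N + 1 + i)%nat)) (7 / 16) :: nil
  end.

Hypothesis outer_base : forall i z, on_contour (outer_contour i) z -> base_point z.

Lemma m_separated j k : (j < k)%nat -> 1 <= m k - m j.
Proof.
intros Hjk; induction Hjk as [|k Hk IH]; [apply m_gap|]. specialize (m_gap k); lra.
Qed.

Lemma rectangle_points x1 x2 y1 y2 z : x1 <= x2 -> y1 <= y2 -> on_contour (rectangle x1 x2 y1 y2) z ->
  x1 <= Re z <= x2 /\ y1 <= Im z <= y2 /\ (Re z = x1 \/ Re z = x2 \/ Im z = y1 \/ Im z = y2).
Proof.
intros Hx Hy [p [t [Hp [Ht ->]]]].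
destruct Hp as [<-|[<-|[<-|[<-|[]]]]]; simpl in Ht; unfold Re, Im; simpl;
  (split; [nra|split; [nra|]]).
- right; right; left; ring.
- right; left; ring.
- right; right; right; ring.
- left; ring.
Qed.

Lemma circle_points c r z : 0 <= r -> on_contour (circle c r :: nil) z -> Cmod (z - c)%C = r.
Proof.
intros Hr [p [t [[<-|[]] [Ht ->]]]]; simpl.
replace (c + polar r (0 + 1 * t) - c)%C with (polar r (0 + 1 * t)) by ring.
rewrite Cmod_polar; now apply Rabs_pos_eq.
Qed.

Lemma homotopy_near (i : nat) (p q : path) : In p (outer_contour i) ->
  (forall y, lo p <= y <= hi p -> Cmod (at_time q y - at_time p y)%C <= 1 / 10) ->
  forall x y, 0 <= x <= 1 -> lo p <= y <= hi p ->
  near_base (at_time p y + RtoC x * (at_time q y - at_time p y))%C.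
Proof.
intros Hp Hd x y Hx Hy; exists (at_time p y); split.
- apply (outer_base i); now exists p, y.
- replace (at_time p y + RtoC x * (at_time q y - at_time p y) - at_time p y)%C
    with (RtoC x * (at_time q y - at_time p y))%C by ring.
  rewrite Cmod_mult Cmod_R Rabs_pos_eq; [|lra]. specialize (Hd y Hy).
  pose proof (Cmod_ge_0 (at_time q y - at_time p y)%C). nra.
Qed.

Lemma segments_close (p q p' q' : C) t : 0 <= t <= 1 ->
  Rabs (Re (p' - p)%C) <= 1 / 20 -> Rabs (Im (p' - p)%C) <= 1 / 20 ->
  Rabs (Re (q' - q)%C) <= 1 / 20 -> Rabs (Im (q' - q)%C) <= 1 / 20 ->
  Cmod (at_time (segment p' q') t - at_time (segment p q) t)%C <= 1 / 10.
Proof.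
intros Ht H1 H2 H3 H4; apply Rle_trans with (1 := Cmod_le_Re_Im _); cbn [at_time segment].
apply Rabs_le_between in H1; apply Rabs_le_between in H2;
apply Rabs_le_between in H3; apply Rabs_le_between in H4.
assert (Rabs (Re (p' + RtoC t * (q' - p') - (p + RtoC t * (q - p)))%C) <= 1 / 20).
{ replace (Re _) with ((1 - t) * Re (p' - p)%C + t * Re (q' - q)%C) by (unfold Re; simpl; ring).
  apply Rabs_le; nra. }
assert (Rabs (Im (p' + RtoC t * (q' - p') - (p + RtoC t * (q - p)))%C) <= 1 / 20).
{ replace (Im _) with ((1 - t) * Im (p' - p)%C + t * Im (q' - q)%C) by (unfold Im; simpl; ring).
  apply Rabs_le; nra. }
lra.
Qed.

Lemma contour_pairs (i : nat) (p q : path) :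
  In (p, q) (combine (outer_contour i) (inner_contour i)) ->
  lo q = lo p /\ hi q = hi p /\ In p (outer_contour i) /\
  (forall y, lo p <= y <= hi p -> Cmod (at_time q y - at_time p y)%C <= 1 / 10).
Proof.
intros Hin; assert (Hp := in_combine_l _ _ _ _ Hin).
destruct i as [|i].
- destruct Hin as [E|[E|[E|[E|[]]]]]; apply pair_equal_spec in E; destruct E as [<- <-];
    (do 2 (split; [reflexivity|]); split; [exact Hp|]; intros y Hy; apply segments_close; auto;
     unfold Re, Im; simpl; apply Rabs_le; lra).
- destruct Hin as [E|[]]; apply pair_equal_spec in E; destruct E as [<- <-].
  do 2 (split; [reflexivity|]); split; [exact Hp|]; intros y Hy; simpl.
  match goal with |- Cmod ?z <= _ => replace z with (polar (- (1 / 16)) (0 + 1 * y))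
    by (apply injective_projections; unfold polar; simpl; field) end.
  rewrite Cmod_polar Rabs_Ropp Rabs_pos_eq; lra.
Qed.

Lemma inner_near i z : on_contour (inner_contour i) z -> near_base z.
Proof.
intros [q [t [Hq [Ht ->]]]].
assert (Hp : exists p, In (p, q) (combine (outer_contour i) (inner_contour i))).
{ destruct i as [|i]; simpl in *.
  - destruct Hq as [<-|[<-|[<-|[<-|[]]]]]; eexists; eauto 6.
  - destruct Hq as [<-|[]]; eexists; eauto. }
destruct Hp as [p Hpq]; destruct (contour_pairs i p q Hpq) as [El [Eh [Hp Hd]]].
rewrite El Eh in Ht.
pose proof (homotopy_near i p q Hp Hd 1 t ltac:(lra) Ht) as Hn.
replace (at_time q t) with (at_time p t + RtoC 1 * (at_time q t - at_time p t))%C by ring. exact Hn.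
Qed.

Lemma outer_near i z : on_contour (outer_contour i) z -> near_base z.
Proof. intros Hz; apply base_near; now apply (outer_base i). Qed.

Lemma contour_int_inner (phi phi' : C -> C) i :
  (forall z, near_base z -> holomorphic_at phi phi' z) ->
  contour_int phi (inner_contour i) = contour_int phi (outer_contour i).
Proof.
intros Hphi.
assert (Hh : forall p q, In (p, q) (combine (outer_contour i) (inner_contour i)) ->
  forall x y, 0 <= x <= 1 -> lo p <= y <= hi p ->
  holomorphic_at phi phi' (at_time p y + RtoC x * (at_time q y - at_time p y))%C).
{ intros p q Hpq x y Hx Hy; destruct (contour_pairs i p q Hpq) as [_ [_ [Hp Hd]]].
  apply Hphi; now apply (homotopy_near i). }
destruct i as [|i].
- apply homotopy_quadrilateral with phi'; try (simpl; apply injective_projections; simpl; ring).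
  intros p q Hpq; assert (Hpq2 := Hh p q Hpq).
  destruct Hpq as [E|[E|[E|[E|[]]]]]; apply pair_equal_spec in E; destruct E as [<- <-];
    (do 4 (split; [reflexivity|]); exact Hpq2).
- simpl; f_equal. apply homotopy_closed with phi'; auto; try apply circle_closed.
  apply Hh; simpl; auto.
Qed.

(** ** The projections *)

Definition form_projection (i : nat) (s : R) (f : H) : H :=
  scal (/ two_pi_i : C_AbsRing)%C
    (match i with
     | O => rectangle_integral (- h) (m N + 1 / 2) (- h) h (fun z => form_resolvent s z f)
     | S i => circle_integral (RtoC (m (N + 1 + i)%nat)) (1 / 2) (fun z => form_resolvent s z f)
     end).

Section Coupling.

Variable s : R.
Hypothesis Hs : 0 <= s <= 1.

Let resolvent_linear z (Hz : near_base z) := form_resolvent_linear s z (near_base_contraction z Hz) Hs.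
Let resolvent_bound z f (Hz : near_base z) := form_resolvent_bound s z f (near_base_contraction z Hz) Hs.
Let resolvent_identity z w f (Hz : near_base z) (Hw : near_base w) :=
  form_resolvent_identity s z w f Hs (near_base_contraction z Hz) (near_base_contraction w Hw).

Lemma form_resolvent_holomorphic z f y : near_base z ->
  holomorphic_at (fun w => inner (form_resolvent s w f) y)
    (fun w => - inner (form_resolvent s w (form_resolvent s w f)) y)%C z.
Proof.
exact (resolvent_holomorphic H (form_resolvent s) near_base 8 near_base_open
  resolvent_linear resolvent_bound resolvent_identity z f y).
Qed.

Lemma form_resolvent_continuous z f : near_base z -> continuous_atH H (fun w => form_resolvent s w f) z.
Proof.
exact (continuous_atH_resolvent H (form_resolvent s) near_base 8 near_base_open
  resolvent_bound resolvent_identity z f).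
Qed.

Lemma form_projection_outer i : riesz_integral H (form_resolvent s) (outer_contour i) (form_projection i s).
Proof.
intros f y; unfold form_projection; rewrite inner_scal_l; f_equal.
destruct i as [|i].
- apply inner_rectangle_integral; intros z Hz. apply form_resolvent_continuous. now apply (outer_near 0).
- apply inner_circle_integral; intros z Hz. apply form_resolvent_continuous. now apply (outer_near (S i)).
Qed.

Lemma form_projection_inner i : riesz_integral H (form_resolvent s) (inner_contour i) (form_projection i s).
Proof.
intros f y; rewrite form_projection_outer; f_equal. symmetry.
apply contour_int_inner with (fun w => - inner (form_resolvent s w (form_resolvent s w f)) y)%C.
intros z Hz; now apply form_resolvent_holomorphic.
Qed.

Lemma form_projection_linear i : is_linear (form_projection i s).
Proof.
apply (riesz_integral_linear H (form_resolvent s) near_base 8 near_base_open resolvent_linear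
  resolvent_bound resolvent_identity (outer_contour i)); [apply outer_near|apply form_projection_outer].
Qed.

Lemma Re_le_Cmod_dist (z w : C) : Rabs (Re z - Re w) <= Cmod (z - w)%C.
Proof. apply (re_le_Cmod (z - w)%C). Qed.

Lemma Im_le_Cmod_dist (z w : C) : Rabs (Im z - Im w) <= Cmod (z - w)%C.
Proof. apply (im_le_Cmod (z - w)%C). Qed.

Lemma m_N_pos : 1 <= m N.
Proof. apply m_ge_1. Qed.

Lemma form_projection_idempotent i f : form_projection i s (form_projection i s f) = form_projection i s f.
Proof.
assert (HmN := m_N_pos).
rewrite (riesz_integral_product H e e_orthonormal e_expansion (form_resolvent s) near_base 8
  near_base_open resolvent_linear resolvent_bound resolvent_identity
  (inner_contour i) (outer_contour i) (form_projection i s) (form_projection i s) 1 (1 / 20)).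
- apply inner_ext; intros w; rewrite inner_scal_l; ring.
- apply inner_near.
- apply outer_near.
- lra.
- intros z w Hz Hw; destruct i as [|i]; simpl in Hz, Hw.
  + apply rectangle_points in Hz; try lra. apply rectangle_points in Hw; try lra.
    destruct Hz as [Z1 [Z2 _]]; destruct Hw as [W1 [W2 W3]].
    pose proof (Re_le_Cmod_dist w z) as D1; pose proof (Im_le_Cmod_dist w z) as D2.
    destruct W3 as [W3|[W3|[W3|W3]]].
    * apply Rle_trans with (2 := D1); rewrite Rabs_left1; lra.
    * apply Rle_trans with (2 := D1); rewrite Rabs_pos_eq; lra.
    * apply Rle_trans with (2 := D2); rewrite Rabs_left1; lra.
    * apply Rle_trans with (2 := D2); rewrite Rabs_pos_eq; lra.
  + apply circle_points in Hz; [|lra]. apply circle_points in Hw; [|lra].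
    set (c := RtoC (m (N + 1 + i)%nat)) in *.
    pose proof (Cmod_triangle (w - z)%C (z - c)%C) as Ht.
    replace (w - z + (z - c))%C with (w - c)%C in Ht by ring. lra.
- intros z Hz; rewrite Cmult_1_l; destruct i as [|i].
  + apply winding_rectangle_inside; apply rectangle_points in Hz; lra.
  + apply circle_points in Hz; [|lra]. simpl. rewrite Cplus_0_r; apply winding_circle_inside; lra.
- intros w Hw; destruct i as [|i].
  + apply winding_rectangle_outside; try lra; apply rectangle_points in Hw; lra.
  + apply circle_points in Hw; [|lra]. simpl. rewrite Cplus_0_r; apply winding_circle_outside; lra.
- apply form_projection_inner.
- apply form_projection_outer.
Qed.

Lemma inner_contours_separated i j z w : i <> j ->
  on_contour (inner_contour i) z -> on_contour (inner_contour j) w -> 1 / 20 <= Cmod (w - z)%C.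
Proof.
assert (HmN := m_N_pos).
assert (Hcc : forall i j z w, (i < j)%nat ->
  on_contour (inner_contour i) z -> on_contour (inner_contour j) w -> 1 / 20 <= Cmod (w - z)%C).
{ clear i j z w; intros i j z w Hij Hz Hw; destruct j as [|j]; [lia|].
  apply circle_points in Hw; [|lra].
  set (c := RtoC (m (N + 1 + j)%nat)) in *.
  destruct i as [|i]; simpl in Hz.
  - apply rectangle_points in Hz; try lra. destruct Hz as [Z1 _].
    pose proof (m_separated N (N + 1 + j) ltac:(lia)).
    pose proof (Re_le_Cmod_dist c z) as D1. change (Re c) with (m (N + 1 + j)%nat) in D1.
    rewrite Rabs_pos_eq in D1; [|lra].
    pose proof (Cmod_triangle (w - z)%C (- (w - c))%C) as Ht.
    replace (w - z + - (w - c))%C with (c - z)%C in Ht by ring. rewrite Cmod_opp in Ht. lra.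
  - apply circle_points in Hz; [|lra].
    pose proof (m_separated (N + 1 + i) (N + 1 + j) ltac:(lia)).
    set (c' := RtoC (m (N + 1 + i)%nat)) in *.
    assert (D : 1 <= Cmod (c - c')%C).
    { apply Rle_trans with (2 := Re_le_Cmod_dist c c'). unfold c, c', Re; simpl. rewrite Rabs_pos_eq; lra. }
    pose proof (Cmod_triangle (w - z)%C (- (w - c) + (z - c'))%C) as Ht.
    pose proof (Cmod_triangle (- (w - c))%C (z - c')%C) as Ht2.
    replace (w - z + (- (w - c) + (z - c')))%C with (c - c')%C in Ht by ring.
    rewrite Cmod_opp in Ht2. lra. }
intros Hij Hz Hw; destruct (Nat.lt_total i j) as [Hlt|[Heq|Hgt]]; [now apply (Hcc i j)|lia|].
replace (w - z)%C with (- (z - w))%C by ring; rewrite Cmod_opp. now apply (Hcc j i).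
Qed.

Lemma inner_contours_winding i j z : i <> j -> on_contour (inner_contour i) z ->
  contour_int (fun w => / (w - z))%C (inner_contour j) = 0.
Proof.
assert (HmN := m_N_pos). intros Hij Hz; destruct j as [|j]; simpl.
- destruct i as [|i]; [lia|]. apply circle_points in Hz; [|lra].
  apply winding_rectangle_outside; try lra. right; left.
  pose proof (m_separated N (N + 1 + i) ltac:(lia)).
  pose proof (Re_le_Cmod_dist z (RtoC (m (N + 1 + i)%nat))) as D.
  apply Rabs_le_between in D; change (Re (RtoC (m (N + 1 + i)%nat))) with (m (N + 1 + i)%nat) in D. lra.
- rewrite Cplus_0_r. apply winding_circle_outside; [lra|].
  set (c := RtoC (m (N + 1 + j)%nat)).
  pose proof (Re_le_Cmod_dist z c) as D. change (Re c) with (m (N + 1 + j)%nat) in D.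
  destruct i as [|i].
  + simpl in Hz; apply rectangle_points in Hz; try lra.
    pose proof (m_separated N (N + 1 + j) ltac:(lia)).
    apply Rlt_le_trans with (2 := D). rewrite Rabs_left1; lra.
  + apply circle_points in Hz; [|lra]. set (c' := RtoC (m (N + 1 + i)%nat)) in *.
    assert (D2 : 1 <= Cmod (c' - c)%C).
    { apply Rle_trans with (2 := Re_le_Cmod_dist c' c). unfold c, c', Re; simpl.
      destruct (Nat.lt_total i j) as [Hlt|[Heq|Hgt]]; [|lia|].
      - pose proof (m_separated (N + 1 + i) (N + 1 + j) ltac:(lia)). rewrite Rabs_left1; lra.
      - pose proof (m_separated (N + 1 + j) (N + 1 + i) ltac:(lia)). rewrite Rabs_pos_eq; lra. }
    pose proof (Cmod_triangle (z - c)%C (- (z - c'))%C) as Ht.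
    replace (z - c + - (z - c'))%C with (c' - c)%C in Ht by ring. rewrite Cmod_opp in Ht. lra.
Qed.

Lemma form_projection_orthogonal i j f : i <> j -> form_projection i s (form_projection j s f) = zero.
Proof.
intros Hij.
rewrite (riesz_integral_product H e e_orthonormal e_expansion (form_resolvent s) near_base 8
  near_base_open resolvent_linear resolvent_bound resolvent_identity
  (inner_contour i) (inner_contour j) (form_projection i s) (form_projection j s) 0 (1 / 20)).
- apply inner_ext; intros w; rewrite inner_scal_l inner_zero_l; ring.
- apply inner_near.
- apply inner_near.
- lra.
- intros z w Hz Hw; now apply (inner_contours_separated i j).
- intros z Hz; rewrite Cmult_0_l; now apply (inner_contours_winding i j).
- intros w Hw; apply (inner_contours_winding j i); auto.
- apply form_projection_inner.
- apply form_projection_inner.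
Qed.

End Coupling.

(** ** The unperturbed projections *)

Lemma form_projection_0_coord i f k :
  inner (form_projection i 0 f) (e k) = if Nat.eq_dec (k - N) i then f#k else RtoC 0.
Proof.
assert (HmN := m_N_pos). assert (Hs : 0 <= 0 <= 1) by lra.
rewrite (form_projection_outer 0 Hs i).
assert (Hne : forall z, on_contour (outer_contour i) z -> RtoC (m k) <> z).
{ intros z Hz E; destruct (outer_base i z Hz) as [Hb _]; specialize (Hb k); rewrite -E in Hb.
  replace (RtoC (m k) - RtoC (m k))%C with (RtoC 0) in Hb by ring; rewrite Cmod_0 in Hb; lra. }
assert (Hw : contour_int (fun z => / (z - RtoC (m k)))%C (outer_contour i)
  = if Nat.eq_dec (k - N) i then two_pi_i else RtoC 0).
{ destruct i as [|i]; simpl outer_contour.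
  - destruct (Nat.eq_dec (k - N) 0).
    + assert (m k <= m N).
      { destruct (Nat.eq_dec k N) as [->|]; [lra|]. pose proof (m_separated k N ltac:(lia)); lra. }
      pose proof (m_ge_1 k). apply winding_rectangle_inside; unfold Re, Im; simpl; lra.
    + pose proof (m_separated N k ltac:(lia)).
      apply winding_rectangle_outside; try lra. right; left; unfold Re; simpl; lra.
  - simpl contour_int; rewrite Cplus_0_r. destruct (Nat.eq_dec (k - N) (S i)).
    + replace (N + 1 + i)%nat with k by lia. apply winding_circle_inside.
      replace (RtoC (m k) - RtoC (m k))%C with (RtoC 0) by ring; rewrite Cmod_0; lra.
    + apply winding_circle_outside; [lra|].
      set (c := RtoC (m (N + 1 + i)%nat)). apply Rlt_le_trans with (2 := Re_le_Cmod_dist (RtoC (m k)) c).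
      unfold c, Re; simpl. destruct (Nat.lt_total k (N + 1 + i)) as [Hlt|[Heq|Hgt]]; [|lia|].
      * pose proof (m_separated k (N + 1 + i) Hlt). rewrite Rabs_left1; lra.
      * pose proof (m_separated (N + 1 + i) k Hgt). rewrite Rabs_pos_eq; lra. }
rewrite (contour_int_ext _ (fun z => f#k * / (z - RtoC (m k)))%C).
2: { intros z Hz; apply form_resolvent_0_coord, near_base_contraction. now apply (outer_near i). }
rewrite contour_int_mult_l.
2: { intros z Hz; apply continuous_atC_inv_shift; auto. }
rewrite Hw. destruct (Nat.eq_dec (k - N) i); [|ring]. field; apply two_pi_i_neq_0.
Qed.

Lemma is_series_C_finite (u : nat -> C) K : (forall k, (K < k)%nat -> u k = 0) ->
  is_series (V := C_NormedModule) u (sum_n u K).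
Proof.
intros Hu; apply is_series_C; intros eps; exists K; intros n Hn.
assert (E : sum_n u n = sum_n u K).
{ induction n as [|n IH]; [now replace K with 0%nat by lia|].
  destruct (Nat.eq_dec K (S n)) as [->|]; auto.
  rewrite sum_Sn IH; [|lia]. rewrite Hu; [|lia]. apply Cplus_0_r. }
rewrite E. replace (sum_n u K - sum_n u K)%C with (RtoC 0); [rewrite Cmod_0; apply cond_pos|].
apply injective_projections; simpl; ring.
Qed.

(** The blocks of coordinates [0..N], [N + 1], [N + 2], ... follow one another. *)
Lemma form_projection_0_partial_sum f g n :
  sum_n (fun i => inner (form_projection i 0 f) g) n
  = sum_n (fun k => f#k * Cconj (g#k))%C (N + n).
Proof.
assert (Hhead : inner (form_projection 0 0 f) g = sum_n (fun k => f#k * Cconj (g#k))%C N).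
{ apply is_series_C_unique with (1 := parseval_inner H e e_expansion (form_projection 0 0 f) g).
  rewrite (sum_n_ext_loc _ (fun k => inner (form_projection 0 0 f) (e k) * Cconj (g#k))%C).
  - apply is_series_C_finite; intros k Hk. rewrite form_projection_0_coord.
    destruct (Nat.eq_dec (k - N) 0); [lia|ring].
  - intros k Hk; rewrite form_projection_0_coord. now destruct (Nat.eq_dec (k - N) 0); [|lia]. }
assert (Htail : forall i, inner (form_projection (S i) 0 f) g = (f#(S (N + i)) * Cconj (g#(S (N + i))))%C).
{ intros i; apply is_series_C_unique with (1 := parseval_inner H e e_expansion (form_projection (S i) 0 f) g).
  apply is_series_C_single with (S (N + i)); intros k. rewrite form_projection_0_coord.
  destruct (Nat.eq_dec (k - N) (S i)), (Nat.eq_dec k (S (N + i))); try lia; [now subst|ring]. }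
induction n as [|n IH].
- rewrite sum_O Nat.add_0_r; exact Hhead.
- rewrite Nat.add_succ_r !sum_Sn IH Htail; reflexivity.
Qed.

Lemma form_projection_0_complete f g :
  is_series (V := C_NormedModule) (fun i => inner (form_projection i 0 f) g) (inner f g).
Proof.
apply is_series_C; intros eps.
destruct (proj1 (is_series_C _ _) (parseval_inner H e e_expansion f g) eps) as [K HK].
exists K; intros n Hn. rewrite form_projection_0_partial_sum. apply HK; lia.
Qed.

Lemma form_projection_0_norm i f : RtoC (norm (form_projection i 0 f) ^ 2) = inner (form_projection i 0 f) f.
Proof.
rewrite -inner_norm.
apply is_series_C_unique with (1 := parseval_inner H e e_expansion _ _).
apply (is_series_ext (V := C_NormedModule)) with (2 := parseval_inner H e e_expansion (form_projection i 0 f) f).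
intros k; rewrite form_projection_0_coord. destruct (Nat.eq_dec (k - N) i); auto.
apply injective_projections; simpl; ring.
Qed.

Lemma form_projection_0_square_sum f n : sum_n (fun i => norm (form_projection i 0 f) ^ 2) n <= norm f ^ 2.
Proof.
rewrite (sum_n_ext _ (fun i => Re (inner (form_projection i 0 f) f))).
2: { intros i; rewrite -form_projection_0_norm; reflexivity. }
rewrite -Re_sum_n form_projection_0_partial_sum Re_sum_n.
rewrite (sum_n_ext _ (fun k => Cmod (f#k) ^ 2)).
2: { intros k; rewrite -Cmod2_conj; reflexivity. }
rewrite -(Series_coord_square H e e_expansion).
apply (sum_n_le_Series (fun k => Cmod (f#k) ^ 2)); [intros; apply pow2_ge_0|].
apply coord_square_summable; auto.
Qed.

Lemma form_projection_0_symmetric i f g : inner (form_projection i 0 f) g = inner f (form_projection i 0 g).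
Proof.
apply is_series_C_unique with (1 := parseval_inner H e e_expansion _ _).
apply (is_series_ext (V := C_NormedModule)) with (2 := parseval_inner H e e_expansion f (form_projection i 0 g)).
intros k; rewrite !form_projection_0_coord. destruct (Nat.eq_dec (k - N) i); auto.
apply injective_projections; simpl; ring.
Qed.

Lemma form_projection_0_series f : is_series (fun i => form_projection i 0 f) f.
Proof.
apply is_series_norm; intros eps.
destruct (proj1 (is_series_norm _ _) (e_expansion f) eps) as [K HK].
exists K; intros n Hn.
assert (E : sum_n (fun i => form_projection i 0 f) n = sum_n (fun k => scal (f#k) (e k)) (N + n) :> H).
{ apply inner_ext; intros g. rewrite !inner_sum_n form_projection_0_partial_sum.
  apply sum_n_ext; intros k. now rewrite inner_scal_l (inner_conj _ g (e k)). }
rewrite E. apply HK; lia.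
Qed.

(** ** Dependence of the projections on the coupling *)

Variable al : R.
Hypothesis al_range : 0 < al <= 1 / 4.
Hypothesis v_le_weight : forall k, v k <= weight al k.

Lemma form_projection_lipschitz i s s' f g X : 0 <= s <= 1 -> 0 <= s' <= 1 -> 
  (forall z, on_contour (outer_contour i) z -> 9 * Mb * dual_norm z f * dual_norm z g <= X) ->
  Cmod (inner (minus (form_projection i s f) (form_projection i s' f)) g)
  <= Rabs (s - s') * (Cmod (/ two_pi_i)%C * contour_length (outer_contour i) * X).
Proof.
intros Hs Hs' HX.
assert (Hc : forall s, 0 <= s <= 1 ->
  continuous_on_contour (fun z => inner (form_resolvent s z f) g) (outer_contour i)).
{ intros r Hr z Hz. apply (derivative_C_continuous _ _ _
    (proj1 (form_resolvent_holomorphic r Hr z f g (outer_near i z Hz)))). }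
rewrite inner_minus_l (form_projection_outer s Hs) (form_projection_outer s' Hs').
replace (/ two_pi_i * contour_int (fun z => inner (form_resolvent s z f) g) (outer_contour i) -
  / two_pi_i * contour_int (fun z => inner (form_resolvent s' z f) g) (outer_contour i))%C
  with (/ two_pi_i * (contour_int (fun z => inner (form_resolvent s z f) g) (outer_contour i) -
    contour_int (fun z => inner (form_resolvent s' z f) g) (outer_contour i)))%C by ring.
rewrite -contour_int_minus; auto.
rewrite Cmod_mult.
replace (Rabs (s - s') * (Cmod (/ two_pi_i)%C * contour_length (outer_contour i) * X))
  with (Cmod (/ two_pi_i)%C * (contour_length (outer_contour i) * (Rabs (s - s') * X))) by ring.
apply Rmult_le_compat_l; [apply Cmod_ge_0|].
apply contour_int_bound.
- intros z Hz; apply continuous_atC_minus; now apply Hc.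
- intros z Hz; rewrite -inner_minus_l. assert (Hg := near_base_contraction z (outer_near i z Hz)).
  apply Rle_trans with (1 := weak_difference z Hg s s' _ _ f g Hs Hs'
    (form_resolvent_spec s z f Hg Hs) (form_resolvent_spec s' z f Hg Hs')).
  specialize (HX z Hz). pose proof (Rabs_pos (s - s')).
  replace (9 * Mb * Rabs (s - s') * dual_norm z f * dual_norm z g)
    with (Rabs (s - s') * (9 * Mb * dual_norm z f * dual_norm z g)) by ring.
  now apply Rmult_le_compat_l.
Qed.

Lemma m_growth j k : index_dist j k <= Rabs (m j - m k).
Proof.
assert (Hjk : forall j k, (j <= k)%nat -> INR k - INR j <= m k - m j).
{ clear j k; intros j k Hjk; induction Hjk as [|k Hk IH]; [lra|].
  rewrite S_INR. specialize (m_gap k); lra. }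
unfold index_dist. destruct (Nat.le_ge_cases j k) as [Hle|Hge].
- specialize (Hjk j k Hle). apply le_INR in Hle. rewrite !Rabs_left1; lra.
- specialize (Hjk k j Hge). apply le_INR in Hge. rewrite !Rabs_pos_eq; lra.
Qed.

Definition coord_abs (f : H) : nat -> R := fun k => Cmod (f#k).

Lemma dual_norm_circle i z f : on_contour (outer_contour (S i)) z ->
  dual_norm z f <= 4 * kernel_sum al (coord_abs f) (N + 1 + i).
Proof.
intros Hz. set (n := (N + 1 + i)%nat).
destruct (kernel_sum_summable al al_range (coord_abs f) (fun k => Cmod_ge_0 _)
  (coord_square_summable H e e_expansion f) n) as [Hex _].
unfold kernel_sum; rewrite -Series_scal_l. apply Series_le; [|now apply ex_series_scal_R].
assert (Hb := proj1 (outer_base (S i) z Hz)).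
apply circle_points in Hz; [|lra]. fold n in Hz.
intros k; specialize (Hb k); pose proof (v_pos k); pose proof (v_le_weight k); pose proof (Cmod_ge_0 (f#k)).
pose proof (index_dist_nonneg n k) as Hd.
assert (Hdist : (1 + index_dist n k) / 4 <= Cmod (z - RtoC (m k))%C).
{ destruct (Nat.eq_dec n k) as [<-|Hne].
  - unfold index_dist in *; rewrite Rminus_diag Rabs_R0; lra.
  - assert (Hd1 : 1 <= index_dist n k).
    { unfold index_dist. destruct (Nat.lt_total n k) as [Hlt|[Heq|Hgt]]; [|lia|].
      - apply le_INR in Hlt; rewrite S_INR in Hlt. rewrite Rabs_left1; lra.
      - apply le_INR in Hgt; rewrite S_INR in Hgt. rewrite Rabs_pos_eq; lra. }
    pose proof (m_growth n k) as Hg.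
    pose proof (Re_le_Cmod_dist (RtoC (m n)) (RtoC (m k))) as D. change (Rabs (m n - m k) <= Cmod (RtoC (m n) - RtoC (m k))%C) in D.
    pose proof (Cmod_triangle (z - RtoC (m k))%C (- (z - RtoC (m n)))%C) as Ht.
    replace (z - RtoC (m k) + - (z - RtoC (m n)))%C with (RtoC (m n) - RtoC (m k))%C in Ht by ring.
    rewrite Cmod_opp in Ht. lra. }
split.
- apply Rmult_le_pos; [apply Rmult_le_pos; lra|]. apply Rlt_le, Rinv_0_lt_compat; lra.
- unfold coord_abs, Rdiv.
  replace (4 * (weight al k * Cmod (f#k) * / (1 + index_dist n k)))
    with (weight al k * Cmod (f#k) * / ((1 + index_dist n k) / 4)) by (field; lra).
  apply Rmult_le_compat.
  + apply Rmult_le_pos; lra.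
  + apply Rlt_le, Rinv_0_lt_compat; lra.
  + apply Rmult_le_compat_r; lra.
  + apply Rinv_le_contravar; lra.
Qed.

Lemma sum_n_head (u : nat -> R) n : (forall k, 0 <= u k) -> sum_n u n <= u 0%nat + sum_n (fun i => u (S i)) n.
Proof.
intros Hu; induction n as [|n IH].
- rewrite !sum_O. specialize (Hu 1%nat); lra.
- rewrite !sum_Sn; change plus with Rplus.
  assert (E : sum_n u n + u (S n) = u 0%nat + sum_n (fun i => u (S i)) n).
  { clear; induction n as [|n IH]; [rewrite !sum_O; lra|]. rewrite !sum_Sn; change plus with Rplus.
    rewrite IH; ring. }
  rewrite E. specialize (Hu (S (S n))); lra.
Qed.

Lemma sum_n_drop (u : nat -> R) p n : (forall k, 0 <= u k) -> sum_n (fun i => u (p + i)%nat) n <= sum_n u (p + n).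
Proof.
intros Hu; induction n as [|n IH].
- rewrite sum_O. apply term_le_sum_n; auto; lia.
- rewrite Nat.add_succ_r !sum_Sn; change plus with Rplus.
  replace (p + S n)%nat with (S (p + n)) by lia. lra.
Qed.

(** For the discs [kap_i] is a multiple of [weight al n] and [A_i] one of
    [kernel_sum al _ n], with [n = N + i] for the block [i >= 1], so the square
    sum is Schur's test [kernel_sum_square]. The block of the rectangle is a single
    term, for which the norm is enough. *)
Lemma form_projections_similar : exists W Winv : H -> H, bounded_inverse W Winv /\
  forall i f, W (form_projection i 1 (Winv f)) = form_projection i 0 f.
Proof.
set (kp := Cmod (/ two_pi_i)%C). assert (Hkp : 0 <= kp) by apply Cmod_ge_0.
set (l0 := contour_length (outer_contour 0)). assert (Hl0 : 0 <= l0) by apply contour_length_nonneg.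
set (l1 := contour_length (outer_contour 1)). assert (Hl1 : 0 <= l1) by apply contour_length_nonneg.
set (c0 := 1 + kp * l0 * 16). set (c1 := 1 + kp * l1 * (9 * Mb * 16)).
assert (Hc0 : 1 <= c0).
{ assert (0 <= kp * l0) by now apply Rmult_le_pos. unfold c0; lra. }
assert (Hc1 : 1 <= c1).
{ assert (0 <= kp * l1 * (9 * Mb * 16)) by (repeat apply Rmult_le_pos; lra). unfold c1; lra. }
set (D := 1 + 2 * decay_total al).
assert (HD : 1 <= D) by (pose proof (decay_total_nonneg al al_range); unfold D; lra).
set (A := fun i f => match i with O => c0 * norm f | S i => c1 * kernel_sum al (coord_abs f) (N + 1 + i) end).
set (kap := fun i => match i with O => c0 | S i => c1 * D * weight al (N + 1 + i) end).
assert (Hks : forall f n, 0 <= kernel_sum al (coord_abs f) n /\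
  kernel_sum al (coord_abs f) n <= D * weight al n * norm f).
{ intros f n.
  assert (H0 := kernel_sum_nonneg al al_range (coord_abs f) (fun k => Cmod_ge_0 _)
    (coord_square_summable H e e_expansion f) n).
  split; auto.
  destruct (kernel_sum_summable al al_range (coord_abs f) (fun k => Cmod_ge_0 _)
    (coord_square_summable H e e_expansion f) n) as [_ Hk].
  unfold coord_abs in Hk at 2. rewrite (Series_coord_square H e e_expansion) in Hk.
  pose proof (weight_pos al n) as Hw. pose proof (norm_ge_0 f) as Hf.
  assert (Hp : 0 <= D * weight al n * norm f) by (repeat apply Rmult_le_pos; lra).
  apply Rsqr_incr_0_var; auto. rewrite !Rsqr_pow2. apply Rle_trans with (1 := Hk).
  rewrite !Rpow_mult_distr. rewrite !Rmult_assoc. 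
  assert (0 <= weight al n ^ 2 * norm f ^ 2) by (apply Rmult_le_pos; apply pow2_ge_0).
  assert (2 * decay_total al <= D ^ 2) by (unfold D in *; nra). nra. }
assert (HAn : forall i f, 0 <= A i f).
{ intros [|i] f; simpl.
  - apply Rmult_le_pos; [lra|apply norm_ge_0].
  - apply Rmult_le_pos; [lra|apply Hks]. }
assert (Hkap : forall i, 0 <= kap i).
{ intros [|i]; simpl; [lra|]. pose proof (weight_pos al (N + 1 + i)). repeat apply Rmult_le_pos; lra. }
destruct (similar_0_1 H e e_orthonormal e_expansion form_projection A kap
  (c0 ^ 2 + c1 ^ 2 * D * (2 * decay_total al))) as [U [V0 [[LU [LV [UV VU]]] HU]]].
- pose proof (decay_total_nonneg al al_range). assert (0 <= c1 ^ 2 * D) by nra. nra.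
- intros i s Hs; now apply form_projection_linear.
- intros i j s f Hs. destruct (Nat.eq_dec i j) as [<-|Hne].
  + now apply form_projection_idempotent.
  + now apply form_projection_orthogonal.
- exact HAn.
- exact Hkap.
- intros i s s' f g Hs Hs'; destruct i as [|i]; simpl A.
  + apply Rle_trans with (Rabs (s - s') * (kp * l0 * (16 * norm f * norm g))).
    * apply form_projection_lipschitz; auto. intros z Hz.
      pose proof (dual_norm_product z (near_base_contraction z (outer_near 0 z Hz)) f g); lra.
    * rewrite (Rmult_assoc (Rabs (s - s')) (c0 * norm f)); apply Rmult_le_compat_l; [apply Rabs_pos|].
      pose proof (Rmult_le_pos _ _ (norm_ge_0 f) (norm_ge_0 g)).
      replace (kp * l0 * (16 * norm f * norm g)) with ((c0 - 1) * (norm f * norm g)) by (unfold c0; ring).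
      replace (c0 * norm f * (c0 * norm g)) with (c0 * c0 * (norm f * norm g)) by ring.
      apply Rmult_le_compat_r; auto; nra.
  + destruct (Hks f (N + 1 + i)%nat) as [F0 _]; destruct (Hks g (N + 1 + i)%nat) as [G0 _].
    set (Kf := kernel_sum al (coord_abs f) (N + 1 + i)) in *.
    set (Kg := kernel_sum al (coord_abs g) (N + 1 + i)) in *.
    apply Rle_trans with (Rabs (s - s') * (kp * l1 * (9 * Mb * (4 * Kf) * (4 * Kg)))).
    * apply (form_projection_lipschitz (S i)); auto. intros z Hz.
      pose proof (dual_norm_circle i z f Hz) as Df; pose proof (dual_norm_circle i z g Hz) as Dg.
      assert (Hz' := near_base_contraction z (outer_near (S i) z Hz)).
      pose proof (dual_norm_nonneg z Hz' f); pose proof (dual_norm_nonneg z Hz' g).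
      apply Rmult_le_compat; auto; [repeat apply Rmult_le_pos; lra|].
      apply Rmult_le_compat_l; auto; lra.
    * rewrite (Rmult_assoc (Rabs (s - s')) (c1 * Kf)); apply Rmult_le_compat_l; [apply Rabs_pos|].
      pose proof (Rmult_le_pos _ _ F0 G0).
      replace (kp * l1 * (9 * Mb * (4 * Kf) * (4 * Kg))) with ((c1 - 1) * (Kf * Kg)) by (unfold c1; ring).
      replace (c1 * Kf * (c1 * Kg)) with (c1 * c1 * (Kf * Kg)) by ring.
      apply Rmult_le_compat_r; auto; nra.
- intros [|i] f; simpl; [lra|]. destruct (Hks f (N + 1 + i)%nat) as [_ K1].
  replace (c1 * D * weight al (N + 1 + i) * norm f) with (c1 * (D * weight al (N + 1 + i) * norm f)) by ring.
  apply Rmult_le_compat_l; lra.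
- intros f n. apply Rle_trans with (1 := sum_n_head (fun i => (kap i * A i f) ^ 2) n (fun i => pow2_ge_0 _)).
  simpl kap; simpl A.
  set (u := fun k => (c1 ^ 2 * D) ^ 2 * (weight al k * kernel_sum al (coord_abs f) k) ^ 2).
  assert (Hu : sum_n (fun i => (c1 * D * weight al (N + 1 + i) * (c1 * kernel_sum al (coord_abs f) (N + 1 + i))) ^ 2) n
    <= (c1 ^ 2 * D) ^ 2 * ((2 * decay_total al) ^ 2 * norm f ^ 2)).
  { assert (Eq : forall i, (c1 * D * weight al (N + 1 + i) * (c1 * kernel_sum al (coord_abs f) (N + 1 + i))) ^ 2
      = u (N + 1 + i)%nat) by (intros; unfold u; ring).
    rewrite (sum_n_ext _ _ _ Eq).
    apply Rle_trans with (sum_n u (N + 1 + n)).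
    - apply sum_n_drop; intros; apply Rmult_le_pos; apply pow2_ge_0.
    - unfold u. rewrite (sum_n_mult_l (K := R_Ring) ((c1 ^ 2 * D) ^ 2) (fun k => (weight al k * kernel_sum al (coord_abs f) k) ^ 2)).
      apply Rmult_le_compat_l; [apply pow2_ge_0|].
      pose proof (kernel_sum_square al al_range (coord_abs f) (fun k => Cmod_ge_0 _)
        (coord_square_summable H e e_expansion f) (N + 1 + n)) as Hk.
      unfold coord_abs in Hk at 2. rewrite (Series_coord_square H e e_expansion) in Hk. exact Hk. }
  apply Rle_trans with ((c0 ^ 2 * norm f) ^ 2 + (c1 ^ 2 * D * (2 * decay_total al) * norm f) ^ 2).
  + replace (c0 * (c0 * norm f)) with (c0 ^ 2 * norm f) by ring. apply Rplus_le_compat_l.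
    apply Rle_trans with (1 := Hu); right; ring.
  + pose proof (norm_ge_0 f). pose proof (decay_total_nonneg al al_range).
    assert (0 <= c0 ^ 2 * norm f) by (apply Rmult_le_pos; [apply pow2_ge_0|auto]).
    assert (0 <= c1 ^ 2 * D * (2 * decay_total al) * norm f).
    { repeat apply Rmult_le_pos; auto; lra. }
    rewrite Rmult_plus_distr_r. nra.
- apply form_projection_0_square_sum.
- exact form_projection_0_complete.
- exists V0, U; split; [split; [|split; [|split]]|]; auto.
  intros i f; now rewrite -HU VU.
Qed.

(** ** The operator of the form *)

Section Operator.

Variable T : operator H.
Hypothesis T_iff : forall u w,
  (dom T u /\ T u = w) <-> (V u /\ forall y, V y -> Cplus (a u y) (b u y) = inner w y).

Lemma operator_weak_solution z u : dom T u ->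
  weak_solution 1 z u (minus (scal z u) (T u)).
Proof.
intros Hu; destruct (proj1 (T_iff u (T u)) (conj Hu eq_refl)) as [Vu Hy].
split; auto; intros y Vy. rewrite inner_minus_l inner_scal_l -Hy; auto. ring.
Qed.

Lemma weak_solution_operator z u f : weak_solution 1 z u f ->
  dom T u /\ minus (scal z u) (T u) = f.
Proof.
intros [Vu Hu].
destruct (proj2 (T_iff u (minus (scal z u) f))) as [Du Eu].
- split; auto; intros y Vy. rewrite inner_minus_l inner_scal_l -Hu; auto. ring.
- split; auto. apply inner_ext; intros y. rewrite inner_minus_l inner_scal_l Eu inner_minus_l inner_scal_l; ring.
Qed.

Lemma form_resolvent_is_resolvent z : contraction_point z -> is_resolvent H T z (form_resolvent 1 z).
Proof.
intros Hz. assert (Hs : 0 <= 1 <= 1) by lra. split; [|split].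
- now apply form_resolvent_linear.
- intros f; apply weak_solution_operator; now apply form_resolvent_spec.
- intros u Du; symmetry; apply form_resolvent_unique; auto. now apply operator_weak_solution.
Qed.

Lemma resolvent_form_resolvent z f : contraction_point z -> resolvent H T z f = form_resolvent 1 z f.
Proof.
intros Hz; assert (HR := form_resolvent_is_resolvent z Hz).
assert (HS : is_resolvent H T z (resolvent H T z))
  by exact (epsilon_spec (inhabits (fun _ : H => zero)) (is_resolvent H T z) (ex_intro _ _ HR)).
destruct HR as [_ [HR _]]; destruct HS as [_ [_ HS]].
destruct (HR f) as [D E]. specialize (HS _ D). rewrite E in HS. exact HS.
Qed.

Definition operator_projection (i : nat) : H -> H :=
  match i with
  | O => riesz_projection (rectangle_integral (- h) (m N + 1 / 2) (- h) h) T
  | S i => riesz_projection (circle_integral (RtoC (m (N + 1 + i)%nat)) (1 / 2)) T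
  end.

Lemma operator_projection_form i f : operator_projection i f = form_projection i 1 f.
Proof.
assert (Hs : 0 <= 1 <= 1) by lra.
assert (Hc : forall z, near_base z -> continuous_atH H (fun z => resolvent H T z f) z).
{ intros z Hz eps He.
  destruct (form_resolvent_continuous 1 Hs z f Hz eps He) as [d1 [D1 L1]].
  destruct (near_base_open z Hz) as [d2 [D2 L2]].
  exists (Rmin d1 d2); split; [now apply Rmin_pos|]; intros w Hw.
  rewrite !resolvent_form_resolvent; [|now apply near_base_contraction|].
  - apply L1, (Rlt_le_trans _ _ _ Hw (Rmin_l _ _)).
  - apply near_base_contraction, L2, (Rlt_le_trans _ _ _ Hw (Rmin_r _ _)). }
assert (E : forall y, contour_int (fun z => inner (resolvent H T z f) y) (outer_contour i)
  = contour_int (fun z => inner (form_resolvent 1 z f) y) (outer_contour i)).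
{ intros y; apply contour_int_ext; intros z Hz.
  rewrite resolvent_form_resolvent; auto. now apply near_base_contraction, (outer_near i). }
apply inner_ext; intros y. rewrite (form_projection_outer 1 Hs i f y) -E.
destruct i as [|i]; unfold operator_projection, riesz_projection; rewrite inner_scal_l; f_equal.
- apply inner_rectangle_integral; intros z Hz; apply Hc; now apply (outer_near 0).
- apply inner_circle_integral; intros z Hz; apply Hc; now apply (outer_near (S i)).
Qed.

Lemma operator_projections_similar :
  (exists W Winv : H -> H, bounded_inverse W Winv /\
    forall i f, W (operator_projection i (Winv f)) = form_projection i 0 f) /\ riesz_system operator_projection.
Proof.
destruct form_projections_similar as [W [Winv [HW HP]]].
assert (HR : forall i f, W (operator_projection i (Winv f)) = form_projection i 0 f).
{ intros i f; rewrite operator_projection_form; apply HP. }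
assert (Hs : 0 <= 0 <= 1) by lra.
split; [now exists W, Winv|].
exists W, Winv, (fun i => form_projection i 0).
split; [exact HW|split; [|split; [|split]]].
- intros i; split; [now apply form_projection_linear|split].
  + intros f; now apply form_projection_idempotent.
  + intros f g; apply form_projection_0_symmetric.
- intros i j Hij f; now apply form_projection_orthogonal.
- exact form_projection_0_series.
- intros j f. destruct HW as [_ [_ [_ HW]]]. now rewrite -HR !HW.
Qed.

End Operator.

End Form.

(** * The square root of [A] *)

Section SquareRoot.

Variable H : HilbertSpace.

Lemma self_adjoint_symmetric (A : operator H) u v : self_adjoint A -> dom A u -> dom A v ->
  inner (A u) v = inner u (A v).
Proof. intros [_ [_ HA]] Hu Hv. exact (proj1 (HA v (A v)) (conj Hv eq_refl) u Hu). Qed.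

(** For [p = B x - sqrt l x] the equation [B p = - sqrt l p] contradicts [B >= 0]
    unless [p = 0]. *)
Lemma sqrt_eigenvector (A B : operator H) (x : H) (l : R) :
  is_sqrt_op A B -> 1 <= l -> dom A x -> A x = scal (RtoC l : C_AbsRing) x ->
  dom B x /\ B x = scal (RtoC (sqrt l) : C_AbsRing) x.
Proof.
intros [HB [Hn [Hdom Happ]]] Hl Dx Ex.
destruct (proj1 (Hdom x) Dx) as [D1 D2]. split; auto.
destruct (proj1 HB) as [_ [Hplus Hscal]].
set (r := sqrt l). assert (Hr : 0 < r) by (apply sqrt_lt_R0; lra).
assert (Hr2 : r * r = l) by (apply sqrt_sqrt; lra).
destruct (Hscal (RtoC (- r)) x D1) as [D3 E3].
destruct (Hplus (B x) (scal (RtoC (- r) : C_AbsRing) x) D2 D3) as [D4 E4].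
set (p := plus (B x) (scal (RtoC (- r) : C_AbsRing) x) : H).
assert (Ep : B p = scal (RtoC (- r) : C_AbsRing) p).
{ unfold p; rewrite E4 E3 -Happ; auto. rewrite Ex.
  apply inner_ext; intros y. rewrite inner_scal_l !inner_plus_l !inner_scal_l -Hr2.
  rewrite RtoC_mult RtoC_opp; ring. }
assert (Hp0 : p = zero).
{ specialize (Hn p D4). rewrite Ep inner_scal_l inner_norm in Hn.
  apply inner_self_zero. rewrite inner_norm.
  assert (Hnn : 0 <= - r * norm p ^ 2) by (unfold Re in Hn; simpl in Hn; simpl; lra).
  pose proof (pow2_ge_0 (norm p)). replace (norm p ^ 2) with 0; auto. nra. }
apply inner_ext; intros y.
assert (Z : inner p y = 0) by (rewrite Hp0; apply inner_zero_l).
unfold p in Z; rewrite inner_plus_l inner_scal_l RtoC_opp in Z.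
rewrite inner_scal_l.
replace (inner (B x) y) with (inner (B x) y + - RtoC r * inner x y + RtoC r * inner x y)%C by ring.
rewrite Z; ring.
Qed.

End SquareRoot.

Section Instance.

Variables (H : HilbertSpace) (A sqrtA : operator H)
  (psi : nat -> H) (mu : nat -> R) (b : form H)
  (alpha Mb C2alpha D2alpha h : R) (N : nat).
Hypothesis psi_basis : orthonormal_basis psi.
Hypothesis psi_eigen : forall n : nat, (1 <= n)%nat ->
  dom A (psi n) /\ A (psi n) = scal (RtoC (mu n) : C_AbsRing) (psi n).
Hypothesis mu_1 : 1 <= mu 1%nat.
Hypothesis mu_gap : forall n : nat, (1 <= n)%nat -> 1 <= mu (n + 1)%nat - mu n.
Hypothesis sqrtA_sqrt : is_sqrt_op A sqrtA.
Hypothesis b_dom : forall u : H, fdom b u <-> fdom (form_of_sqrt sqrtA) u.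
Hypothesis b_sesquilinear : sesquilinear b.
Hypothesis b_matrix : determined_by_matrix psi b.
Hypothesis alpha_pos : 0 < alpha.
Hypothesis Mb_pos : 0 < Mb.
Hypothesis b_bound : forall m n : nat, (1 <= m)%nat -> (1 <= n)%nat ->
  Cmod (b (psi m) (psi n)) <= Mb / (Rpower (INR m) alpha * Rpower (INR n) alpha).
Hypothesis C_const : is_C_constant mu (2 * alpha) C2alpha.
Hypothesis D_const : is_D_constant (2 * alpha) D2alpha.
Hypothesis N_pos : (1 <= N)%nat.
Hypothesis N_choice : forall n : nat, (N < n)%nat -> Mb * C2alpha * sigma (2 * alpha) n <= 1 / 2.
Hypothesis h_gt1 : 1 < h.
Hypothesis h_choice : 2 * Mb * (1 / h * sum_n_m (fun k => Rpower (INR k) (- (2 * alpha))) 1 (N + 2)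
  + D2alpha * tau (2 * alpha) h) <= 1 / 2.

(* Indices are shifted to start at 0. *)
Let e (k : nat) : H := psi (S k).
Let m (k : nat) : R := mu (S k).
Let v (k : nat) : R := Rpower (INR (S k)) (- alpha).
Let V (u : H) : Prop := dom sqrtA u.
Let a (u w : H) : C := inner (sqrtA u) (sqrtA w).

Lemma e_orthonormal j k : inner (e j) (e k) = if Nat.eq_dec j k then RtoC 1 else RtoC 0.
Proof.
unfold e; rewrite (proj1 psi_basis); try lia.
destruct (Nat.eq_dec (S j) (S k)), (Nat.eq_dec j k); auto; lia.
Qed.

Lemma e_expansion f : is_series (fun k => scal (inner f (e k)) (e k)) f.
Proof. apply (proj2 psi_basis). Qed.

Lemma m_step k : 1 <= m (S k) - m k.
Proof. unfold m. pose proof (mu_gap (S k) ltac:(lia)) as Hg. now rewrite Nat.add_1_r in Hg. Qed.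

Lemma m_ge k : INR (S k) <= m k.
Proof.
induction k as [|k IH]; [exact mu_1|]. rewrite S_INR. pose proof (m_step k); lra.
Qed.

Lemma m_ge_one k : 1 <= m k.
Proof. pose proof (m_ge k); rewrite S_INR in H0; pose proof (pos_INR k); lra. Qed.

Lemma v_positive k : 0 < v k.
Proof. apply exp_pos. Qed.

Lemma v_square k : v k ^ 2 = / Rpower (INR (S k)) (2 * alpha).
Proof.
unfold v; rewrite -Rsqr_pow2; unfold Rsqr; rewrite -Rpower_plus -Rpower_Ropp. f_equal; ring.
Qed.

Lemma sqrtA_basis k : V (e k) /\ sqrtA (e k) = scal (RtoC (sqrt (m k)) : C_AbsRing) (e k).
Proof.
destruct (psi_eigen (S k) ltac:(lia)) as [D E].
apply (sqrt_eigenvector H A); auto. apply m_ge_one.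
Qed.

Lemma sqrtA_coord u k : V u -> inner (sqrtA u) (e k) = (RtoC (sqrt (m k)) * inner u (e k))%C.
Proof.
intros Vu; destruct (sqrtA_basis k) as [Ve Ee].
rewrite (self_adjoint_symmetric H sqrtA u (e k) (proj1 sqrtA_sqrt) Vu Ve) Ee inner_scal_r.
f_equal; apply injective_projections; simpl; ring.
Qed.

Lemma sqrt_m_square k : sqrt (m k) * sqrt (m k) = m k.
Proof. apply sqrt_sqrt. pose proof (m_ge_one k); lra. Qed.

Lemma V_iff_summable u : V u <-> ex_series (fun k => m k * Cmod (inner u (e k)) ^ 2).
Proof.
assert (Eq : forall z k, Cmod (RtoC (sqrt (m k)) * z)%C ^ 2 = m k * Cmod z ^ 2).
{ intros z k; rewrite Cmod_mult Cmod_R Rpow_mult_distr pow2_abs -{2}(sqrt_m_square k); ring. }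
split.
- intros Vu. apply ex_series_ext_R with (2 := coord_square_summable H e e_expansion (sqrtA u)).
  intros k; rewrite sqrtA_coord; auto.
- intros Hs.
  destruct (riesz_fischer H e e_orthonormal (fun k => RtoC (sqrt (m k)) * inner u (e k))%C) as [w Hw].
  { apply ex_series_ext_R with (2 := Hs); intros k; now rewrite Eq. }
  apply (proj2 (proj2 (proj1 sqrtA_sqrt)) u w). intros x Vx.
  apply is_series_C_unique with (1 := parseval_inner H e e_expansion (sqrtA x) u).
  apply (is_series_ext (V := C_NormedModule)) with (2 := parseval_inner H e e_expansion x w).
  intros k; rewrite Hw sqrtA_coord; auto. rewrite Cmult_conj.
  replace (Cconj (RtoC (sqrt (m k)))) with (RtoC (sqrt (m k))) by (apply injective_projections; simpl; ring).
  refine (_ : @eq C _ _); ring.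
Qed.

Lemma a_is_series u w : V u -> V w ->
  is_series (V := C_NormedModule) (fun k => RtoC (m k) * (inner u (e k) * Cconj (inner w (e k))))%C (a u w).
Proof.
intros Vu Vw.
apply (is_series_ext (V := C_NormedModule)) with (2 := parseval_inner H e e_expansion (sqrtA u) (sqrtA w)).
intros k; rewrite !sqrtA_coord; auto. rewrite Cmult_conj.
replace (Cconj (RtoC (sqrt (m k)))) with (RtoC (sqrt (m k))) by (apply injective_projections; simpl; ring).
replace (RtoC (m k)) with (RtoC (sqrt (m k)) * RtoC (sqrt (m k)))%C
  by (rewrite -RtoC_mult sqrt_m_square; reflexivity).
refine (_ : @eq C _ _); ring.
Qed.

Lemma b_domain u : V u -> fdom b u.
Proof. intros Vu; apply b_dom; exact Vu. Qed.

(** ** The weights *)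

Lemma weight_series_summable t : 0 <= t -> ex_series (fun k => v k ^ 2 / (INR (S k) + t)).
Proof.
intros Ht.
destruct D_const as [_ HD]; destruct (HD 2 ltac:(lra)) as [Hex _].
apply ex_series_dominated with (fun k => 3 * / (Rpower (INR (S k)) (2 * alpha) * (INR (S k) + 2))).
- intros k. rewrite v_square Rinv_mult.
  assert (Hk : 1 <= INR (S k)) by (rewrite S_INR; pose proof (pos_INR k); lra).
  assert (Hi : 0 < / Rpower (INR (S k)) (2 * alpha)) by (apply Rinv_0_lt_compat, exp_pos).
  split.
  + apply Rmult_le_pos; [lra|apply Rlt_le, Rinv_0_lt_compat; lra].
  + replace (3 * (/ Rpower (INR (S k)) (2 * alpha) * / (INR (S k) + 2)))
      with (/ Rpower (INR (S k)) (2 * alpha) * / ((INR (S k) + 2) / 3))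
      by (unfold Rdiv; rewrite Rinv_mult Rinv_inv; ring).
    apply Rmult_le_compat_l; [lra|]. apply Rinv_le_contravar; lra.
- now apply ex_series_scal_R.
Qed.

Lemma V_weight_summable u : V u -> ex_series (fun k => v k * Cmod (inner u (e k))).
Proof.
intros Vu; apply V_iff_summable in Vu.
destruct (series_cauchy_schwarz (fun k => v k * / sqrt (m k)) (fun k => sqrt (m k) * Cmod (inner u (e k)))) as [E _].
- intros k; apply Rmult_le_pos; [apply Rlt_le, v_positive|].
  apply Rlt_le, Rinv_0_lt_compat, sqrt_lt_R0. pose proof (m_ge_one k); lra.
- intros k; apply Rmult_le_pos; [apply sqrt_pos|apply Cmod_ge_0].
- apply ex_series_dominated with (2 := weight_series_summable 0 (Rle_refl 0)).
  intros k; split; [apply pow2_ge_0|].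
  pose proof (m_ge k); pose proof (m_ge_one k).
  assert (Hk : 1 <= INR (S k)) by (rewrite S_INR; pose proof (pos_INR k); lra).
  rewrite Rpow_mult_distr pow_inv pow2_sqrt; [|lra]. rewrite Rplus_0_r; unfold Rdiv.
  apply Rmult_le_compat_l; [apply pow2_ge_0|]. apply Rinv_le_contravar; lra.
- apply ex_series_ext_R with (2 := Vu).
  intros k; rewrite Rpow_mult_distr pow2_sqrt; [reflexivity|pose proof (m_ge_one k); lra].
- apply ex_series_ext_R with (2 := E). intros k; field.
  apply Rgt_not_eq, sqrt_lt_R0; pose proof (m_ge_one k); lra.
Qed.

Lemma b_weight_bound u w : V u -> V w ->
  Cmod (b u w) <= Mb * weight_norm H e v u * weight_norm H e v w.
Proof.
intros Vu Vw.
destruct (b_matrix u w (b_domain u Vu) (b_domain w Vw)) as [_ Hlim].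
set (c := fun j k => (inner u (psi (S j)) * Cconj (inner w (psi (S k))) * b (psi (S j)) (psi (S k)))%C).
set (qu := fun k => v k * Cmod (inner u (e k))). set (qw := fun k => v k * Cmod (inner w (e k))).
assert (Hqu : forall k, 0 <= qu k) by (intros; apply Rmult_le_pos; [apply Rlt_le, v_positive|apply Cmod_ge_0]).
assert (Hqw : forall k, 0 <= qw k) by (intros; apply Rmult_le_pos; [apply Rlt_le, v_positive|apply Cmod_ge_0]).
assert (Hc : forall j k, Cmod (c j k) <= Mb * qu j * qw k).
{ intros j k; unfold c; rewrite !Cmod_mult Cmod_conj.
  pose proof (b_bound (S j) (S k) ltac:(lia) ltac:(lia)) as Hb.
  replace (Mb / (Rpower (INR (S j)) alpha * Rpower (INR (S k)) alpha)) with (Mb * v j * v k) in Hb.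
  - unfold qu, qw, e.
    pose proof (Cmod_ge_0 (inner u (psi (S j)))); pose proof (Cmod_ge_0 (inner w (psi (S k)))).
    replace (Mb * (v j * Cmod (inner u (psi (S j)))) * (v k * Cmod (inner w (psi (S k)))))
      with (Cmod (inner u (psi (S j))) * Cmod (inner w (psi (S k))) * (Mb * v j * v k)) by ring.
    apply Rmult_le_compat_l; auto. now apply Rmult_le_pos.
  - unfold v. rewrite !Rpower_Ropp. unfold Rdiv; rewrite Rinv_mult; ring. }
assert (Hn : forall n, Cmod (sum_n (fun j => sum_n (fun k => c j k) n) n)
   <= Mb * weight_norm H e v u * weight_norm H e v w).
{ intros n. apply Rle_trans with (1 := Cmod_sum_n _ n).
  apply Rle_trans with (sum_n (fun j => Mb * qu j * sum_n qw n) n).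
  - apply sum_n_le_sum_n; intros j. apply Rle_trans with (1 := Cmod_sum_n _ n).
    apply Rle_trans with (sum_n (fun k => Mb * qu j * qw k) n); [now apply sum_n_le_sum_n|].
    right; exact (sum_n_mult_l (K := R_Ring) (Mb * qu j) qw n).
  - assert (E : sum_n (fun j => Mb * qu j * sum_n qw n) n = Mb * sum_n qu n * sum_n qw n).
    { transitivity (sum_n (fun j => Mb * qu j) n * sum_n qw n).
      - exact (sum_n_mult_r (K := R_Ring) (sum_n qw n) (fun j => Mb * qu j) n).
      - f_equal. exact (sum_n_mult_l (K := R_Ring) Mb qu n). }
    rewrite E.
    assert (S1 : sum_n qu n <= weight_norm H e v u) by (apply sum_n_le_Series; auto; now apply V_weight_summable).
    assert (S2 : sum_n qw n <= weight_norm H e v w) by (apply sum_n_le_Series; auto; now apply V_weight_summable).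
    pose proof (sum_n_nonneg qu n Hqu); pose proof (sum_n_nonneg qw n Hqw).
    apply Rmult_le_compat; auto; [apply Rmult_le_pos; lra|]. apply Rmult_le_compat_l; lra. }
apply Rnot_lt_le; intros Hlt.
set (M := Mb * weight_norm H e v u * weight_norm H e v w) in *.
pose proof (proj1 (filterlim_locally_ball_norm (U := C_NormedModule) (F := eventually) _ (b u w)) Hlim
  (mkposreal (Cmod (b u w) - M) ltac:(lra))) as [n0 Hn0].
specialize (Hn0 n0 (Nat.le_refl _)); specialize (Hn n0).
change (Cmod (sum_n (fun j => sum_n (fun k => c j k) n0) n0 - b u w)%C < Cmod (b u w) - M) in Hn0.
set (x := sum_n (fun j => sum_n (fun k => c j k) n0) n0 : C) in *.
pose proof (Cmod_triangle x (- (x - b u w))%C) as Ht.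
replace (x + - (x - b u w))%C with (b u w) in Ht by ring. rewrite Cmod_opp in Ht. lra.
Qed.

(** ** The contours lie in the resolvent set *)

Lemma resolvent_sum_eq z k :
  resolvent_sum m v z k = / (Rpower (INR (S k)) (2 * alpha) * Cmod (RtoC (mu (S k)) - z)%C).
Proof.
unfold resolvent_sum, Rdiv; rewrite v_square Rinv_mult.
replace (RtoC (mu (S k)) - z)%C with (- (z - RtoC (m k)))%C by (unfold m; ring). now rewrite Cmod_opp.
Qed.

Lemma Re_dist (z : C) (x : R) : Rabs (Re z - x) <= Cmod (z - RtoC x)%C.
Proof. apply (re_le_Cmod (z - RtoC x)%C). Qed.

Lemma Im_dist (z : C) (x : R) : Rabs (Im z) <= Cmod (z - RtoC x)%C.
Proof.
pose proof (im_le_Cmod (z - RtoC x)%C) as Hi. 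
replace (Im (z - RtoC x)%C) with (Im z) in Hi by (unfold Im; simpl; ring). exact Hi.
Qed.

Lemma base_strip n z : (N <= n)%nat ->
  m n - 1 / 2 <= Re z <= m (S n) - 1 / 2 -> 1 / 2 <= Cmod (z - RtoC (m n))%C -> base_point m v Mb z.
Proof.
intros Hn Hz Hd. split.
- intros k; destruct (Nat.lt_total k n) as [Hlt|[Heq|Hgt]].
  + pose proof (m_separated m m_step k n Hlt). apply Rle_trans with (2 := Re_dist z (m k)).
    rewrite Rabs_pos_eq; lra.
  + now subst.
  + assert (m (S n) <= m k).
    { destruct (Nat.eq_dec k (S n)) as [->|]; [lra|]. pose proof (m_separated m m_step (S n) k ltac:(lia)); lra. }
    apply Rle_trans with (2 := Re_dist z (m k)). rewrite Rabs_left1; lra.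
- destruct C_const as [_ HC].
  assert (Hin : mu (S n) - 1 / 2 <= Re z <= mu (S n + 1)%nat - 1 / 2).
  { rewrite Nat.add_1_r. exact Hz. }
  destruct (HC (S n) z ltac:(lia) Hin Hd) as [Hex HS].
  assert (Eq : forall k, / (Rpower (INR (S k)) (2 * alpha) * Cmod (RtoC (mu (S k)) - z)%C) = resolvent_sum m v z k)
    by (intros; now rewrite resolvent_sum_eq).
  split; [now apply ex_series_ext_R with (1 := Eq)|].
  rewrite -(Series_ext _ _ Eq).
  pose proof (N_choice (S n) ltac:(lia)) as HN. rewrite Rmult_assoc in HN.
  apply Rle_trans with (2 := HN). apply Rmult_le_compat_l; lra.
Qed.

Lemma base_circle n z : (N < n)%nat -> Cmod (z - RtoC (m n))%C = 1 / 2 -> base_point m v Mb z.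
Proof.
intros Hn Hz. pose proof (Re_dist z (m n)) as Hr. rewrite Hz in Hr. apply Rabs_le_between in Hr.
pose proof (m_step n). apply (base_strip n); try lia; lra.
Qed.

Lemma h_bounds : Mb * (sum_n (fun k => v k ^ 2) (N + 1) / h) + 2 * (Mb * (D2alpha * tau (2 * alpha) h)) <= 1 / 2
  /\ Mb * (D2alpha * tau (2 * alpha) h) <= 1 / 2.
Proof.
assert (Hs : sum_n_m (fun k => Rpower (INR k) (- (2 * alpha))) 1 (N + 2) = sum_n (fun k => v k ^ 2) (N + 1)).
{ unfold sum_n. replace (N + 2)%nat with (S (N + 1)) by lia. rewrite -sum_n_m_S.
  apply sum_n_m_ext; intros k. now rewrite v_square Rpower_Ropp. }
pose proof h_choice as Hh. rewrite Hs in Hh.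
assert (H0 : 0 <= sum_n (fun k => v k ^ 2) (N + 1)) by (apply sum_n_nonneg; intros; apply pow2_ge_0).
assert (H1 : 0 <= sum_n (fun k => v k ^ 2) (N + 1) / h).
{ apply Rmult_le_pos; auto. apply Rlt_le, Rinv_0_lt_compat; lra. }
assert (H2 : 0 <= D2alpha * tau (2 * alpha) h).
{ destruct D_const as [_ HD]; destruct (HD h h_gt1) as [Hex HS].
  apply Rle_trans with (2 := HS). apply Series_nonneg; auto. intros k.
  apply Rlt_le, Rinv_0_lt_compat, Rmult_lt_0_compat; [apply exp_pos|]. pose proof (pos_INR (S k)); lra. }
replace (1 / h * sum_n (fun k => v k ^ 2) (N + 1)) with (sum_n (fun k => v k ^ 2) (N + 1) / h) in Hh
  by (unfold Rdiv; ring).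
set (X := sum_n (fun k => v k ^ 2) (N + 1) / h) in *. set (Y := D2alpha * tau (2 * alpha) h) in *.
assert (0 <= Mb * X) by (apply Rmult_le_pos; lra). assert (0 <= Mb * Y) by (apply Rmult_le_pos; lra).
split; lra.
Qed.

Lemma D_series : ex_series (fun k => v k ^ 2 / (INR (S k) + h)) /\
  Series (fun k => v k ^ 2 / (INR (S k) + h)) <= D2alpha * tau (2 * alpha) h.
Proof.
destruct D_const as [_ HD]; destruct (HD h h_gt1) as [Hex HS].
assert (Eq : forall k, / (Rpower (INR (S k)) (2 * alpha) * (INR (S k) + h)) = v k ^ 2 / (INR (S k) + h)).
{ intros k; rewrite v_square Rinv_mult; reflexivity. }
split; [now apply ex_series_ext_R with (1 := Eq)|]. now rewrite -(Series_ext _ _ Eq).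
Qed.

Lemma base_left z : Re z = - h -> base_point m v Mb z.
Proof.
intros Hz.
assert (Hd : forall k, INR (S k) + h <= Cmod (z - RtoC (m k))%C).
{ intros k; pose proof (m_ge k). pose proof (pos_INR (S k)). apply Rle_trans with (2 := Re_dist z (m k)).
  rewrite Rabs_left1; lra. }
destruct D_series as [Hex HS].
assert (Hr : forall k, 0 <= resolvent_sum m v z k <= v k ^ 2 / (INR (S k) + h)).
{ intros k; specialize (Hd k); pose proof (pos_INR (S k)); pose proof (pow2_ge_0 (v k)).
  unfold resolvent_sum, Rdiv; split.
  - apply Rmult_le_pos; auto. apply Rlt_le, Rinv_0_lt_compat; lra.
  - apply Rmult_le_compat_l; auto. apply Rinv_le_contravar; lra. }
split; [|split].
- intros k; specialize (Hd k); pose proof (pos_INR (S k)); lra.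
- now apply ex_series_dominated with (1 := Hr).
- apply Rle_trans with (2 := proj2 h_bounds). apply Rmult_le_compat_l; [lra|].
  apply Rle_trans with (2 := HS). now apply Series_le.
Qed.

(** On the horizontal sides [|z - m_k| >= h] for all [k], and for [k = N + 2 + j]
    also [|z - m_k| >= j + 1]; half the sum of the two is [(j + 1 + h) / 2]. *)
Lemma base_horizontal z : Rabs (Im z) = h -> Re z <= m N + 1 / 2 -> base_point m v Mb z.
Proof.
intros Hi Hz.
assert (Hd : forall k, h <= Cmod (z - RtoC (m k))%C).
{ intros k; rewrite -Hi; apply Im_dist. }
assert (Hd2 : forall j, (INR (S j) + h) / 2 <= Cmod (z - RtoC (m (N + 2 + j)%nat))%C).
{ intros j. assert (INR (S j) <= m (N + 2 + j)%nat - m N - 1 / 2).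
  { induction j as [|j IH].
    - replace (N + 2 + 0)%nat with (S (S N)) by lia. pose proof (m_step N); pose proof (m_step (S N)).
      simpl; lra.
    - replace (N + 2 + S j)%nat with (S (N + 2 + j)) by lia. pose proof (m_step (N + 2 + j)).
      rewrite S_INR; lra. }
  specialize (Hd (N + 2 + j)%nat). pose proof (pos_INR (S j)).
  pose proof (Re_dist z (m (N + 2 + j)%nat)) as Hr. rewrite Rabs_left1 in Hr; lra. }
destruct D_series as [Hex HS].
assert (Hr0 : forall k, 0 <= resolvent_sum m v z k <= v k ^ 2 / h).
{ intros k; specialize (Hd k); pose proof (pow2_ge_0 (v k)); unfold resolvent_sum, Rdiv; split.
  - apply Rmult_le_pos; auto. apply Rlt_le, Rinv_0_lt_compat; lra.
  - apply Rmult_le_compat_l; auto. apply Rinv_le_contravar; lra. }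
assert (Hv : forall j, v (N + 2 + j)%nat ^ 2 <= v j ^ 2).
{ intros j; apply pow_incr; split; [apply Rlt_le, v_positive|]. unfold v.
  apply Rpower_neg_antitone; [lra|]. split; [apply lt_0_INR; lia|apply le_INR; lia]. }
assert (Hr : forall j, 0 <= resolvent_sum m v z (N + 2 + j)%nat <= 2 * (v j ^ 2 / (INR (S j) + h))).
{ intros j; split; [apply Hr0|]. specialize (Hd2 j); specialize (Hv j); pose proof (pos_INR (S j)).
  unfold resolvent_sum.
  replace (2 * (v j ^ 2 / (INR (S j) + h))) with (v j ^ 2 / ((INR (S j) + h) / 2)) by (field; lra).
  unfold Rdiv at 1 2. apply Rmult_le_compat; auto; [apply pow2_ge_0| |].
  - apply Rlt_le, Rinv_0_lt_compat; lra.
  - apply Rinv_le_contravar; lra. }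
assert (Htail : ex_series (fun j => resolvent_sum m v z (N + 2 + j)%nat)).
{ apply ex_series_dominated with (1 := Hr). now apply ex_series_scal_R. }
assert (Hsum : ex_series (resolvent_sum m v z)) by exact (proj2 (ex_series_incr_n _ (N + 2)) Htail).
split; [|split; auto].
- intros k; specialize (Hd k); lra.
- rewrite (Series_incr_n _ (N + 2)); [|lia|auto].
  rewrite -sum_n_Reals. replace (Init.Nat.pred (N + 2)) with (N + 1)%nat by lia.
  apply Rle_trans with (2 := proj1 h_bounds).
  rewrite Rmult_plus_distr_l; apply Rplus_le_compat.
  + apply Rmult_le_compat_l; [lra|]. unfold Rdiv.
    apply Rle_trans with (sum_n (fun k => v k ^ 2 * / h) (N + 1)); [apply sum_n_le_sum_n; intros k; apply Hr0|].
    right; exact (sum_n_mult_r (K := R_Ring) (/ h) (fun k => v k ^ 2) (N + 1)).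
  + rewrite -Rmult_assoc (Rmult_comm 2) Rmult_assoc; apply Rmult_le_compat_l; [lra|].
    apply Rle_trans with (Series (fun j => 2 * (v j ^ 2 / (INR (S j) + h)))).
    * apply Series_le; auto. now apply ex_series_scal_R.
    * rewrite Series_scal_l; lra.
Qed.

Lemma contours_base i z : on_contour (outer_contour m N h i) z -> base_point m v Mb z.
Proof.
pose proof (m_ge_one N) as HmN.
intros Hz; destruct i as [|i]; simpl in Hz.
- apply rectangle_points in Hz; try lra. destruct Hz as [Z1 [Z2 Z3]].
  destruct Z3 as [Z3|[Z3|[Z3|Z3]]].
  + now apply base_left.
  + apply (base_strip N); [lia| |].
    * pose proof (m_step N); lra.
    * apply Rle_trans with (2 := Re_dist z (m N)). rewrite Rabs_pos_eq; lra.
  + apply base_horizontal; [|lra]. rewrite Z3 Rabs_Ropp Rabs_pos_eq; lra.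
  + apply base_horizontal; [|lra]. rewrite Z3 Rabs_pos_eq; lra.
- apply circle_points in Hz; [|lra]. apply (base_circle (N + 1 + i)); auto; lia.
Qed.

Let T := form_operator (form_plus (form_of_sqrt sqrtA) b).

Lemma T_characterization u w :
  (dom T u /\ T u = w) <-> (V u /\ forall y, V y -> Cplus (a u y) (b u y) = inner w y).
Proof.
assert (Hrep : forall w, represents H (form_plus (form_of_sqrt sqrtA) b) u w <->
  (V u /\ forall y, V y -> Cplus (a u y) (b u y) = inner w y)).
{ intros w'; split.
  - intros [[Vu _] Hy]; split; auto. intros y Vy; apply Hy. split; auto; now apply b_domain.
  - intros [Vu Hy]; split.
    + split; auto; now apply b_domain.
    + intros y [Vy _]; now apply Hy. }
assert (Huniq : forall w1 w2, (forall y, V y -> Cplus (a u y) (b u y) = inner w1 y) ->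
  (forall y, V y -> Cplus (a u y) (b u y) = inner w2 y) -> w1 = w2).
{ intros w1 w2 H1 H2; apply (coord_ext H e e_expansion); intros k.
  destruct (sqrtA_basis k) as [Ve _]. now rewrite -H1 // -H2. }
split.
- intros [Du <-].
  apply Hrep. exact (epsilon_spec (inhabits zero) (represents H _ u) Du).
- intros Hw. assert (Du : dom T u) by (exists w; now apply Hrep). split; auto.
  apply Huniq; [|apply Hw].
  apply Hrep. exact (epsilon_spec (inhabits zero) (represents H _ u) Du).
Qed.

Lemma eigen_projection_formula (P : H -> H) n f : self_adjoint A -> (1 <= n)%nat ->
  eigen_projection A (RtoC (mu n)) P -> P f = scal (inner f (psi n)) (psi n).
Proof.
intros HA Hn [[_ [Pid Psym]] Pfix].
destruct n as [|n]; [lia|]. clear Hn.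
destruct (psi_eigen (S n) ltac:(lia)) as [Dn En].
assert (Pn : P (psi (S n)) = psi (S n)) by (apply Pfix; auto).
destruct (proj1 (Pfix (P f)) (Pid f)) as [DP EP].
apply (coord_ext H e e_expansion); intros k.
rewrite inner_scal_l. change (psi (S n)) with (e n). rewrite e_orthonormal.
destruct (Nat.eq_dec n k) as [<-|Hne].
- rewrite Psym. unfold e; rewrite Pn; ring.
- destruct (psi_eigen (S k) ltac:(lia)) as [Dk Ek].
  pose proof (self_adjoint_symmetric H A (P f) (psi (S k)) HA DP Dk) as E.
  rewrite EP Ek inner_scal_l inner_scal_r in E.
  replace (Cconj (RtoC (mu (S k)))) with (RtoC (mu (S k))) in E by (apply injective_projections; simpl; ring).
  assert (Hmu : mu (S n) <> mu (S k)).
  { change (m n <> m k). destruct (Nat.lt_total n k) as [Hlt|[Heq|Hgt]]; [|lia|].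
    - pose proof (m_separated m m_step n k Hlt); lra.
    - pose proof (m_separated m m_step k n Hgt); lra. }
  assert (Hz : (RtoC (mu (S n) - mu (S k)) * inner (P f) (e k) = 0)%C).
  { unfold e; rewrite RtoC_minus.
    replace ((RtoC (mu (S n)) - RtoC (mu (S k))) * inner (P f) (psi (S k)))%C
      with (RtoC (mu (S n)) * inner (P f) (psi (S k)) - RtoC (mu (S k)) * inner (P f) (psi (S k)))%C by ring.
    rewrite E; ring. }
  destruct (Ceq_dec (inner (P f) (e k)) 0) as [Hzero|Hnz]; [rewrite Hzero; ring|].
  exfalso; apply (Cmult_neq_0 _ _) in Hz; auto. intros Er; injection Er; lra.
Qed.

Lemma riesz_projections_similar (P0 : nat -> H -> H) :
  self_adjoint A ->
  (forall n : nat, (1 <= n)%nat -> eigen_projection A (RtoC (mu n)) (P0 n)) ->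
  (exists W Winv : H -> H, bounded_inverse W Winv /\
     (forall i f, W (operator_projection H m N h T (S i) (Winv f)) = P0 (N + 2 + i)%nat f) /\
     (forall f, W (operator_projection H m N h T 0 (Winv f)) = sum_n_m (fun n => P0 n f) 1 (N + 1))) /\
  riesz_system (operator_projection H m N h T).
Proof.
intros HA HP0.
(* Lowering the exponent only weakens the bound on [b], while the kernel estimates
   need an exponent of at most [1/3]. *)
set (al := Rmin alpha (1 / 4)).
assert (Hal : 0 < al <= 1 / 4).
{ unfold al; split; [apply Rmin_pos; lra|apply Rmin_r]. }
assert (Hv : forall k, v k <= weight al k).
{ intros k; unfold v, weight; rewrite S_INR. apply Rle_Rpower; [pose proof (pos_INR k); lra|].
  pose proof (Rmin_l alpha (1 / 4)); unfold al; lra. }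
destruct b_sesquilinear as [B1 [B2 [B3 B4]]].
assert (B1' : forall u u' w, V u -> V u' -> V w -> b (plus u u') w = Cplus (b u w) (b u' w))
  by (intros; apply B1; now apply b_domain).
assert (B2' : forall (c : C) u w, V u -> V w -> b (scal c u) w = Cmult c (b u w))
  by (intros; apply B2; now apply b_domain).
assert (B3' : forall u u' w, V u -> V u' -> V w -> b w (plus u u') = Cplus (b w u) (b w u'))
  by (intros; apply B3; now apply b_domain).
assert (B4' : forall (c : C) u w, V u -> V w -> b w (scal c u) = Cmult (Cconj c) (b w u))
  by (intros; apply B4; now apply b_domain).
destruct (operator_projections_similar H e e_orthonormal e_expansion m v V a b Mb m_ge_one v_positive Mb_pos
  V_iff_summable a_is_series B1' B2' B3' B4' V_weight_summable b_weight_bound N h m_step h_gt1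
  contours_base al Hal Hv T T_characterization) as [[W [Winv [HW HR]]] Hsys].
assert (Hcoord := form_projection_0_coord H e e_orthonormal e_expansion m v V a b Mb m_ge_one v_positive Mb_pos
  V_iff_summable a_is_series B1' B2' B3' B4' V_weight_summable b_weight_bound N h m_step h_gt1
  contours_base).
assert (HP : forall k f, P0 (S k) f = scal (inner f (e k)) (e k)).
{ intros k f; apply eigen_projection_formula; auto; [lia|apply HP0; lia]. }
split; auto. exists W, Winv; split; auto; split.
- intros i f; rewrite HR. replace (N + 2 + i)%nat with (S (N + 1 + i)) by lia. rewrite HP.
  apply (coord_ext H e e_expansion); intros k. rewrite Hcoord inner_scal_l e_orthonormal.
  destruct (Nat.eq_dec (k - N) (S i)), (Nat.eq_dec (N + 1 + i) k); try lia; [subst; ring|ring].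
- intros f; rewrite HR. replace (N + 1)%nat with (S N) by lia.
  rewrite -(sum_n_m_S (fun n => P0 n f)).
  rewrite (sum_n_m_ext _ (fun k => scal (inner f (e k)) (e k))); [|intros; apply HP].
  apply (coord_ext H e e_expansion); intros k. rewrite Hcoord.
  change (sum_n_m (fun k => scal (inner f (e k)) (e k)) 0 N) with (sum_n (fun k => scal (inner f (e k)) (e k)) N).
  destruct (Nat.eq_dec (k - N) 0).
  + rewrite (inner_sum_n_basis H e e_orthonormal (fun k => inner f (e k))); [reflexivity|lia].
  + symmetry; apply (inner_sum_n_m_basis H e e_orthonormal (fun k => inner f (e k)) 0 N k); lia.
Qed.

End Instance.

Theorem theorem3 (H : HilbertSpace) (A sqrtA : operator H)
  (psi : nat -> H) (mu : nat -> R) (b : form H)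
  (alpha Mb C2alpha D2alpha h : R) (N : nat) (P0 : nat -> H -> H)
  (A_self_adjoint : self_adjoint A)
  (psi_basis : orthonormal_basis psi)
  (psi_eigen : forall n : nat, (1 <= n)%nat ->
     dom A (psi n) /\ A (psi n) = scal (RtoC (mu n) : C_AbsRing) (psi n))
  (mu_1 : 1 <= mu 1%nat)
  (mu_gap : forall n : nat, (1 <= n)%nat -> 1 <= mu (n + 1)%nat - mu n)
  (sqrtA_sqrt : is_sqrt_op A sqrtA)
  (b_dom : forall u : H, fdom b u <-> fdom (form_of_sqrt sqrtA) u)
  (b_sesquilinear : sesquilinear b)
  (b_matrix : determined_by_matrix psi b)
  (alpha_pos : 0 < alpha) (Mb_pos : 0 < Mb)
  (b_bound : forall m n : nat, (1 <= m)%nat -> (1 <= n)%nat ->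
     Cmod (b (psi m) (psi n))
     <= Mb / (Rpower (INR m) alpha * Rpower (INR n) alpha))
  (C_const : is_C_constant mu (2 * alpha) C2alpha)
  (D_const : is_D_constant (2 * alpha) D2alpha)
  (N_pos : (1 <= N)%nat)
  (N_choice : forall n : nat, (N < n)%nat ->
     Mb * C2alpha * sigma (2 * alpha) n <= 1 / 2)
  (h_gt1 : 1 < h)
  (h_choice :
     2 * Mb * (1 / h * sum_n_m (fun k => Rpower (INR k) (- (2 * alpha)))
                               1 (N + 2)
               + D2alpha * tau (2 * alpha) h) <= 1 / 2)
  (P0_spectral : forall n : nat, (1 <= n)%nat ->
     eigen_projection A (RtoC (mu n)) (P0 n)) :
  let T := form_operator (form_plus (form_of_sqrt sqrtA) b) in
  let SN := riesz_projection
              (rectangle_integral (- h) (mu (N + 1)%nat + 1 / 2) (- h) h) T in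
  let P := fun n : nat =>
             riesz_projection (circle_integral (RtoC (mu n)) (1 / 2)) T in
  (exists W Winv : H -> H,
     bounded_inverse W Winv /\
     (forall n : nat, (N + 1 < n)%nat ->
        forall f : H, W (P n (Winv f)) = P0 n f) /\
     (forall f : H, W (SN (Winv f)) = sum_n_m (fun n => P0 n f) 1 (N + 1))) /\
  riesz_system (fun j => match j with
                         | O => SN
                         | S k => P (N + 2 + k)%nat
                         end).
Proof.
intros T SN P.
destruct (riesz_projections_similar H A sqrtA psi mu b alpha Mb C2alpha D2alpha h N psi_basis psi_eigen mu_1 mu_gap
  sqrtA_sqrt b_dom b_sesquilinear b_matrix alpha_pos Mb_pos b_bound C_const D_const N_pos N_choice
  h_gt1 h_choice P0 A_self_adjoint P0_spectral) as [[W [Winv [HW [HP HS]]]] Hsys].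
assert (E0 : operator_projection H (fun k => mu (S k)) N h T 0 = SN).
{ unfold SN, operator_projection; now rewrite Nat.add_1_r. }
assert (ES : forall i, operator_projection H (fun k => mu (S k)) N h T (S i) = P (N + 2 + i)%nat).
{ intros i; unfold P, operator_projection. now replace (N + 2 + i)%nat with (S (N + 1 + i)) by lia. }
split.
- exists W, Winv; split; [exact HW|split].
  + intros n Hn f. replace n with (N + 2 + (n - (N + 2)))%nat by lia. rewrite -ES; apply HP.
  + intros f; rewrite -E0; apply HS.
- destruct Hsys as [W' [Winv' [Q [HW' [HQ [HQQ [HQs HQP]]]]]]].
  exists W', Winv', Q; do 4 (split; [assumption|]).
  intros [|j] f; rewrite -HQP; [now rewrite E0|now rewrite ES].
Qed.
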